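(* Let $p\ge2$ and assume that $\overline z_p<\infty$ and that $k_2$ and $k_p$ are Borel measurable with $k_2,k_p\in L^1([0,T])$. Suppose in addition that there exist $\beta\in(0,1]$, a constant $C_\phi\ge0$ and non-negative functions $h_q\in L^q([0,T])$, $q\in\{1,2,p\}$, such that for all $x,x'\in E$, $$\sup_{t\in[0,T]}|\phi_t(x)-\phi_t(x')|\le C_\phi\,d_E(x,x')^\beta,$$ $$\left(\int_E|K(r,x,y)-K(r,x',y)|^q\,m(dy)\right)^{1/q}\le h_q(r)\,d_E(x,x')^\beta,\qquad r\in(0,T],\ q\in\{1,2,p\}.$$ Finally, suppose that $(E,d_E)$ is compact, that there exist constants $c,D>0$ such that $\mathcal N(E,\varepsilon)\le c\,\varepsilon^{-D}$ for all $\varepsilon\in(0,1]$, where $\mathcal N(E,\varepsilon)$ is the minimal number of closed $d_E$-balls of radius $\varepsilon$ needed to cover $E$, and that $\beta p>D$. Then, for every $t\in[0,T]$, the spatial field $x\mapsto V_t(x)$ admits a modification which is almost surely $\alpha$-Hölder continuous for every $\alpha\in(0,\beta-D/p)$, and this modification can be chosen simultaneously for all such $\alpha$.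
   Context: Fix a complete probability space $(\Omega,\mathcal F,\mathbb P)$, a horizon $T>0$, and a Polish space $E$ with Borel $\sigma$-algebra $\mathcal E$, a finite Borel measure $m$, and a metric $d_E$ compatible with the topology of $E$. Write $\mathbb R_+=[0,\infty)$. Let $\ell$ be a Borel measure supported on $(0,\infty)$ with $\overline z:=\int_0^\infty z\,\ell(dz)<\infty$, and let $N$ be a Poisson random measure on $[0,T]\times E\times\mathbb R_+\times\mathbb R_+$ with intensity $ds\,m(dy)\,\ell(dz)\,du$. Let $\mathcal F_t^0$ be generated by $N((0,s]\times B)$, $s\le t$, $B$ Borel, augmented with all $\mathbb P$-null sets, and put $\mathcal F_t^N=\bigcap_{r\in(t,T]}\mathcal F_r^0$ for $t<T$, $\mathcal F_T^N=\mathcal F_T^0$. The predictable $\sigma$-algebra $\mathcal P$ on $\Omega\times[0,T]\times E$ is generated by the sets $A_0\times\{0\}\times B$ and $A\times(s,t]\times B$ with $A_0\in\mathcal F_0^N$, $A\in\mathcal F_s^N$, $B\in\mathcal E$; a field is predictable if it is $\mathcal P$-measurable. $K:(0,T]\times E\times E\to\mathbb R_+$ is an admissible kernel: Borel, with $k(r):=\sup_{x}\int_EK(r,x,y)\,m(dy)$ Borel measurable and in $L^1((0,T])$. $\lambda_0,\lambda_1\ge0$ are constants, $\phi:[0,T]\times E\to\mathbb R_+$ is bounded and measurable. For $q\ge1$: $\overline z_q:=\int_0^\infty z^q\,\ell(dz)$ and $k_q(r):=\sup_{x\in E}\int_EK(r,x,y)^q\,m(dy)$. $V$ is the non-negative predictable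 field (with values in $[0,\infty]$, a.s. finite at each $(t,x)$, unique up to modification) with $\sup_{(t,x)}\mathbb E[V_t(x)]<\infty$ such that, for every $(t,x)\in[0,T]\times E$, almost surely $V_t(x)=\phi_t(x)+\int_{(0,t)\times E\times\mathbb R_+\times\mathbb R_+}K(t-s,x,y)\,z\,\mathbf 1_{\{u\le\lambda_0+\lambda_1V_s(y)\}}N(ds,dy,dz,du)$. For fixed $t$, a modification of $x\mapsto V_t(x)$ is a real-valued field $(\widehat V(x))_{x\in E}$ with $\mathbb P(\widehat V(x)=V_t(x))=1$ for every $x\in E$. *)

(* Defs.v *)
From HB Require Import structures.
From mathcomp Require Import all_boot all_order all_algebra.
From mathcomp Require Import all_classical all_reals all_analysis.
From mathcomp Require Import measurable_realfun.

Set Implicit Arguments.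
Unset Strict Implicit.
Unset Printing Implicit Defensive.

Import Order.TTheory GRing.Theory Num.Theory.
Import numFieldNormedType.Exports.

Local Open Scope classical_set_scope.
Local Open Scope ring_scope.
Local Open Scope ereal_scope.

(* The library requires a point on every type that carries a sigma-algebra. *)
#[short(type="pmetricType")]
HB.structure Definition PointedMetric (K : numDomainType) :=
  { M of Metric K M & isPointed M }.

Notation borel E := (g_sigma_algebraType (@open E)).

Section metric_spaces.
Local Open Scope ring_scope.
Context {R : realType}.

Definition is_metric (T : Type) (rho : T -> T -> R) : Prop :=
  [/\ forall x y, 0 <= rho x y,
      forall x y, rho x y = 0 <-> x = y,
      forall x y, rho x y = rho y x
    & forall x y z, rho x z <= rho x y + rho y z].

Definition metric_induces_topology (T : topologicalType) (rho : T -> T -> R)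
    : Prop :=
  forall A : set T, open A <->
    (forall x, A x -> exists2 e, 0 < e & forall y, rho x y < e -> A y).

Definition complete_metric (T : Type) (rho : T -> T -> R) : Prop :=
  forall u : nat -> T,
    (forall e, 0 < e -> exists n, forall i j,
       (n <= i)%N -> (n <= j)%N -> rho (u i) (u j) < e) ->
    exists l, forall e, 0 < e -> exists n, forall i,
       (n <= i)%N -> rho (u i) l < e.

Definition polish (T : topologicalType) : Prop :=
  (exists2 D : set T, countable D & dense D) /\
  exists rho : T -> T -> R,
    [/\ is_metric rho, metric_induces_topology rho & complete_metric rho].

Variable E : metricType R.

(* The library's closed_ball is the closure of the open ball, which in a
   general metric space is smaller than this set. *)
Definition closed_mball (x : E) (e : R) : set E := [set y | mdist x y <= e].

(* Equal to +oo when no finite cover exists. *)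
Definition covering_number (e : R) : \bar R :=
  ereal_inf [set n%:R%:E | n in [set n : nat | exists c : 'I_n -> E,
    [set: E] `<=` \bigcup_i closed_mball (c i) e]].

Definition holder_continuous (a : R) (f : E -> R) : Prop :=
  exists C : R, forall x y, `|f x - f y| <= C * mdist x y `^ a.

End metric_spaces.

Arguments polish R T : clear implicits.
Arguments covering_number {R} E e.

Section Poisson_random_measure.
Context {R : realType} d {Omega : measurableType d} (P : probability Omega R).
Context dX {X : measurableType dX}.

(* A random measure on the measurable subset S of X is encoded as a family of
   measures on X of which only the values on subsets of S are used. *)
Definition poisson_random_measure (S : set X) (nu : set X -> \bar R)
    (N : Omega -> {measure set X -> \bar R}) : Prop :=
  [/\ forall A, measurable A -> A `<=` S ->
        measurable_fun [set: Omega] (fun w => N w A),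
      forall A w, measurable A -> A `<=` S ->
        N w A = +oo \/ exists k : nat, N w A = k%:R%:E,
      forall A, measurable A -> A `<=` S -> nu A < +oo ->
        (* the second argument of poisson_prob plays no role *)
        forall k : nat,
          P [set w | N w A = k%:R%:E] = poisson_prob (fine (nu A)) k [set k],
      forall A, measurable A -> A `<=` S -> nu A = +oo ->
        P [set w | N w A = +oo] = 1
    & forall (n : nat) (A : 'I_n -> set X) (B : 'I_n -> set (\bar R)),
        (forall i, measurable (A i) /\ A i `<=` S) ->
        trivIset [set: 'I_n] A ->
        (forall i, measurable (B i)) ->
        P (\bigcap_i [set w | B i (N w (A i))]) =
        \prod_(i < n) P [set w | B i (N w (A i))]].

End Poisson_random_measure.

Section volterra_field.
Context {R : realType} {E : pmetricType R}.
Variables (T : R) (m : {finite_measure set (borel E) -> \bar R}).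
Variable l : {measure set R -> \bar R}.

Local Notation leb := (@lebesgue_measure R).

(* The coordinates (s, y, z, u) of a mark. *)
Local Notation mark := (R * borel E * R * R)%type.

Definition marks : set mark :=
  [set a | [/\ (0 <= a.1.1.1 <= T)%R, (0 <= a.1.2)%R & (0 <= a.2)%R]].

Definition marks_before (t : R) : set mark :=
  [set a | [/\ (0 < a.1.1.1 < t)%R, (0 <= a.1.2)%R & (0 <= a.2)%R]].

(* ds m(dy) l(dz) du; the operators \x and \x^ agree on sigma-finite measures,
   and \x^ is the one that is a measure without sigma-finiteness of its right
   factor being declared. *)
Definition intensity : set mark -> \bar R :=
  ((leb \x m) \x^ l) \x leb.

Context d (Omega : measurableType d) (P : probability Omega R).
Variable N : Omega -> {measure set mark -> \bar R}.

(* (0, s] x B, for B a Borel subset of E x R_+ x R_+ *)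
Definition slab (s : R) (B : set (borel E * R * R)) : set mark :=
  [set a | (0 < a.1.1.1 <= s)%R /\ B (a.1.1.2, a.1.2, a.2)].

Definition raw_filtration (t : R) : set (set Omega) :=
  <<s [set F | exists (s : R) (B : set (borel E * R * R)) (C : set (\bar R)),
         [/\ (0 <= s <= t)%R, measurable B,
             B `<=` [set b | (0 <= b.1.2)%R /\ (0 <= b.2)%R],
             measurable C
           & F = [set w | C (N w (slab s B))]]]
      `|` [set F | P.-negligible F] >>.

Definition filtration (t : R) : set (set Omega) :=
  if (t < T)%R then \bigcap_(r in `]t, T]) raw_filtration r
  else raw_filtration T.

Definition predictable_sets : set (set (Omega * R * borel E)) :=
  <<s [set a | (0 <= a.1.2 <= T)%R],
      [set F | exists (A : set Omega) (B : set (borel E)),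
         [/\ filtration 0 A, measurable B & F = A `*` [set 0%R] `*` B]]
      `|` [set F | exists (s t : R) (A : set Omega) (B : set (borel E)),
         [/\ (0 <= s < t)%R /\ (t <= T)%R, filtration s A, measurable B
           & F = A `*` `]s, t] `*` B]] >>.

Definition predictable (V : R -> E -> Omega -> \bar R) : Prop :=
  forall C : set (\bar R), measurable C ->
    predictable_sets
      [set a | (0 <= a.1.2 <= T)%R /\ C (V a.1.2 a.2 a.1.1)].

Variable K : R -> E -> E -> R.

Definition kernel_sup (q r : R) : \bar R :=
  ereal_sup (range (fun x : E => \int[m]_y (K r x y `^ q)%:E)).

Definition admissible_kernel : Prop :=
  [/\ forall r x y, (0 < r <= T)%R -> (0 <= K r x y)%R,
      measurable_fun [set a : R * borel E * borel E | (0 < a.1.1 <= T)%R]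
        (fun a => K a.1.1 a.1.2 a.2)
    & leb.-integrable `]0%R, T]
        (fun r => ereal_sup (range (fun x : E => \int[m]_y (K r x y)%:E)))].

Variables (lambda0 lambda1 : R) (phi : R -> E -> R).

Definition initial_field : Prop :=
  [/\ forall t x, (0 <= t <= T)%R -> (0 <= phi t x)%R,
      exists M : R, forall t x, (0 <= t <= T)%R -> (phi t x <= M)%R
    & measurable_fun [set a : R * borel E | (0 <= a.1 <= T)%R]
        (fun a => phi a.1 a.2)].

Definition volterra_solution (V : R -> E -> Omega -> \bar R) : Prop :=
  [/\ predictable V,
      forall t x w, (0 <= t <= T)%R -> 0 <= V t x w,
      forall t x, (0 <= t <= T)%R -> {ae P, forall w, V t x w < +oo},
      ereal_sup [set \int[P]_w V a.1 a.2 w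
                | a in [set a : R * E | (0 <= a.1 <= T)%R]] < +oo
    & forall t x, (0 <= t <= T)%R -> {ae P, forall w,
        V t x w = (phi t x)%:E +
          \int[N w]_(a in marks_before t)
            (K (t - a.1.1.1) x a.1.1.2 * a.1.2 *
             (a.2%:E <= lambda0%:E + lambda1%:E * V a.1.1.1 a.1.1.2 w)%E%:R)%:E}].

Definition spatial_modification (V : R -> E -> Omega -> \bar R) (t : R)
    (W : E -> Omega -> R) : Prop :=
  (forall x, measurable_fun [set: Omega] (W x)) /\
  forall x, P [set w | (W x w)%:E = V t x w] = 1.

(* Membership in L^q(D) for a real exponent q, up to a.e. equality. *)
Definition in_Lq (q : R) (D : set R) (h : R -> R) : Prop :=
  measurable_fun D h /\ \int[leb]_(r in D) (`|h r| `^ q)%:E < +oo.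

End volterra_field.

(* Main.v *)
(* The increment V_t(x) - V_t(x') is dominated by the integral, against the thinned Poisson
   measure, of |K(., x, .) - K(., x', .)|, so it suffices to bound p-th moments of integrals of
   non-negative predictable integrands. These are controlled by the p-th moment of the
   compensator and the mean of the integral of the p-th power, and Jensen's inequality with
   respect to the kernel reduces both to moments of the intensity lambda0 + lambda1 V.
   Applied to V itself this gives a Volterra inequality, hence by a weighted Gronwall argument
   sup E V^p < oo; applied to the kernel differences it gives
   E |V_t(x) - V_t(x')|^p <= C d(x, x')^(beta p).
   Kolmogorov's criterion on a space with N(E, e) <= c e^-D then yields the exponents below
   beta - D / p: the number of pairs of net points to control at scale 2^-k is brought down from
   N^2 to N^(1 + o(1)), and the modification is the limit along nearest net points. *)

Require Import Defs.
From HB Require Import structures.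
From mathcomp Require Import all_boot all_order all_algebra finmap.
From mathcomp Require Import all_classical all_reals all_analysis.
From mathcomp Require Import measurable_realfun.
From mathcomp Require Import ring lra.

Set Implicit Arguments.
Unset Strict Implicit.
Unset Printing Implicit Defensive.

Import Order.TTheory GRing.Theory Num.Theory.
Import numFieldNormedType.Exports.

Local Open Scope classical_set_scope.
Local Open Scope ring_scope.
Local Open Scope ereal_scope.

(** * Truncated powers *)

Section truncated_power.
Local Open Scope ring_scope.
Context {R : realType}.
Variables (p M : R).
Hypotheses (hp : 1 <= p) (hM : 0 < M).

(* [tpsi] replaces the power [v `^ p] by a function of linear growth, so that its
   moments are finite a priori; all estimates are uniform in the level [M]. *)
Definition tpow (v : R) : R := Num.min v M `^ (p - 1).
Definition tpsi (v : R) : R := v * tpow v.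

Let p1 : 0 <= p - 1. Proof. by rewrite subr_ge0. Qed.

Lemma tpow_ge0 v : 0 <= tpow v. Proof. exact: powR_ge0. Qed.

Lemma tpow_le_pow v : 0 <= v -> tpow v <= v `^ (p - 1).
Proof.
move=> v0; apply: ge0_ler_powR => //.
- by rewrite nnegrE le_min v0 ltW.
- by rewrite ge_min lexx.
Qed.

Lemma tpow_le_cst v : 0 <= v -> tpow v <= M `^ (p - 1).
Proof.
move=> v0; apply: ge0_ler_powR => //.
- by rewrite nnegrE le_min v0 ltW.
- by rewrite nnegrE ltW.
- by rewrite ge_min lexx orbT.
Qed.

Lemma tpow_mono u v : 0 <= u -> u <= v -> tpow u <= tpow v.
Proof.
move=> u0 uv; apply: ge0_ler_powR => //.
- by rewrite nnegrE le_min u0 ltW.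
- by rewrite nnegrE le_min (le_trans u0 uv) ltW.
- by rewrite le_min !ge_min uv lexx /= orbT.
Qed.

Lemma tpow_scale c v : 1 <= c -> 0 <= v -> tpow (c * v) <= c `^ (p - 1) * tpow v.
Proof.
move=> c1 v0; have c0 : 0 <= c by lra.
have m0 : 0 <= Num.min v M by rewrite le_min v0 ltW.
rewrite /tpow -powRM //; apply: ge0_ler_powR => //.
- by rewrite nnegrE le_min mulr_ge0 // ltW.
- by rewrite nnegrE mulr_ge0.
- case: (leP v M) => vM; rewrite ge_min ?lexx //.
  by rewrite ler_peMl ?orbT // ltW.
Qed.

Lemma tpow_tangent y v : 0 <= y -> 0 <= v -> (v - y) * tpow y <= v * tpow v.
Proof.
move=> y0 v0; case: (leP v y) => vy.
  apply: (@le_trans _ _ 0); last by rewrite mulr_ge0 // tpow_ge0.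
  by rewrite mulr_le0_ge0 ?tpow_ge0 // subr_le0.
apply: ler_pM; rewrite ?tpow_ge0 ?subr_ge0 ?(ltW vy) //; first by rewrite gerBl.
by apply: tpow_mono => //; exact: ltW.
Qed.

Lemma tpow_add a b : 0 <= a -> 0 <= b -> tpow (a + b) <= 2 `^ (p - 1) * (tpow a + tpow b).
Proof.
move=> a0 b0; wlog ab : a b a0 b0 / a <= b => [H|].
  by case: (leP a b) => [|/ltW] ab; [|rewrite addrC [tpow a + _]addrC]; exact: H.
apply: (@le_trans _ _ (tpow (2 * b))).
  by apply: tpow_mono; [rewrite addr_ge0|lra].
apply: (le_trans (tpow_scale _ b0)); first by lra.
by rewrite ler_wpM2l ?powR_ge0 // lerDr tpow_ge0.
Qed.

Lemma tpsi_ge0 v : 0 <= v -> 0 <= tpsi v.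
Proof. by move=> v0; rewrite mulr_ge0 // tpow_ge0. Qed.

Lemma tpsi_mono u v : 0 <= u -> u <= v -> tpsi u <= tpsi v.
Proof. by move=> u0 uv; rewrite ler_pM // ?tpow_ge0 // tpow_mono. Qed.

Let mulrpow c : 0 <= c -> c * c `^ (p - 1) = c `^ p.
Proof. by move=> c0; rewrite mulr_powRB1 // (lt_le_trans _ hp). Qed.

Lemma tpsi_scale c v : 1 <= c -> 0 <= v -> tpsi (c * v) <= c `^ p * tpsi v.
Proof.
move=> c1 v0; have c0 : 0 <= c by lra.
rewrite /tpsi -mulrpow // mulrACA ler_wpM2l ?mulr_ge0 //.
exact: tpow_scale.
Qed.

Lemma tpsi_add a b : 0 <= a -> 0 <= b -> tpsi (a + b) <= 2 `^ p * (tpsi a + tpsi b).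
Proof.
move=> a0 b0; wlog ab : a b a0 b0 / a <= b => [H|].
  by case: (leP a b) => [|/ltW] ab; [|rewrite addrC [tpsi a + _]addrC]; exact: H.
apply: (@le_trans _ _ (tpsi (2 * b))).
  by apply: tpsi_mono; [rewrite addr_ge0|lra].
apply: (le_trans (tpsi_scale _ b0)); first by lra.
by rewrite ler_wpM2l ?powR_ge0 // lerDr tpsi_ge0.
Qed.

Lemma tpsi_le_pow v : 0 <= v -> tpsi v <= v `^ p.
Proof. by move=> v0; rewrite -mulrpow // ler_wpM2l // tpow_le_pow. Qed.

Lemma tpsi_le_lin v : 0 <= v -> tpsi v <= M `^ (p - 1) * v.
Proof. by move=> v0; rewrite /tpsi mulrC ler_wpM2r // tpow_le_cst. Qed.

Lemma tpsi_eq_pow v : 0 <= v -> v <= M -> tpsi v = v `^ p.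
Proof. by move=> v0 vM; rewrite /tpsi /tpow min_l // mulrpow. Qed.

Lemma measurable_tpow : measurable_fun [set: R] tpow.
Proof.
apply: (measurableT_comp (measurable_powR (p - 1))).
exact: measurable_minr.
Qed.

Lemma measurable_tpsi : measurable_fun [set: R] tpsi.
Proof. by apply: measurable_funM => //; exact: measurable_tpow. Qed.

Lemma tpow_young c x a : 1 <= c -> 0 <= x -> 0 <= a ->
  c * (tpow x * a) <= 2^-1 * tpsi x + c * (2 * c) `^ (p - 1) * tpsi a.
Proof.
move=> c1 x0 a0; case: (leP (2 * c * a) x) => ax.
  have -> : c * (tpow x * a) = 2^-1 * (2 * c * a * tpow x) by field.
  apply: ler_wpDr; last by rewrite ler_wpM2l ?invr_ge0 // /tpsi ler_wpM2r ?tpow_ge0.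
  by rewrite !mulr_ge0 ?powR_ge0 ?tpow_ge0 //; lra.
apply: ler_wpDl; first by rewrite mulr_ge0 // tpsi_ge0.
rewrite -mulrA ler_wpM2l //; first by lra.
rewrite /tpsi [a * _]mulrC mulrA ler_wpM2r //.
apply: (le_trans (tpow_mono x0 (ltW ax))).
by apply: tpow_scale => //; lra.
Qed.

Lemma sum_tpow_tangent (xi : nat -> R) n y : (forall i, 0 <= xi i) -> 0 <= y ->
  (\sum_(i < n) xi i - y) * tpow y <=
  \sum_(i < n) tpow (\sum_(j < i.+1) xi j) * xi i.
Proof.
move=> xi0 y0; elim: n => [|n IH].
  by rewrite !big_ord0 sub0r mulNr oppr_le0 mulr_ge0 // tpow_ge0.
rewrite [X in _ <= X]big_ord_recr /= [X in (X - _)]big_ord_recr /=.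
set S := \sum_(i < n) xi i in IH *.
have Sn : \sum_(j < n.+1) xi j = S + xi n by rewrite big_ord_recr.
have RHS0 : 0 <= \sum_(i < n) tpow (\sum_(j < i.+1) xi j) * xi i.
  by apply: sumr_ge0 => i _; rewrite mulr_ge0 // tpow_ge0.
rewrite Sn; case: (leP (S + xi n) y) => Sy.
  apply: (@le_trans _ _ 0); first by rewrite mulr_le0_ge0 ?tpow_ge0 // subr_le0.
  by rewrite addr_ge0 // mulr_ge0 // tpow_ge0.
have -> : (S + xi n - y) * tpow y = (S - y) * tpow y + tpow y * xi n by ring.
rewrite lerD // ler_wpM2r //.
by apply: tpow_mono => //; exact: ltW.
Qed.

(* A discrete substitute for the jump form of Ito's formula. *)
Lemma tpsi_sum_le (xi : nat -> R) n : (forall i, 0 <= xi i) ->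
  tpsi (\sum_(i < n) xi i) <=
  2 `^ p * 2 `^ (p - 1) *
  (\sum_(i < n) tpow (\sum_(j < i) xi j) * xi i + \sum_(i < n) tpsi (xi i)).
Proof.
move=> xi0; set S := \sum_(i < n) xi i.
have S0 : 0 <= S by apply: sumr_ge0.
have S20 : 0 <= S / 2 by rewrite divr_ge0.
have -> : S = 2 * (S / 2) by field.
apply: (le_trans (tpsi_scale _ S20)); first by lra.
rewrite -mulrA ler_wpM2l ?powR_ge0 //.
have -> : tpsi (S / 2) = (S - S / 2) * tpow (S / 2) by rewrite /tpsi; field.
apply: (le_trans (sum_tpow_tangent n xi0 S20)).
rewrite -big_split /= mulr_sumr; apply: ler_sum => i _.
rewrite big_ord_recr /= /tpsi [xi i * _]mulrC -mulrDl mulrA ler_wpM2r //.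
by apply: tpow_add => //; apply: sumr_ge0.
Qed.

End truncated_power.

(** * Compensated point processes *)

Lemma cvg_monotone_integral d (T : measurableType d) (R : realType)
    (mu : {measure set T -> \bar R}) (A : set T) (g_ : nat -> T -> \bar R)
    (g : T -> \bar R) : measurable A ->
  (forall n, measurable_fun A (g_ n)) ->
  (forall n x, A x -> 0 <= g_ n x) ->
  (forall x, A x -> nondecreasing_seq (g_ ^~ x)) ->
  (forall x, A x -> g_ ^~ x @ \oo --> g x) ->
  (fun n => \int[mu]_(x in A) g_ n x) @ \oo --> \int[mu]_(x in A) g x.
Proof.
move=> mA mg g0 ndg cg.
rewrite (_ : \int[mu]_(x in A) g x = \int[mu]_(x in A) limn (g_ ^~ x)).
  exact: cvg_monotone_convergence.
by apply: eq_integral => x /set_mem Ax; rewrite (cvg_lim _ (cg x Ax)).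
Qed.

Lemma fin_num_addeI {R : realDomainType} (x y z : \bar R) :
  x \is a fin_num -> x + y = x + z -> y = z.
Proof. by move=> fx xyz; rewrite -(addeK y fx) -(addeK z fx) [y + x]addeC xyz [z + x]addeC. Qed.

Section nonnegative_function_induction.
Context d (T : measurableType d) (R : realType).
Variable Q : (T -> \bar R) -> Prop.
Hypothesis Q_indic : forall A, measurable A -> Q (fun x => (\1_A x)%:E).
Hypothesis Q_scale : forall (c : R) f, (0 <= c)%R -> (forall x, 0 <= f x) ->
  Q f -> Q (fun x => c%:E * f x).
Hypothesis Q_add : forall f g, (forall x, 0 <= f x) -> (forall x, 0 <= g x) ->
  Q f -> Q g -> Q (fun x => f x + g x).
Hypothesis Q_lim : forall (f_ : nat -> T -> \bar R) f,
  (forall n x, 0 <= f_ n x) -> (forall x, nondecreasing_seq (f_ ^~ x)) ->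
  (forall x, f_ ^~ x @ \oo --> f x) -> (forall n, Q (f_ n)) -> Q f.

Import HBNNSimple.

Lemma ge0_measurable_fun_ind f : measurable_fun [set: T] f ->
  (forall x, 0 <= f x) -> Q f.
Proof.
move=> mf f0; pose g := nnsfun_approx measurableT mf.
apply: (@Q_lim (fun n x => (g n x)%:E) f).
- by move=> n x; rewrite lee_fin.
- move=> x m n mn; rewrite lee_fin.
  by have /lefP := nd_nnsfun_approx measurableT mf mn; apply.
- by move=> x; apply: cvg_nnsfun_approx.
move=> n; set h := g n.
have -> : (fun x => (h x)%:E) =
    (fun x => \sum_(y <- fset_set (range h)) (y * \1_(h @^-1` [set y]) x)%:E).
  by apply/funext => x; rewrite fimfunE fsbig_finite //= sumEFin.
have : {in enum_fset (fset_set (range h)), forall y, (0 <= y)%R}.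
  by move=> y; rewrite in_fset_set // => /set_mem[x _ <-].
elim: (enum_fset (fset_set (range h))) => [|y s IH] s0.
  under eq_fun do rewrite big_nil.
  have -> : (fun=> 0) = (fun x => (\1_(set0 : set T) x)%:E) :> (T -> \bar R).
    by apply/funext => x; rewrite indic0.
  exact: Q_indic.
under eq_fun do rewrite big_cons.
have y0 : (0 <= y)%R by apply: s0; rewrite inE eqxx.
apply: Q_add.
- by move=> x; rewrite lee_fin mulr_ge0.
- move=> x; rewrite big_seq; apply: sume_ge0 => z zs.
  by rewrite lee_fin mulr_ge0 // s0 // inE zs orbT.
- under eq_fun do rewrite EFinM.
  by apply: Q_scale => //; exact: Q_indic.
- by apply: IH => z zs; apply: s0; rewrite inE zs orbT.
Qed.

End nonnegative_function_induction.

Section compensated_point_process.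
Context {R : realType} d (Omega : measurableType d) (P : probability Omega R).
Context dX (X : measurableType dX) dY (Y : measurableType dY).
Variables (T : R) (tm : X -> R) (pr : X -> Y).
Variable Fil : R -> set (set Omega).
Variable N : Omega -> {measure set X -> \bar R}.
Variable nu : {measure set X -> \bar R}.

Definition cyl (a b : R) (B : set Y) : set X :=
  [set x | (a < tm x <= b)%R /\ B (pr x)].

Definition FilT (t : R) := g_sigma_algebraType (Fil t).

Record compensated : Prop := Compensated {
  cp_T0 : (0 < T)%R;
  cp_tm : measurable_fun [set: X] tm;
  cp_pr : measurable_fun [set: X] pr;
  cp_sa : forall t, (0 <= t <= T)%R -> sigma_algebra [set: Omega] (Fil t);
  cp_m : forall t, (0 <= t <= T)%R -> Fil t `<=` measurable;
  cp_mono : forall s t, (0 <= s)%R -> (s <= t)%R -> (t <= T)%R ->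
    Fil s `<=` Fil t;
  cp_Nfin : forall w, N w [set: X] < +oo;
  cp_nufin : nu [set: X] < +oo;
  cp_Nsupp : forall w, N w (~` cyl 0 T [set: Y]) = 0;
  cp_nusupp : nu (~` cyl 0 T [set: Y]) = 0;
  cp_adapted : forall a b B, (0 <= a)%R -> (a <= b)%R -> (b <= T)%R ->
    measurable B -> measurable_fun [set: FilT b] (fun w => N w (cyl a b B));
  cp_comp : forall a b A B, (0 <= a)%R -> (a <= b)%R -> (b <= T)%R ->
    Fil a A -> measurable B ->
    \int[P]_(w in A) N w (cyl a b B) = P A * nu (cyl a b B)
}.

Definition predictable_rect : set (set (Omega * X)) :=
  [set F | exists a b A B, [/\ (0 <= a <= T)%R /\ (0 <= b <= T)%R,
    Fil a A, measurable B & F = A `*` cyl a b B]].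

Definition ptype := g_sigma_algebraType predictable_rect.

Hypothesis CP : compensated.
Let T0 := cp_T0 CP.
Let mtm := cp_tm CP.
Let mpr := cp_pr CP.
Let Fil_sa := cp_sa CP.
Let Fil_m := cp_m CP.
Let Fil_mono := cp_mono CP.
Let N_fin := cp_Nfin CP.
Let nu_fin := cp_nufin CP.
Let N_supp := cp_Nsupp CP.
Let nu_supp := cp_nusupp CP.
Let N_adapted := cp_adapted CP.
Let N_comp := cp_comp CP.

Lemma measurable_cyl a b B : measurable B -> measurable (cyl a b B).
Proof.
move=> mB; have -> : cyl a b B = tm @^-1` `]a, b]%classic `&` pr @^-1` B.
  by apply/seteqP; split => x; rewrite /cyl /= in_itv.
by apply: measurableI; rewrite -[X in measurable X]setTI; [exact: mtm|exact: mpr].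
Qed.

Lemma measurable_FilT t A : (0 <= t <= T)%R -> Fil t A -> measurable (A : set (FilT t)).
Proof. by move=> _ FA; exact: sub_sigma_algebra. Qed.

Lemma FilT_measurable t (A : set (FilT t)) : (0 <= t <= T)%R -> measurable A -> Fil t A.
Proof.
by move=> tT; rewrite /measurable /= sigma_algebra_id //; exact: Fil_sa.
Qed.

Lemma FilT_mono s t d' (Z : measurableType d') (f : Omega -> Z) :
  (0 <= s)%R -> (s <= t)%R -> (t <= T)%R ->
  measurable_fun [set: FilT s] f -> measurable_fun [set: FilT t] f.
Proof.
move=> s0 st tT mf _ B mB; apply: measurable_FilT; first by rewrite tT (le_trans s0).
apply: (Fil_mono s0 st tT); apply: FilT_measurable; first by rewrite s0 (le_trans st).
exact: mf.
Qed.

Lemma FilT_fun t d' (Z : measurableType d') (f : Omega -> Z) :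
  (0 <= t <= T)%R ->
  measurable_fun [set: FilT t] f -> measurable_fun [set: Omega] f.
Proof.
move=> tT mf _ B mB; apply: (Fil_m tT); apply: FilT_measurable => //.
exact: mf.
Qed.

Let upto (t : R) : set X := tm @^-1` `]-oo, t]%classic.

Let m_upto t : measurable (upto t).
Proof. by rewrite -[upto t]setTI; exact: mtm. Qed.

Let QS (F : set (Omega * X)) := [/\
  forall w, measurable (xsection F w),
  forall t, (0 <= t <= T)%R ->
    measurable_fun [set: FilT t] (fun w => N w (xsection F w `&` upto t)),
  measurable_fun [set: Omega] (fun w => nu (xsection F w)) &
  \int[P]_w N w (xsection F w) = \int[P]_w nu (xsection F w)].

Let D : set X := cyl 0 T [set: Y].

Let mD : measurable D. Proof. exact: measurable_cyl. Qed.

Let suppE (mu : {measure set X -> \bar R}) A : mu (~` D) = 0 -> measurable A ->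
  mu A = mu (A `&` D).
Proof.
move=> mu0 mA; rewrite (measureDI mu mA mD) [X in X + _](_ : _ = 0) ?add0e //.
apply: (@subset_measure0 _ _ _ mu _ (~` D)); last by [].
- exact: measurableD.
- exact: measurableC.
- by move=> x [].
Qed.

Let N_upto_T w A : measurable A -> N w (A `&` upto T) = N w A.
Proof.
move=> mA; rewrite (suppE (N_supp w) mA) (suppE (N_supp w)).
  congr (N w _); apply/seteqP; split => x.
    by move=> [[]].
  by move=> [Ax Dx]; split => //; split => //; rewrite /upto /= in_itv /=;
    have [/andP[]] := Dx.
exact: measurableI.
Qed.

Let N_adapted' a b B : (0 <= a <= T)%R -> (0 <= b <= T)%R -> measurable B ->
  measurable_fun [set: FilT b] (fun w => N w (cyl a b B)).
Proof.
move=> /andP[a0 aT] /andP[b0 bT] mB; case: (leP a b) => ab; first exact: N_adapted.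
rewrite (_ : cyl a b B = set0); last first.
  apply/seteqP; split => x // [/andP[ax xb] _].
  by have := lt_trans (lt_le_trans ax xb) ab; rewrite ltxx.
under eq_fun do rewrite measure0; exact: measurable_cst.
Qed.

Let QS_meas F : QS F -> measurable_fun [set: Omega] (fun w => N w (xsection F w)).
Proof.
move=> [mF aF _ _]; have TT : (0 <= T <= T)%R by rewrite lexx ltW.
apply: (FilT_fun TT); apply: eq_measurable_fun (aF _ TT) => w _.
by rewrite N_upto_T.
Qed.

Let QS_rect F : predictable_rect F -> QS F.
Proof.
move=> [a [b [A [B [[aT bT] FA mB ->]]]]].
have mA : measurable A := Fil_m aT FA.
have mC c : measurable (cyl a c B) := measurable_cyl a c mB.
have xE w : xsection (A `*` cyl a b B) w = if w \in A then cyl a b B else set0.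
  by case: ifPn => wA; [rewrite in_xsectionX|rewrite notin_xsectionX].
have patchN (mu : Omega -> {measure set X -> \bar R}) c w :
    mu w (if w \in A then cyl a c B else set0) =
    ((fun w => mu w (cyl a c B)) \_ A) w.
  by rewrite patchE; case: ifP => //; rewrite measure0.
split.
- by move=> w; rewrite xE; case: ifP.
- move=> t tT.
  have -> : (fun w => N w (xsection (A `*` cyl a b B) w `&` upto t)) =
            (fun w => N w (if w \in A then cyl a (Num.min b t) B else set0)).
    apply/funext => w; rewrite xE; congr (N w _); case: ifP => _; last by rewrite set0I.
    apply/seteqP; split => x; rewrite /cyl /upto /= in_itv /= le_min.
      by move=> [[/andP[-> ->] ?] ->].
    by move=> [/and3P[-> -> ->] ?].
  under eq_fun do rewrite patchN.
  have mtT : (0 <= Num.min b t <= T)%R.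
    case/andP: bT => b0 bT; case/andP: tT => t0 tT.
    by rewrite le_min b0 t0 ge_min bT.
  case: (leP a t) => at_.
    have mAt : measurable (A : set (FilT t)).
      apply: measurable_FilT => //.
      by apply: Fil_mono FA => //; [case/andP: aT|case/andP: tT].
    apply/(@measurable_restrictT _ _ (FilT t) _ A _ mAt).
    apply: (@measurable_funTS _ _ (FilT t)); apply: (@FilT_mono (Num.min b t)) => //.
    + by case/andP: mtT.
    + by rewrite ge_min lexx orbT.
    + by case/andP: tT.
    + exact: N_adapted'.
  rewrite (_ : cyl a (Num.min b t) B = set0); last first.
    apply/seteqP; split => x // [/andP[ax]]; rewrite le_min => /andP[_ xt] _.
    by have := lt_trans (lt_le_trans ax xt) at_; rewrite ltxx.
  apply: (@eq_measurable_fun _ _ (FilT t) _ _ (cst 0)).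
    by move=> w _; rewrite patchE measure0; case: ifP.
  exact: measurable_cst.
- under eq_fun do rewrite xE (patchN (fun=> nu)).
  exact: ((@measurable_restrictT _ _ Omega _ A (cst (nu (cyl a b B))) mA).1
    (@measurable_cst _ _ _ _ _ _)).
- under eq_integral do rewrite xE patchN.
  under [RHS]eq_integral do rewrite xE (patchN (fun=> nu)).
  rewrite -!integral_mkcond integral_cst //.
  case: (leP a b) => ab.
    by rewrite N_comp // 1?muleC //; [case/andP: aT|case/andP: bT].
  rewrite (_ : cyl a b B = set0) ?measure0 ?mul0e.
    by under eq_integral do rewrite measure0; rewrite integral0.
  apply/seteqP; split => x // [/andP[ax xb] _].
  by have := lt_trans (lt_le_trans ax xb) ab; rewrite ltxx.
Qed.

Let setT_rect : predictable_rect ([set: Omega] `*` D).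
Proof.
exists 0%R, T, setT, setT; split => //; first by rewrite !lexx !ltW.
have [F0 FC _] : sigma_algebra setT (Fil 0) by apply: Fil_sa; rewrite lexx ltW.
by have := FC _ F0; rewrite setD0.
Qed.

Let QS_setT : QS [set: Omega * X].
Proof.
have xT w : xsection [set: Omega * X] w = setT.
  by rewrite xsectionE.
have xD w : xsection ([set: Omega] `*` D) w = D by rewrite in_xsectionX // mem_setT.
have [h1 h2 h3 h4] := QS_rect setT_rect; split.
- by move=> w; rewrite xT.
- move=> t tT; apply: eq_measurable_fun (h2 _ tT) => w _.
  rewrite xT xD setTI [RHS](suppE (N_supp w)) //.
  by rewrite setIC.
- by under eq_fun do rewrite xT; exact: measurable_cst.
- transitivity (\int[P]_w N w (xsection ([set: Omega] `*` D) w)).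
    by apply: eq_integral => w _; rewrite xT xD (suppE (N_supp w)) // setTI.
  rewrite h4; apply: eq_integral => w _.
  by rewrite xT xD [RHS](suppE nu_supp) // setTI.
Qed.

Let fin_nu : \int[P]_w nu [set: X] < +oo.
Proof.
have -> : \int[P]_w nu [set: X] = nu [set: X] * P setT by exact: integral_cst.
by rewrite [P _]probability_setT mule1.
Qed.

Let xC (F : set (Omega * X)) w : xsection (~` F) w = ~` xsection F w.
Proof. by rewrite !xsectionE. Qed.

Let mN_lt (mu : {measure set X -> \bar R}) A : mu setT < +oo -> measurable A -> mu A < +oo.
Proof.
move=> h mA; apply: le_lt_trans h.
by apply: le_measure; rewrite ?inE //; exact: subsetT.
Qed.

Let QS_C F : QS F -> QS (~` F).
Proof.
move=> QF; have mNF := QS_meas QF; have [mF aF nF eF] := QF.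
have [_ aT nT eT] := QS_setT.
have mC w : measurable (xsection (~` F) w) by rewrite xC; exact: measurableC.
have xT w : xsection [set: Omega * X] w = setT.
  by rewrite xsectionE.
have n3 : measurable_fun setT (fun w => nu (xsection (~` F) w)).
  have -> : (fun w => nu (xsection (~` F) w)) =
            (fun w => nu setT - nu (xsection F w)).
    by apply/funext => w; rewrite xC -setTD measureD // setTI.
  exact: emeasurable_funB.
have n2 t : (0 <= t <= T)%R ->
    measurable_fun [set: FilT t] (fun w => N w (xsection (~` F) w `&` upto t)).
  move=> tT.
  have -> : (fun w => N w (xsection (~` F) w `&` upto t)) =
    (fun w => N w (xsection setT w `&` upto t) - N w (xsection F w `&` upto t)).
    apply/funext => w; rewrite xC xT setTI setIC -setDE measureD //; last exact: mN_lt.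
    by rewrite setIC.
  by apply: emeasurable_funB; [exact: aT|exact: aF].
have n2' : measurable_fun setT (fun w => N w (xsection (~` F) w)).
  have TT : (0 <= T <= T)%R by rewrite lexx ltW.
  apply: (FilT_fun TT); apply: eq_measurable_fun (n2 _ TT) => w _.
  by rewrite N_upto_T.
split => //.
have addE (mu : Omega -> {measure set X -> \bar R}) :
    measurable_fun [set: Omega] (fun w => mu w (xsection F w)) ->
    measurable_fun [set: Omega] (fun w => mu w (xsection (~` F) w)) ->
    \int[P]_w mu w (xsection F w) + \int[P]_w mu w (xsection (~` F) w) =
    \int[P]_w mu w setT.
  move=> m1 m2; rewrite -ge0_integralD //; apply: eq_integral => w _.
  by rewrite xC -measureU ?setUv // ?setICr //; exact: measurableC.
have a1 := addE N mNF n2'; have a2 := addE (fun=> nu) nF n3.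
have eT' : \int[P]_w N w setT = \int[P]_w nu setT.
  transitivity (\int[P]_w N w (xsection setT w)).
    by apply: eq_integral => w _; rewrite xT.
  by rewrite eT; apply: eq_integral => w _; rewrite xT.
have : \int[P]_w nu (xsection F w) + \int[P]_w N w (xsection (~` F) w) =
       \int[P]_w nu (xsection F w) + \int[P]_w nu (xsection (~` F) w).
  by rewrite a2 -eT' -a1 eF.
apply: fin_num_addeI; rewrite ge0_fin_numE ?integral_ge0 //.
apply: le_lt_trans fin_nu; apply: ge0_le_integral => //.
by move=> w _; apply: le_measure; rewrite ?inE //; exact: subsetT.
Qed.

Let QS_bigcup (F : (set (Omega * X))^nat) : trivIset setT F ->
  (forall n, QS (F n)) -> QS (\bigcup_n F n).
Proof.
move=> tF QF.
have mF n w : measurable (xsection (F n) w) by have [] := QF n.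
have mUF w : measurable (xsection (\bigcup_n F n) w).
  by rewrite xsection_bigcup; exact: bigcupT_measurable.
have sumE (mu : {measure set X -> \bar R}) w :
    mu (xsection (\bigcup_n F n) w) = \sum_(n <oo) mu (xsection (F n) w).
  rewrite xsection_bigcup measure_bigcup //; last exact: trivIset_xsection.
  by apply: eq_eseriesl => n; rewrite in_setT.
split => //.
- move=> t tT.
  have -> : (fun w => N w (xsection (\bigcup_n F n) w `&` upto t)) =
            (fun w => \sum_(n <oo) N w (xsection (F n) w `&` upto t)).
    apply/funext => w; rewrite xsection_bigcup setI_bigcupl measure_bigcup //.
    - by apply: eq_eseriesl => n; rewrite in_setT.
    - by move=> n _; exact: measurableI.
    - by apply: trivIset_setIr; exact: trivIset_xsection.
  apply: ge0_emeasurable_sum => // n _.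
  by have [_ a _ _] := QF n; exact: a.
- under eq_fun do rewrite sumE.
  by apply: ge0_emeasurable_sum => // n _; have [] := QF n.
- under eq_integral do rewrite sumE.
  under [RHS]eq_integral do rewrite sumE.
  rewrite !integral_nneseries //.
  + by apply: eq_eseriesr => n _; have [] := QF n.
  + by move=> n; have [] := QF n.
  + by move=> n; exact: QS_meas.
Qed.

Let predictable_rectI : setI_closed predictable_rect.
Proof.
move=> _ _ [a [b [A [B [[aT bT] FA mB ->]]]]] [a' [b' [A' [B' [[aT' bT'] FA' mB' ->]]]]].
exists (Num.max a a'), (Num.min b b'), (A `&` A'), (B `&` B').
have maT : (0 <= Num.max a a' <= T)%R by case: (leP a a').
have [c0 cT] := andP maT.
split.
- by split => //; case: (leP b b').
- have FM A0 a0 : (0 <= a0 <= T)%R -> (a0 <= Num.max a a')%R -> Fil a0 A0 ->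
      Fil (Num.max a a') A0.
    by move=> /andP[a00 _] am; apply: Fil_mono.
  apply: FilT_measurable => //.
  apply: measurableI; apply: measurable_FilT => //.
    by apply: FM FA => //; rewrite le_max lexx.
  by apply: FM FA' => //; rewrite le_max lexx orbT.
- exact: measurableI.
- apply/seteqP; split => [[w x]|[w x]]; rewrite /cyl /= le_min gt_max.
    by move=> [[? [/andP[-> ->] ?]] [? [/andP[-> ->] ?]]].
  by move=> [[? ?] [/andP[/andP[-> ->] /andP[-> ->]] [? ?]]].
Qed.

Let QS_all (F : set ptype) : measurable F -> QS F.
Proof.
move=> mF; apply: (@dynkin_induction _ ptype predictable_rect QS) => //.
- by move=> S _; exact: QS_C.
- by move=> S _; exact: QS_bigcup.
Qed.

Section integrals.
Implicit Type f : Omega * X -> \bar R.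

Let QF f := [/\
  forall w, measurable_fun [set: X] (fun x => f (w, x)),
  forall t, (0 <= t <= T)%R ->
    measurable_fun [set: FilT t] (fun w => \int[N w]_(x in upto t) f (w, x)),
  measurable_fun [set: Omega] (fun w => \int[nu]_x f (w, x)) &
  \int[P]_w \int[N w]_x f (w, x) = \int[P]_w \int[nu]_x f (w, x)].

Let N_int_upto_T w (g : X -> \bar R) : measurable_fun [set: X] g ->
  (forall x, 0 <= g x) ->
  \int[N w]_(x in upto T) g x = \int[N w]_x g x.
Proof.
move=> mg g0.
rewrite (@ge0_negligible_integral _ _ _ (N w) setT (~` D)) //; last first.
  exact: measurableC.
rewrite (@ge0_negligible_integral _ _ _ (N w) (upto T) (~` D)) //; last 2 first.
- exact: measurableC.
- exact: measurable_funTS.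
congr integral; rewrite setDE setCK setTD setCK.
by apply/setIidr => x; rewrite /D /cyl /upto /= in_itv /= => -[/andP[]].
Qed.

Let QF_meas f : (forall x, 0 <= f x) -> QF f ->
  measurable_fun [set: Omega] (fun w => \int[N w]_x f (w, x)).
Proof.
move=> f0 [mf af _ _]; have TT : (0 <= T <= T)%R by rewrite lexx ltW.
apply: (FilT_fun TT); apply: eq_measurable_fun (af _ TT) => w _.
exact: N_int_upto_T.
Qed.

Lemma predictable_compensation (f : ptype -> \bar R) :
  measurable_fun [set: ptype] f -> (forall x, 0 <= f x) -> [/\
  forall w, measurable_fun [set: X] (fun x => f (w, x)),
  forall t, (0 <= t <= T)%R -> measurable_fun [set: FilT t]
    (fun w => \int[N w]_(x in tm @^-1` `]-oo, t]%classic) f (w, x)),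
  measurable_fun [set: Omega] (fun w => \int[nu]_x f (w, x)) &
  \int[P]_w \int[N w]_x f (w, x) = \int[P]_w \int[nu]_x f (w, x)].
Proof.
move: f; apply: (@ge0_measurable_fun_ind _ ptype R QF).
- move=> F mF; have [m1 m2 m3 m4] := QS_all mF.
  have xE w x : (\1_F (w, x))%:E = (\1_(xsection F w) x)%:E :> \bar R.
    by rewrite !indicE mem_xsection.
  have iE (mu : {measure set X -> \bar R}) w :
      \int[mu]_x (\1_F (w, x))%:E = mu (xsection F w).
    rewrite -[xsection F w in RHS]setIT -integral_indic //.
    by apply: eq_integral => x _; rewrite xE.
  split => /=.
  + move=> w; under eq_fun do rewrite xE.
    exact/measurable_EFinP/measurable_indic.
  + move=> t tT; apply: eq_measurable_fun (m2 _ tT) => w _.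
    rewrite -integral_indic //.
    by apply: eq_integral => x _; rewrite xE.
  + by under eq_fun do rewrite iE.
  + under eq_integral do rewrite iE.
    by under [RHS]eq_integral do rewrite iE.
- move=> c f c0 f0 [m1 m2 m3 m4].
  have iE (mu : {measure set X -> \bar R}) A w : measurable A ->
      \int[mu]_(x in A) (c%:E * f (w, x)) = c%:E * \int[mu]_(x in A) f (w, x).
    by move=> mA; rewrite ge0_integralZl_EFin //; exact: measurable_funTS.
  split => /=.
  + by move=> w; apply: measurable_funeM.
  + move=> t tT; under eq_fun do rewrite iE //.
    by apply: measurable_funeM; exact: m2.
  + by under eq_fun do rewrite iE //; apply: measurable_funeM.
  + under eq_integral do rewrite iE //.
    under [RHS]eq_integral do rewrite iE //.
    rewrite !ge0_integralZl_EFin ?m4 //.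
    * by move=> w _; exact: integral_ge0.
    * by move=> w _; exact: integral_ge0.
    * exact: QF_meas.
- move=> f g f0 g0 Qf Qg; have [m1 m2 m3 m4] := Qf; have [n1 n2 n3 n4] := Qg.
  have iE (mu : {measure set X -> \bar R}) A w : measurable A ->
      \int[mu]_(x in A) (f (w, x) + g (w, x)) =
      \int[mu]_(x in A) f (w, x) + \int[mu]_(x in A) g (w, x).
    by move=> mA; rewrite ge0_integralD //; exact: measurable_funTS.
  split => /=.
  + by move=> w; apply: emeasurable_funD.
  + move=> t tT; under eq_fun do rewrite iE //.
    by apply: emeasurable_funD; [exact: m2|exact: n2].
  + by under eq_fun do rewrite iE //; apply: emeasurable_funD.
  + have sumE (mu : Omega -> {measure set X -> \bar R}) :
        measurable_fun [set: Omega] (fun w => \int[mu w]_x f (w, x)) ->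
        measurable_fun [set: Omega] (fun w => \int[mu w]_x g (w, x)) ->
        \int[P]_w \int[mu w]_x (f (w, x) + g (w, x)) =
        \int[P]_w \int[mu w]_x f (w, x) + \int[P]_w \int[mu w]_x g (w, x).
      move=> mf mg; under eq_integral do rewrite iE //.
      by apply: (@ge0_integralD _ _ _ P setT measurableT
        (fun w => \int[mu w]_x f (w, x)) (fun w => \int[mu w]_x g (w, x))) => // w _;
        exact: integral_ge0.
    rewrite (sumE N (QF_meas f0 Qf) (QF_meas g0 Qg)) (sumE (fun=> nu) m3 n3).
    by rewrite m4 n4.
- move=> f_ f f_0 ndf cvgf Qf_.
  have f0 x : 0 <= f x.
    rewrite -(cvg_lim _ (cvgf x)) //; apply: lime_ge; first exact/cvgP/cvgf.
    exact: nearW.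
  have mf w : measurable_fun [set: X] (fun x => f (w, x)).
    apply: (emeasurable_fun_cvg (fun n x => f_ n (w, x))) => //.
    by move=> n; have [] := Qf_ n.
  have iE (mu : {measure set X -> \bar R}) A w : measurable A ->
      (fun n => \int[mu]_(x in A) f_ n (w, x)) @ \oo --> \int[mu]_(x in A) f (w, x).
    move=> mA; apply: cvg_monotone_integral => //.
    by move=> n; apply: measurable_funTS; have [] := Qf_ n.
  split => //=.
  + move=> t tT.
    apply: (@emeasurable_fun_cvg _ (FilT t) _ _ (fun n w => \int[N w]_(x in upto t) f_ n (w, x))).
      by move=> n; have [_ a _ _] := Qf_ n; exact: a.
    by move=> w _; exact: iE.
  + apply: (@emeasurable_fun_cvg _ Omega _ _ (fun n w => \int[nu]_x f_ n (w, x))).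
      by move=> n; have [] := Qf_ n.
    by move=> w _; exact: iE.
  + have ndI (mu : {measure set X -> \bar R}) w :
        nondecreasing_seq (fun n => \int[mu]_x f_ n (w, x)).
      move=> a b ab; apply: ge0_le_integral => //.
      * by have [] := Qf_ a.
      * by have [] := Qf_ b.
      * by move=> x _; exact: ndf.
    have cvgI (mu : Omega -> {measure set X -> \bar R}) :
        (forall n, measurable_fun [set: Omega] (fun w => \int[mu w]_x f_ n (w, x))) ->
        (fun n => \int[P]_w \int[mu w]_x f_ n (w, x)) @ \oo -->
        \int[P]_w \int[mu w]_x f (w, x).
      move=> mmu; apply: cvg_monotone_integral => //.
        by move=> n w _; exact: integral_ge0.
      by move=> w _; exact: iE.
    have c1 := cvgI N (fun n => QF_meas (f_0 n) (Qf_ n)).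
    have c2 : (fun n => \int[P]_w \int[nu]_x f_ n (w, x)) @ \oo -->
              \int[P]_w \int[nu]_x f (w, x).
      by apply: (cvgI (fun=> nu)) => n; have [] := Qf_ n.
    have e : (fun n => \int[P]_w \int[N w]_x f_ n (w, x)) =
             (fun n => \int[P]_w \int[nu]_x f_ n (w, x)).
      by apply/funext => n; have [_ _ _ ->] := Qf_ n.
    rewrite e in c1; exact: (cvg_unique (@ereal_hausdorff R) c1 c2).
Qed.

Lemma measurable_point_integral (f : ptype -> \bar R) :
  measurable_fun [set: ptype] f -> (forall x, 0 <= f x) ->
  measurable_fun [set: Omega] (fun w => \int[N w]_x f (w, x)).
Proof. by move=> mf f0; apply: QF_meas => //; exact: predictable_compensation. Qed.

End integrals.

End compensated_point_process.

(** * Moment inequality for point integrals *)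

Lemma integral_bound_off_event d (T : measurableType d) (R : realType)
    (P : {measure set T -> \bar R}) (u v v' : T -> \bar R) (bad : set T)
    (B K c : R) :
  (0 <= B)%R -> (0 <= K)%R -> (0 <= c)%R -> measurable bad ->
  measurable_fun [set: T] u -> measurable_fun [set: T] v ->
  measurable_fun [set: T] v' ->
  (forall w, 0 <= u w) -> (forall w, 0 <= v w) -> (forall w, 0 <= v' w) ->
  (forall w, u w <= B%:E) ->
  (forall w, ~ bad w -> u w <= K%:E * (v w + c%:E * v' w)) ->
  \int[P]_w u w <=
  K%:E * (\int[P]_w v w + c%:E * \int[P]_w v' w) + B%:E * P bad.
Proof.
move=> B0 K0 c0 mbad mu mv mv' u0 v0 v'0 uB uK.
have m1 : measurable_fun [set: T] (fun w => c%:E * v' w) by exact: measurable_funeM.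
have m2 : measurable_fun [set: T] (fun w => v w + c%:E * v' w).
  exact: emeasurable_funD.
have m3 : measurable_fun [set: T] (fun w => B%:E * (\1_bad w)%:E).
  by apply: measurable_funeM; apply/measurable_EFinP; exact: measurable_indic.
have n1 w : 0 <= c%:E * v' w by rewrite mule_ge0.
have n2 w : 0 <= v w + c%:E * v' w by rewrite adde_ge0.
apply: (@le_trans _ _ (\int[P]_w
   (K%:E * (v w + c%:E * v' w) + B%:E * (\1_bad w)%:E))).
  apply: ge0_le_integral => //.
  - by apply: emeasurable_funD => //; apply: measurable_funeM.
  - move=> w _; rewrite indicE; case: (boolP (w \in bad)) => wb.
      by rewrite mule1 (le_trans (uB w)) // leeDr // mule_ge0.
    rewrite mule0 adde0; apply: uK => bw.
    by move/negP: wb; apply; rewrite inE.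
rewrite ge0_integralD //; last 3 first.
- by move=> w _; rewrite mule_ge0.
- exact: measurable_funeM.
- by move=> w _; rewrite mule_ge0 // lee_fin.
rewrite !ge0_integralZl_EFin //; last first.
  by apply/measurable_EFinP; exact: measurable_indic.
rewrite ge0_integralD // ge0_integralZl_EFin //.
by rewrite integral_indic // setIT.
Qed.

(* [tpsi] is not convex, whence the factor 2^-1 and the rescaled argument. *)
Lemma weighted_tpow_jensen d (T : measurableType d) (R : realType)
    (mu : {measure set T -> \bar R}) (A : set T) (p M theta a : R) (G f : T -> R) :
  measurable A -> (1 <= p)%R -> (0 < M)%R -> (0 < theta)%R ->
  measurable_fun A G -> measurable_fun A f ->
  (forall x, 0 <= G x)%R -> (forall x, 0 <= f x)%R ->
  \int[mu]_(x in A) (G x)%:E <= theta%:E ->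
  \int[mu]_(x in A) (G x * f x)%:E = a%:E ->
  (2^-1 * a * tpow p M (a / (2 * theta)))%:E <=
  \int[mu]_(x in A) (G x * tpsi p M (f x))%:E.
Proof.
move=> mA p1 M0 th0 mG mf G0 f0 Gth Gfa.
have a0 : (0 <= a)%R.
  by rewrite -lee_fin -Gfa; apply: integral_ge0 => x _; rewrite lee_fin mulr_ge0.
set y := (a / (2 * theta))%R.
have y0 : (0 <= y)%R by rewrite divr_ge0 // mulr_ge0 // ltW.
set c := tpow p M y.
have c0 : (0 <= c)%R by exact: tpow_ge0.
have mpsi : measurable_fun A (tpsi p M \o f).
  by apply: measurableT_comp => //; exact: measurable_tpsi.
have key : (c * a)%:E <=
    \int[mu]_(x in A) (G x * tpsi p M (f x))%:E + (y * c * theta)%:E.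
  rewrite EFinM -Gfa -ge0_integralZl_EFin //; last 2 first.
  - by move=> x _; rewrite lee_fin mulr_ge0.
  - by apply/measurable_EFinP; exact: measurable_funM.
  apply: (@le_trans _ _ (\int[mu]_(x in A)
      ((G x * tpsi p M (f x))%:E + (y * c)%:E * (G x)%:E))).
    apply: ge0_le_integral => //.
    - by move=> x _; rewrite -EFinM lee_fin !mulr_ge0.
    - apply: measurable_funeM; apply/measurable_EFinP; exact: measurable_funM.
    - apply: emeasurable_funD; first by apply/measurable_EFinP; exact: measurable_funM.
      by apply: measurable_funeM; exact/measurable_EFinP.
    - move=> x _; rewrite -!EFinM -EFinD lee_fin.
      have := tpow_tangent p1 M0 y0 (f0 x); rewrite -/c => h.
      have -> : (c * (G x * f x) = G x * ((f x - y) * c) + y * c * G x)%R by ring.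
      by rewrite lerD2r ler_wpM2l.
  rewrite ge0_integralD //; last 4 first.
  - by move=> x _; rewrite lee_fin mulr_ge0 // tpsi_ge0 //.
  - by apply/measurable_EFinP; exact: measurable_funM.
  - by move=> x _; rewrite -EFinM lee_fin mulr_ge0 // mulr_ge0.
  - by apply: measurable_funeM; exact/measurable_EFinP.
  rewrite leeD2l // ge0_integralZl_EFin //; last 3 first.
  - by move=> x _; rewrite lee_fin.
  - exact/measurable_EFinP.
  - exact: mulr_ge0.
  by rewrite [leRHS]EFinM; apply: lee_wpmul2l => //; rewrite lee_fin mulr_ge0.
have ytheta : (y * c * theta = 2^-1 * (c * a))%R.
  by rewrite /y; field; exact: lt0r_neq0.
rewrite -leeBlDr // ytheta -EFinB in key.
by apply: le_trans key; rewrite lee_fin; lra.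
Qed.

(* A Burkholder-type inequality without stochastic calculus: cut [0, T] into n cells.
   Outside an event of probability O(1/n) every cell carries at most one point, and there
   the discrete tangent inequality bounds [tpsi] of the integral by predictable sums,
   which are compensated; Young's inequality absorbs the cross term. *)
Section core_moment_inequality.
Context {R : realType} d (Omega : measurableType d) (P : probability Omega R).
Context dX (X : measurableType dX) dY (Y : measurableType dY).
Variables (T : R) (tm : X -> R) (pr : X -> Y).
Variable Fil : R -> set (set Omega).
Variable N : Omega -> {measure set X -> \bar R}.
Variable nu : {measure set X -> \bar R}.
Hypothesis CP : compensated P T tm pr Fil N nu.
Variable kappa : R.
Hypothesis N_simple : forall a b, (0 <= a)%R -> (a <= b)%R -> (b <= T)%R ->
  P [set w | 1 < N w (cyl tm pr a b [set: Y])] <= (kappa * (b - a) ^+ 2)%:E.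
Variables (p M L : R).
Hypotheses (p1 : (1 <= p)%R) (M0 : (0 < M)%R).
Variable H : Omega * X -> R.
Local Notation pT := (ptype T tm pr Fil).
Hypothesis mH : measurable_fun [set: pT] (H : pT -> R).
Hypothesis H0 : forall z, (0 <= H z)%R.
Hypothesis HL : forall z, (H z <= L)%R.

Let T0 := cp_T0 CP.
Let T0' : (0 <= T)%R := ltW T0.
Let cylT a b : set X := cyl tm pr a b [set: Y].
Let m_cyl a b : measurable (cylT a b).
Proof. by apply: (measurable_cyl CP). Qed.
Let upto (t : R) : set X := tm @^-1` `]-oo, t]%classic.
Let m_upto t : measurable (upto t).
Proof. by rewrite -[upto t]setTI; exact: (cp_tm CP). Qed.

Let EH z := (H z)%:E.
Let compH := predictable_compensation CP (f := EH)
  (iffRL (measurable_EFinP _ _) mH) (fun z => H0 z).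

Let mHw w : measurable_fun [set: X] (fun x => H (w, x)).
Proof. by have [h _ _ _] := compH; apply/measurable_EFinP; exact: h. Qed.

Let supp_int (mu : {measure set X -> \bar R}) (g : X -> \bar R) A B :
  mu (~` cylT 0 T) = 0 -> measurable A -> measurable B ->
  measurable_fun [set: X] g -> (forall x, 0 <= g x) ->
  A `&` cylT 0 T = B `&` cylT 0 T ->
  \int[mu]_(x in A) g x = \int[mu]_(x in B) g x.
Proof.
move=> mu0 mA mB mg g0 AB.
rewrite (@ge0_negligible_integral _ _ _ mu A (~` cylT 0 T)) //; last 2 first.
- exact: measurableC.
- exact: measurable_funTS.
rewrite (@ge0_negligible_integral _ _ _ mu B (~` cylT 0 T)) //; last 2 first.
- exact: measurableC.
- exact: measurable_funTS.
by rewrite !setDE !setCK AB.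
Qed.

Let L0 : (0 <= L)%R. Proof. exact: le_trans (H0 point) (HL point). Qed.

Let int_fin (mu : {measure set X -> \bar R}) w A : mu [set: X] < +oo -> measurable A ->
  \int[mu]_(x in A) EH (w, x) \is a fin_num.
Proof.
move=> fmu mA; rewrite ge0_fin_numE; last by apply: integral_ge0 => x _; rewrite lee_fin.
apply: (@le_lt_trans _ _ (\int[mu]_(x in A) (cst L%:E) x)).
  apply: ge0_le_integral => //.
  - by move=> x _; rewrite lee_fin.
  - by apply/measurable_EFinP; exact: measurable_funTS.
  - by move=> x _ /=; rewrite lee_fin.
rewrite integral_cst // lte_mul_pinfty // ?lee_fin //.
by apply: le_lt_trans fmu; apply: le_measure; rewrite ?inE //; exact: subsetT.
Qed.

Let Xw w : R := fine (\int[N w]_x EH (w, x)).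
Let Aw w : R := fine (\int[nu]_x EH (w, x)).

Section partition.
Variable n : nat.
Let t (i : nat) : R := (T * (i%:R / n.+1%:R))%R.
Let t_mono i : (t i <= t i.+1)%R.
Proof. by rewrite ler_wpM2l // ler_pM2r ?invr_gt0 ?ltr0n // ler_nat. Qed.
Let t_ge0 i : (0 <= t i)%R.
Proof. by rewrite mulr_ge0 ?divr_ge0. Qed.
Let t_le i : (i <= n.+1)%N -> (t i <= T)%R.
Proof.
by move=> ni; rewrite ler_piMr // ler_pdivrMr ?ltr0n // mul1r ler_nat.
Qed.
Let t0 : t 0 = 0%R. Proof. by rewrite /t mul0r mulr0. Qed.
Let tn : t n.+1 = T. Proof. by rewrite /t divff ?mulr1 // pnatr_eq0. Qed.
Let C i := cylT (t i) (t i.+1).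
Let mC i : measurable (C i). Proof. exact: m_cyl. Qed.

Let int_step (mu : {measure set X -> \bar R}) (g : X -> \bar R) i :
  measurable_fun [set: X] g -> (forall x, 0 <= g x) ->
  \int[mu]_(x in upto (t i.+1)) g x =
  \int[mu]_(x in upto (t i)) g x + \int[mu]_(x in C i) g x.
Proof.
move=> mg g0; rewrite -ge0_integral_setU //; last 2 first.
- exact: measurable_funTS.
- rewrite disj_set2E; apply/eqP/seteqP; split => x //.
  rewrite /upto /C /cylT /cyl /= in_itv /= => -[xi [/andP[ix _] _]].
  by have := lt_le_trans ix xi; rewrite ltxx.
congr integral; apply/seteqP; split => x; rewrite /upto /C /cylT /cyl /= !in_itv /=.
  by move=> xi; case: (leP (tm x) (t i)) => ?; [left|right].
by move=> [xi|[/andP[]]] //; exact: le_trans (t_mono i).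
Qed.

Let int_sum (mu : {measure set X -> \bar R}) (g : X -> \bar R) k :
  mu (~` cylT 0 T) = 0 ->
  measurable_fun [set: X] g -> (forall x, 0 <= g x) ->
  \int[mu]_(x in upto (t k)) g x = \sum_(i < k) \int[mu]_(x in C i) g x.
Proof.
move=> mu0 mg g0; elim: k => [|k IH]; last by rewrite big_ord_recr /= int_step // IH.
rewrite big_ord0 t0 (@supp_int mu g _ set0) ?integral_set0 //.
rewrite set0I; apply/seteqP; split => x //.
rewrite /upto /cylT /cyl /= in_itv /= => -[xi [/andP[ix _] _]].
by have := lt_le_trans ix xi; rewrite ltxx.
Qed.

Let int_sumT (mu : {measure set X -> \bar R}) (g : X -> \bar R) :
  mu (~` cylT 0 T) = 0 ->
  measurable_fun [set: X] g -> (forall x, 0 <= g x) ->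
  \int[mu]_x g x = \sum_(i < n.+1) \int[mu]_(x in C i) g x.
Proof.
move=> mu0 mg g0; rewrite -int_sum // tn; apply: supp_int => //.
apply/seteqP; split => x; rewrite /upto /cylT /cyl /= in_itv /=.
  by move=> [_ [/andP[? ?] ?]]; split => //; split => //; apply/andP.
by move=> [_ [/andP[? ?] ?]]; split => //; split => //; apply/andP.
Qed.

Let S i w : R := fine (\int[N w]_(x in upto (t i)) EH (w, x)).
Let xi i w : R := fine (\int[N w]_(x in C i) EH (w, x)).

Let mEH w : measurable_fun [set: X] (fun x => EH (w, x)).
Proof. exact/measurable_EFinP. Qed.

Let EH0 w x : 0 <= EH (w, x). Proof. by rewrite lee_fin. Qed.

Let Nfin w : N w [set: X] < +oo := cp_Nfin CP w.
Let nufin : nu [set: X] < +oo := cp_nufin CP.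
Let Nsupp w : N w (~` cylT 0 T) = 0 := cp_Nsupp CP w.
Let nusupp : nu (~` cylT 0 T) = 0 := cp_nusupp CP.

Let xi_ge0 i w : (0 <= xi i w)%R.
Proof. by apply: fine_ge0; apply: integral_ge0. Qed.

Let xiE i w : (xi i w)%:E = \int[N w]_(x in C i) EH (w, x).
Proof. by rewrite fineK // int_fin. Qed.

Let S_sum i w : S i w = (\sum_(j < i) xi j w)%R.
Proof.
apply: EFin_inj; rewrite fineK ?int_fin // int_sum // -sumEFin.
by apply: eq_bigr => j _; rewrite xiE.
Qed.

Let S_ge0 i w : (0 <= S i w)%R.
Proof. by apply: fine_ge0; apply: integral_ge0. Qed.

Let X_sum w : Xw w = (\sum_(j < n.+1) xi j w)%R.
Proof.
apply: EFin_inj; rewrite fineK ?int_fin // int_sumT // -sumEFin.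
by apply: eq_bigr => j _; rewrite xiE.
Qed.

Let S_le_X (i : 'I_n.+1) w : (S i w <= Xw w)%R.
Proof.
rewrite -lee_fin /S /Xw !fineK ?int_fin //.
by apply: ge0_subset_integral => //; exact: subsetT.
Qed.

Let mS i : (i <= n.+1)%N -> measurable_fun [set: FilT Fil (t i)] (S i).
Proof.
move=> ni; apply: (@measurableT_comp _ _ _ (FilT Fil (t i)) _ _ fine).
  exact: fine_measurable.
by have [_ h _ _] := compH; apply: h; rewrite t_ge0 t_le.
Qed.

Let f_ (i : nat) (z : pT) : R := ((tpow p M (S i z.1) * \1_(C i) z.2) * H z)%R.

Let f_0 i z : (0 <= f_ i z)%R.
Proof. by rewrite !mulr_ge0 // tpow_ge0. Qed.

Let m_simple a b (u : Omega -> R) : (0 <= a)%R -> (a <= b)%R -> (b <= T)%R ->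
  measurable_fun [set: FilT Fil a] u ->
  measurable_fun [set: pT] (fun z => u z.1 * \1_(cylT a b) z.2)%R.
Proof.
move=> a0 ab bT mu.
have aT : (0 <= a <= T)%R by rewrite a0 (le_trans ab).
have bT' : (0 <= b <= T)%R by rewrite bT (le_trans a0).
have rect (B : set Omega) : Fil a B -> measurable (B `*` cylT a b : set pT).
  by move=> FB; apply: sub_sigma_algebra; exists a, b, B, setT; split.
have mR : measurable ([set: Omega] `*` cylT a b : set pT).
  by apply: rect; apply: (FilT_measurable CP aT).
have -> : (fun z : pT => u z.1 * \1_(cylT a b) z.2)%R =
    (fun z : pT => u z.1)%R \_ ([set: Omega] `*` cylT a b).
  apply/funext => -[w x]; rewrite patchE indicE /=.
  have -> : ((w, x) \in [set: Omega] `*` cylT a b) = (x \in cylT a b).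
    by apply/idP/idP; rewrite !inE //= => -[].
  by case: ifP => _; rewrite ?mulr1 ?mulr0.
apply/(@measurable_restrictT _ _ pT _ _ (fun z : pT => u z.1) mR) => _ B mB.
have -> : ([set: Omega] `*` cylT a b) `&` (fun z : pT => u z.1) @^-1` B =
          (u @^-1` B) `*` cylT a b.
  by apply/seteqP; split => [[w x]|[w x]] /=; [move=> [[_ ?] ?]|move=> [? ?]].
apply: rect; apply: (FilT_measurable CP aT).
by rewrite -[X in measurable X]setTI; exact: mu.
Qed.

Let mf_ i : (i < n.+1)%N -> measurable_fun [set: pT] (f_ i).
Proof.
move=> ni; apply: measurable_funM => //.
apply: (m_simple (u := fun w => tpow p M (S i w))) => //; first exact: t_le.
apply: (@measurableT_comp _ _ _ (FilT Fil (t i)) _ _ (tpow p M)).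
  exact: measurable_tpow.
by apply: mS; exact: ltnW.
Qed.

Let f (z : pT) : \bar R := \sum_(i < n.+1) (f_ i z)%:E.

Let mf : measurable_fun [set: pT] f.
Proof.
apply: emeasurable_sum => i; apply/measurable_EFinP; exact: mf_.
Qed.

Let f0 z : 0 <= f z.
Proof. by apply: sume_ge0 => i _; rewrite lee_fin. Qed.

Let int_f (mu : {measure set X -> \bar R}) w : mu setT < +oo ->
  \int[mu]_x f (w, x) =
  \sum_(i < n.+1) (tpow p M (S i w) * fine (\int[mu]_(x in C i) EH (w, x)))%:E.
Proof.
move=> fmu.
have mfw i : measurable_fun [set: X] (fun x => (f_ i (w, x))%:E).
  apply/measurable_EFinP; apply: measurable_funM => //.
  by apply: measurable_funM => //=; exact: (measurable_indic (mC i)).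
rewrite ge0_integral_sum //; last by move=> i x _; rewrite lee_fin.
apply: eq_bigr => i _; rewrite EFinM fineK ?int_fin //.
rewrite -ge0_integralZl_EFin //; last 2 first.
- exact: measurable_funTS.
- exact: tpow_ge0.
rewrite [RHS]integral_mkcond; apply: eq_integral => x _.
rewrite patchE /f_ /= indicE; case: ifP => _; rewrite ?mulr1 ?mulr0 ?mul0r //.
Qed.

Let bad := \big[setU/set0]_(i < n.+1) [set w | 1 < N w (C i)].

Let mNC i : (i < n.+1)%N -> measurable_fun [set: Omega] (fun w => N w (C i)).
Proof.
move=> ni; have tT : (0 <= t i.+1 <= T)%R by rewrite t_ge0 t_le.
by apply: (FilT_fun CP tT); apply: (cp_adapted CP) => //; exact: t_le.
Qed.

Let mbad1 (i : 'I_n.+1) : measurable [set w | 1 < N w (C i)].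
Proof.
have m1 : measurable_fun [set: Omega] (fun=> 1 : \bar R) by exact: measurable_cst.
by have := measurable_lte measurableT m1 (mNC (ltn_ord i)); rewrite setTI.
Qed.

Let mbad : measurable bad.
Proof. by apply: bigsetU_measurable => i _; exact: mbad1. Qed.

Let P_bad : P bad <= (kappa * T ^+ 2 / n.+1%:R)%:E.
Proof.
apply: (@le_trans _ _ (\sum_(i < n.+1) (kappa * (T / n.+1%:R) ^+ 2)%:E)).
  have := @Boole_inequality _ _ _ P
    (fun i => if (i < n.+1)%N then [set w | 1 < N w (C i)] else set0) n.+1.
  rewrite /bad; under eq_bigr do rewrite ltn_ord.
  move=> h; apply: (le_trans (h _)).
    by move=> i ni; rewrite ni; exact: (mbad1 (Ordinal ni)).
  apply: lee_sum => i _; rewrite ltn_ord.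
  have -> : (T / n.+1%:R = t i.+1 - t i)%R.
    by rewrite /t -mulrBr -mulrBl -natrB // subSnn mul1r.
  by apply: N_simple => //; exact: t_le.
rewrite sumEFin lee_fin sumr_const card_ord -mulr_natr.
rewrite le_eqVlt; apply/orP; left; apply/eqP.
by field; apply/eqP => n10; have := ler0n R n; lra.
Qed.

Let EHp (z : pT) : \bar R := ((H z) `^ p)%:E.

Let mHp : measurable_fun [set: pT] EHp.
Proof.
apply/measurable_EFinP; apply: (measurableT_comp (measurable_powR p)).
exact: mH.
Qed.

Let EHp0 z : 0 <= EHp z. Proof. by rewrite lee_fin powR_ge0. Qed.

Let mEHp w : measurable_fun [set: X] (fun x => EHp (w, x)).
Proof. by have [h _ _ _] := predictable_compensation CP mHp EHp0. Qed.

Let K : R := (2 `^ p * 2 `^ (p - 1))%R.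

Let K0 : (0 <= K)%R. Proof. by rewrite mulr_ge0 // powR_ge0. Qed.

Let tpsi_xi (i : 'I_n.+1) w : ~ bad w ->
  (tpsi p M (xi i w))%:E <= (2 `^ p)%:E * \int[N w]_(x in C i) EHp (w, x).
Proof.
move=> nbad.
have NC : N w (C i) <= 1.
  rewrite leNgt; apply/negP => lt1; apply: nbad; rewrite /bad (bigD1 i) //=.
  by left.
have jen := @weighted_tpow_jensen _ X R (N w) (C i) p M 1 (xi i w) (cst 1%R)
  (fun x => H (w, x)) (mC i) p1 M0 ltr01.
apply: (@le_trans _ _ ((2 `^ p)%:E *
   (\int[N w]_(x in C i) (1 * tpsi p M (H (w, x)))%:E))).
  have xi2 : (0 <= xi i w / 2)%R by rewrite divr_ge0.
  apply: (@le_trans _ _ ((2 `^ p)%:E * (tpsi p M (xi i w / 2))%:E)).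
    rewrite -EFinM lee_fin; have := @tpsi_scale _ p M p1 M0 2%R _ _ xi2.
    have -> : (2 * (xi i w / 2) = xi i w)%R by field.
    by apply; lra.
  rewrite lee_wpmul2l ?lee_fin ?powR_ge0 //.
  apply: le_trans (jen _ _ _ _ _ _) => //.
  - by rewrite lee_fin mulr1 /tpsi [(2^-1 * _)%R]mulrC.
  - by apply: measurable_funTS.
  - have -> : \int[N w]_(x in C i) (cst 1%R x)%:E = \int[N w]_(x in C i) (cst 1%:E) x by [].
    by rewrite integral_cst // mul1e.
  - by rewrite xiE; apply: eq_integral => x _; rewrite mul1r.
rewrite lee_wpmul2l ?lee_fin ?powR_ge0 //; apply: ge0_le_integral => //.
- by move=> x _; rewrite lee_fin mul1r tpsi_ge0.
- apply/measurable_EFinP; apply: measurable_funM => //.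
  apply: (measurableT_comp (measurable_tpsi p M)).
  exact: measurable_funTS.
- exact: measurable_funTS.
- by move=> x _; rewrite lee_fin mul1r; exact: tpsi_le_pow.
Qed.

Let pointwise w : ~ bad w ->
  (tpsi p M (Xw w))%:E <=
  K%:E * (\int[N w]_x f (w, x) + (2 `^ p)%:E * \int[N w]_x EHp (w, x)).
Proof.
move=> nbad; rewrite X_sum.
apply: (@le_trans _ _ (K * (\sum_(i < n.+1) tpow p M (\sum_(j < i) xi j w) * xi i w +
   \sum_(i < n.+1) tpsi p M (xi i w)))%:E).
  by rewrite lee_fin; apply: (tpsi_sum_le p1 M0 n.+1 (xi := fun i => xi i w)).
rewrite EFinM lee_wpmul2l ?lee_fin // EFinD leeD //.
  rewrite int_f // -sumEFin; apply: lee_sum => i _.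
  by rewrite -S_sum.
rewrite int_sumT // ge0_sume_distrr; last by move=> i _; exact: integral_ge0.
by rewrite -sumEFin; apply: lee_sum => i _; exact: tpsi_xi.
Qed.

Let mX : measurable_fun [set: Omega] Xw.
Proof.
apply: measurableT_comp; first exact: fine_measurable.
apply: (measurable_point_integral CP) => //.
by apply/measurable_EFinP; exact: mH.
Qed.

Let X0 w : (0 <= Xw w)%R. Proof. by rewrite X_sum; apply: sumr_ge0. Qed.

Let mA : measurable_fun [set: Omega] Aw.
Proof.
apply: measurableT_comp; first exact: fine_measurable.
by have [_ _ h _] := compH.
Qed.

Let A0 w : (0 <= Aw w)%R. Proof. by apply: fine_ge0; apply: integral_ge0. Qed.

Let mXA : measurable_fun [set: Omega] (fun w => (tpow p M (Xw w) * Aw w)%:E).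
Proof.
apply/measurable_EFinP; apply: measurable_funM => //.
exact: (measurableT_comp (measurable_tpow p M)).
Qed.

Let int_nu_f w : \int[nu]_x f (w, x) <= (tpow p M (Xw w) * Aw w)%:E.
Proof.
rewrite int_f // EFinM /Aw fineK ?int_fin // int_sumT // ge0_sume_distrr; last first.
  by move=> i _; exact: integral_ge0.
apply: lee_sum => i _; rewrite EFinM [(fine _)%:E](fineK (int_fin w nufin (mC i))).
apply: lee_wpmul2r; first exact: integral_ge0.
by rewrite lee_fin; exact: tpow_mono.
Qed.

Lemma partition_bound (B : R) : (0 <= B)%R ->
  \int[P]_w (Num.min (tpsi p M (Xw w)) B)%:E <=
  K%:E * (\int[P]_w (tpow p M (Xw w) * Aw w)%:E +
          (2 `^ p)%:E * \int[P]_w \int[nu]_x EHp (w, x)) +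
  B%:E * (kappa * T ^+ 2 / n.+1%:R)%:E.
Proof.
move=> B0.
have [_ _ mnuf compf] := predictable_compensation CP mf f0.
have [_ _ _ compHp] := predictable_compensation CP mHp EHp0.
apply: (@le_trans _ _ (K%:E * (\int[P]_w \int[N w]_x f (w, x) +
    (2 `^ p)%:E * \int[P]_w \int[N w]_x EHp (w, x)) + B%:E * P bad)).
  apply: integral_bound_off_event.
  - exact: B0.
  - exact: K0.
  - exact: powR_ge0.
  - exact: mbad.
  - apply/measurable_EFinP; apply: measurable_minr => //.
    exact: (measurableT_comp (measurable_tpsi p M)).
  - exact: (measurable_point_integral CP mf f0).
  - exact: (measurable_point_integral CP mHp EHp0).
  - by move=> w; rewrite lee_fin le_min B0 andbT tpsi_ge0.
  - by move=> w; apply: integral_ge0 => x _; exact: f0.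
  - by move=> w; apply: integral_ge0 => x _; exact: EHp0.
  - by move=> w; rewrite lee_fin ge_min lexx orbT.
  - move=> w wb; apply: le_trans (pointwise wb).
    by rewrite lee_fin ge_min lexx.
apply: leeD; last first.
  by apply: lee_wpmul2l; [rewrite lee_fin|exact: P_bad].
apply: lee_wpmul2l; first by rewrite lee_fin.
rewrite compHp compf; apply: leeD; last by [].
apply: ge0_le_integral.
- exact: measurableT.
- by move=> w _; apply: integral_ge0 => x _; exact: f0.
- exact: mnuf.
- exact: mXA.
- by move=> w _; exact: int_nu_f.
Qed.

End partition.

Let X0 w : (0 <= Xw w)%R.
Proof. by apply: fine_ge0; apply: integral_ge0 => x _; rewrite lee_fin. Qed.

Let A0 w : (0 <= Aw w)%R.
Proof. by apply: fine_ge0; apply: integral_ge0 => x _; rewrite lee_fin. Qed.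

Let mX : measurable_fun [set: Omega] Xw.
Proof.
apply: measurableT_comp; first exact: fine_measurable.
apply: (measurable_point_integral CP); first by apply/measurable_EFinP; exact: mH.
by move=> z; rewrite lee_fin.
Qed.

Let mA : measurable_fun [set: Omega] Aw.
Proof.
apply: measurableT_comp; first exact: fine_measurable.
by have [_ _ h _] := compH.
Qed.

Let mtX : measurable_fun [set: Omega] (fun w => (tpsi p M (Xw w))%:E).
Proof. by apply/measurable_EFinP; apply: (measurableT_comp (measurable_tpsi p M)). Qed.

Let mtA : measurable_fun [set: Omega] (fun w => (tpsi p M (Aw w))%:E).
Proof. by apply/measurable_EFinP; apply: (measurableT_comp (measurable_tpsi p M)). Qed.

Let mXA : measurable_fun [set: Omega] (fun w => (tpow p M (Xw w) * Aw w)%:E).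
Proof.
apply/measurable_EFinP; apply: measurable_funM => //.
exact: (measurableT_comp (measurable_tpow p M)).
Qed.

Let K : R := (2 `^ p * 2 `^ (p - 1))%R.

Let K1 : (1 <= K)%R.
Proof.
have h q : (0 <= q)%R -> (1 <= 2 `^ q :> R)%R.
  by move=> q0; have := @ler_powR R 2%R _ 0%R q q0; rewrite powRr0; apply; lra.
have h1 := h p (le_trans ler01 p1).
have h2 : (1 <= 2 `^ (p - 1) :> R)%R by apply: h; rewrite subr_ge0.
by rewrite -[leLHS]mulr1; apply: ler_pM.
Qed.

Let rhs := K%:E * (\int[P]_w (tpow p M (Xw w) * Aw w)%:E +
  (2 `^ p)%:E * \int[P]_w \int[nu]_x (H (w, x) `^ p)%:E).

Let min_bound (B : R) : (0 <= B)%R ->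
  \int[P]_w (Num.min (tpsi p M (Xw w)) B)%:E <= rhs.
Proof.
move=> B0; apply/lee_addgt0Pr => e e0.
pose c := (B * (kappa * T ^+ 2))%R.
have [n cn] : exists n, (c / e <= n%:R)%R.
  exists (Num.bound `|c / e|%R); apply: (le_trans (ler_norm _)).
  by rewrite ltW // archi_boundP.
apply: (le_trans (partition_bound n B0)); apply: leeD => //.
rewrite -EFinM lee_fin mulrA -/c ler_pdivrMr ?ltr0n //.
rewrite -ler_pdivrMl // mulrC; apply: (le_trans cn).
by rewrite ler_nat.
Qed.

Let tpsi_bound : \int[P]_w (tpsi p M (Xw w))%:E <= rhs.
Proof.
have t0 w : (0 <= tpsi p M (Xw w))%R by apply: tpsi_ge0.
have c : (fun n => \int[P]_w (Num.min (tpsi p M (Xw w)) n%:R)%:E) @ \oo -->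
    \int[P]_w (tpsi p M (Xw w))%:E.
  apply: cvg_monotone_integral.
  - exact: measurableT.
  - move=> n; apply/measurable_EFinP; apply: measurable_minr => //.
    exact/measurable_EFinP.
  - by move=> n w _; rewrite lee_fin le_min t0 ler0n.
  - move=> w _ a b ab; rewrite lee_fin le_min !ge_min lexx /=.
    by rewrite ler_nat ab orbT.
  - move=> w _; apply: cvg_near_cst; near=> n.
    congr EFin; apply: min_l; near: n; exact: nbhs_infty_ger.
rewrite -(cvg_lim (@ereal_hausdorff R) c); apply: lime_le; first exact/cvgP/c.
by apply: nearW => n; exact: min_bound.
Unshelve. all: by end_near. Qed.

Let tpsi_fin : \int[P]_w (tpsi p M (Xw w))%:E \is a fin_num.
Proof.
rewrite ge0_fin_numE; last by apply: integral_ge0 => w _; rewrite lee_fin tpsi_ge0.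
apply: (@le_lt_trans _ _ (\int[P]_w ((M `^ (p - 1))%:E * (Xw w)%:E))).
  apply: ge0_le_integral => //.
  - by move=> w _; rewrite lee_fin tpsi_ge0.
  - by apply: measurable_funeM; exact/measurable_EFinP.
  - by move=> w _; rewrite -EFinM lee_fin tpsi_le_lin.
rewrite ge0_integralZl_EFin ?powR_ge0 //; last 2 first.
- by move=> w _; rewrite lee_fin.
- exact/measurable_EFinP.
rewrite lte_mul_pinfty ?lee_fin ?powR_ge0 //.
have [_ _ mnu eqc] := compH.
have -> : \int[P]_w (Xw w)%:E = \int[P]_w \int[N w]_x EH (w, x).
  apply: eq_integral => w _; rewrite /Xw fineK //.
  by apply: int_fin => //; exact: (cp_Nfin CP).
rewrite eqc.
apply: (@le_lt_trans _ _ (\int[P]_w (cst (L%:E * nu setT) w))).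
  apply: ge0_le_integral => //.
  - by move=> w _; apply: integral_ge0 => x _; rewrite lee_fin.
  - move=> w _ /=; rewrite -integral_cst //; apply: ge0_le_integral => //.
    + by move=> x _; rewrite lee_fin.
    + exact/measurable_EFinP.
    + by move=> x _ /=; rewrite lee_fin.
rewrite (integral_cst P measurableT) [X in _ * X]probability_setT mule1.
by rewrite lte_mul_pinfty ?lee_fin //; exact: (cp_nufin CP).
Qed.

Lemma core_moment_inequality :
  \int[P]_w (tpsi p M (fine (\int[N w]_x (H (w, x))%:E)))%:E <=
  (2 * (K * (2 * K) `^ (p - 1)))%:E *
    \int[P]_w (tpsi p M (fine (\int[nu]_x (H (w, x))%:E)))%:E +
  (2 * K * 2 `^ p)%:E * \int[P]_w \int[nu]_x (H (w, x) `^ p)%:E.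
Proof.
have K0 : (0 <= K)%R by apply: le_trans K1.
set I := \int[P]_w (tpsi p M (Xw w))%:E.
set J := \int[P]_w (tpsi p M (Aw w))%:E.
set Q := \int[P]_w \int[nu]_x (H (w, x) `^ p)%:E.
have J0 : 0 <= J by apply: integral_ge0 => w _; rewrite lee_fin tpsi_ge0.
have Q0 : 0 <= Q.
  by apply: integral_ge0 => w _; apply: integral_ge0 => x _; rewrite lee_fin powR_ge0.
have c0 : (0 <= K * (2 * K) `^ (p - 1))%R by rewrite mulr_ge0 ?powR_ge0.
have young : K%:E * \int[P]_w (tpow p M (Xw w) * Aw w)%:E <=
    2^-1%:E * I + (K * (2 * K) `^ (p - 1))%:E * J.
  rewrite -!ge0_integralZl_EFin // -?ge0_integralD //.
  - apply: ge0_le_integral => //.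
    + by move=> w _; rewrite -EFinM lee_fin !mulr_ge0 // tpow_ge0.
    + exact: measurable_funeM.
    + by apply: emeasurable_funD; exact: measurable_funeM.
    + move=> w _; rewrite -!EFinM -EFinD lee_fin.
      exact: tpow_young.
  - by move=> w _; rewrite -EFinM lee_fin mulr_ge0 // tpsi_ge0.
  - exact: measurable_funeM.
  - by move=> w _; rewrite -EFinM lee_fin mulr_ge0 // tpsi_ge0.
  - exact: measurable_funeM.
  - by move=> w _; rewrite lee_fin tpsi_ge0.
  - by move=> w _; rewrite lee_fin tpsi_ge0.
  - by move=> w _; rewrite lee_fin mulr_ge0 // tpow_ge0.
have bound : I <= 2^-1%:E * I + ((K * (2 * K) `^ (p - 1))%:E * J + (K * 2 `^ p)%:E * Q).
  apply: (le_trans tpsi_bound); rewrite /rhs ge0_muleDr; last 2 first.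
  - by apply: integral_ge0 => w _; rewrite lee_fin mulr_ge0 // tpow_ge0.
  - by rewrite mule_ge0 // lee_fin powR_ge0.
  by rewrite addeA muleA -EFinM leeD2r.
rewrite -/I -/J -/Q.
have [i Ei] : exists i, I = i%:E by exists (fine I); rewrite fineK.
rewrite Ei in bound *.
have : (2^-1 * i)%:E <= (K * (2 * K) `^ (p - 1))%:E * J + (K * 2 `^ p)%:E * Q.
  rewrite -EFinM -leeBlDl // -EFinB in bound.
  by rewrite (le_trans _ bound) // lee_fin; lra.
move=> h; have -> : i%:E = 2%:E * (2^-1 * i)%:E by rewrite -EFinM; congr EFin; field.
apply: (le_trans (lee_wpmul2l _ h)); first by rewrite lee_fin.
rewrite ge0_muleDr ?mule_ge0 ?lee_fin ?mulr_ge0 ?powR_ge0 //.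
by rewrite !muleA -!EFinM -[(2 * K * _)%R]mulrA lexx.
Qed.

End core_moment_inequality.

(** * Poisson random measures *)

Lemma dynkin_indep d (Omega : measurableType d) (R : realType)
    (P : probability Omega R) (G : set (set Omega)) (Ev : set Omega) :
  measurable Ev -> setI_closed G -> G `<=` measurable ->
  (forall A, G A -> P (A `&` Ev) = P A * P Ev) ->
  forall A, <<s G >> A -> measurable A /\ P (A `&` Ev) = P A * P Ev.
Proof.
move=> mEv GI Gm indG A sA.
apply: (@lambda_system_subset _ G GI setT
  [set A | measurable A /\ P (A `&` Ev) = P A * P Ev]) => //.
- apply/dynkin_lambda_system; split => /=.
  + split; first exact: measurableT.
    by rewrite setTI probability_setT mul1e.
  + move=> B [mB indB]; split; first exact: measurableC.
    have e : P (~` B `&` Ev) + P (B `&` Ev) = P Ev.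
      have mC : measurable (~` B `&` Ev) by apply: measurableI => //; exact: measurableC.
      have mI : measurable (B `&` Ev) by exact: measurableI.
      rewrite -measureU //; last by rewrite setIACA setICl set0I.
      by rewrite -setIUl setvU setTI.
    rewrite probability_setC // muleBl ?fin_num_measure // mul1e -indB -e.
    by rewrite addeK // fin_num_measure //; exact: measurableI.
  + move=> F tF indF; have mF n : measurable (F n) by have [] := indF n.
    split; first exact: bigcupT_measurable.
    rewrite setI_bigcupl !measure_bigcup //; last 2 first.
    * by move=> n _; exact: measurableI.
    * exact: trivIset_setIr.
    have [c c0 Ec] : exists2 c, (0 <= c)%R & P Ev = c%:E.
      by exists (fine (P Ev)); rewrite ?fine_ge0 // fineK // fin_num_measure.
    rewrite Ec muleC -nneseriesZl // -Ec.
    by apply: eq_eseriesr => n _; rewrite muleC; have [_ /= <-] := indF n.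
- by move=> B GB; split; [exact: Gm|exact: indG].
Qed.

Lemma poisson_prob1 (R : realType) (r : R) (k j : nat) : (0 < r)%R ->
  poisson_prob r j [set k] = (poisson_pmf r k)%:E.
Proof.
by move=> r0; rewrite /poisson_prob r0 esum_set1 // lee_fin poisson_pmf_ge0.
Qed.

Lemma poisson_prob_mean (R : realType) (r : R) : (0 <= r)%R ->
  \sum_(k <oo) (k%:R%:E * poisson_prob r 0 [set k]) = r%:E.
Proof.
rewrite le_eqVlt => /predU1P[<-|r0].
  apply: eseries0 => k _ _; rewrite /poisson_prob ltxx diracE.
  by case: k => [|k]; rewrite ?mul0e // memNset ?mule0.
have pmf0 k : 0 <= (poisson_pmf r k)%:E :> \bar R by rewrite lee_fin poisson_pmf_ge0.
have kpmf0 k : 0 <= k%:R%:E * (poisson_pmf r k)%:E.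
  by apply: mule_ge0 => //; rewrite lee_fin.
under eq_eseriesr do rewrite poisson_prob1 //.
rewrite nneseries_recl //=.
rewrite mul0e add0e -nneseries_addn //.
transitivity (\sum_(k <oo) r%:E * (poisson_pmf r k)%:E).
  apply: eq_eseriesr => k _; rewrite addn1 -!EFinM; congr EFin.
  rewrite /poisson_pmf r0 factS natrM exprS invfM.
  have k0 : (k.+1%:R != 0 :> R)%R by rewrite pnatr_eq0.
  by rewrite !mulrA; congr (_ * _ * _)%R; field.
rewrite nneseriesZl //.
have -> : \sum_(k <oo) (poisson_pmf r k)%:E = poisson_prob r 0 [set: nat].
  by rewrite /poisson_prob r0 nneseries_esumT // => k; rewrite lee_fin poisson_pmf_ge0.
by rewrite probability_setT mule1.
Qed.

Section poisson_random_measure.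
Context {R : realType} d {Omega : measurableType d} (P : probability Omega R).
Context dX {X : measurableType dX}.
Variables (S : set X) (nu : set X -> \bar R).
Variable N : Omega -> {measure set X -> \bar R}.
Hypothesis hN : poisson_random_measure P S nu N.

Implicit Types A B : set X.

Lemma prm_measurable A : measurable A -> A `<=` S ->
  measurable_fun [set: Omega] (fun w => N w A).
Proof. by have [h _ _ _ _] := hN; exact: h. Qed.

Lemma prm_event A (C : set (\bar R)) : measurable A -> A `<=` S -> measurable C ->
  measurable [set w | C (N w A)].
Proof.
by move=> mA AS mC; have := prm_measurable mA AS; rewrite -[X in measurable X]setTI; apply.
Qed.

Lemma prm_indep (I : finType) (A : I -> set X) (C : I -> set (\bar R)) :
  (forall i, measurable (A i)) -> (forall i, A i `<=` S) ->
  trivIset [set: I] A -> (forall i, measurable (C i)) ->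
  P [set w | forall i, C i (N w (A i))] = \prod_i P [set w | C i (N w (A i))].
Proof.
move=> mA AS tA mC; have [_ _ _ _ ind] := hN.
have trI : trivIset [set: 'I_#|I|] (A \o enum_val).
  apply/trivIsetP => i j _ _ ij /=; move/trivIsetP: tA; apply => //.
  by apply: contra ij => /eqP/enum_val_inj ->.
have := ind #|I| (A \o enum_val) (C \o enum_val) (fun i => conj (mA _) (AS _)) trI
  (fun i => mC _).
rewrite [X in _ = X](_ : _ = \prod_i P [set w | C i (N w (A i))]); last first.
  by rewrite [RHS](reindex _ (onW_bij _ (@enum_val_bij I))).
move=> <-; congr (P _); apply/seteqP; split => w /=.
  by move=> h i _; exact: h.
by move=> h i; have := h (enum_rank i) Logic.I; rewrite /= enum_rankK.
Qed.

Lemma prm_prob k A : measurable A -> A `<=` S -> nu A < +oo ->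
  P [set w | N w A = k%:R%:E] = poisson_prob (fine (nu A)) 0 [set k].
Proof. by have [_ _ h _ _] := hN => mA AS nuA; rewrite (h _ mA AS nuA k). Qed.

Let mk (k : nat) : measurable [set (k%:R%:E : \bar R)]. Proof. exact: emeasurable_set1. Qed.

Lemma prm_indep_mean A (B : set Omega) : measurable A -> A `<=` S ->
  0 <= nu A -> nu A < +oo -> measurable B ->
  (forall k : nat, P (B `&` [set w | N w A = k%:R%:E]) =
    P B * P [set w | N w A = k%:R%:E]) ->
  \int[P]_(w in B) N w A = P B * nu A.
Proof.
move=> mA AS nu0 nufin mB ind.
have nuE : (fine (nu A))%:E = nu A by rewrite fineK // ge0_fin_numE.
pose Ev k := [set w | N w A = k%:R%:E].
have mEv k : measurable (Ev k) by exact: prm_event (mk k).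
have tEv : trivIset [set: nat] Ev.
  move=> i j _ _ [w []]; rewrite /Ev /= => -> /eqP.
  by rewrite eqe eqr_nat => /eqP.
have PEv1 : P (\bigcup_k Ev k) = 1.
  have e : poisson_prob (fine (nu A)) 0 (\bigcup_k [set k]) = 1.
    by rewrite -[RHS](@probability_setT _ _ _ (poisson_prob (fine (nu A)) 0));
      congr (poisson_prob _ _ _); apply/seteqP; split => k // _; exists k.
  rewrite measure_bigcup // -e measure_bigcup //; last by move=> i j _ _ [k [/= -> ->]].
  by apply: eq_eseriesr => k _; exact: prm_prob.
have null : P (~` (\bigcup_k Ev k)) = 0.
  rewrite probability_setC; last exact: bigcupT_measurable.
  by rewrite PEv1 subee.
have mN := prm_measurable mA AS.
rewrite (@ge0_negligible_integral _ _ _ P B (~` \bigcup_k Ev k)) //; last 2 first.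
- by apply: measurableC; exact: bigcupT_measurable.
- exact: measurable_funTS.
rewrite setDE setCK setI_bigcupr ge0_integral_bigcup //; last 3 first.
- by move=> k; exact: measurableI.
- exact: measurable_funTS.
- exact: trivIset_setIl.
transitivity (\sum_(k <oo) (P B * (k%:R%:E * poisson_prob (fine (nu A)) 0 [set k]))).
  apply: eq_eseriesr => k _.
  rewrite (eq_integral (cst k%:R%:E)); last by move=> w /set_mem[_ ->].
  rewrite integral_cst; last exact: measurableI.
  by rewrite [X in _ * X]ind prm_prob // muleCA.
have [c c0 Ec] : exists2 c, (0 <= c)%R & P B = c%:E.
  by exists (fine (P B)); rewrite ?fine_ge0 // fineK // fin_num_measure.
rewrite Ec nneseriesZl; last by move=> k _; rewrite mule_ge0.
by rewrite poisson_prob_mean ?fine_ge0 // nuE.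
Qed.

Lemma prm_gt1 A : measurable A -> A `<=` S -> 0 <= nu A -> nu A < +oo ->
  P [set w | 1 < N w A] <= (fine (nu A) ^+ 2)%:E.
Proof.
move=> mA AS nu0 nufin; set r := fine (nu A).
pose Ev k := [set w | N w A = k%:R%:E].
have mEv k : measurable (Ev k) by exact: prm_event (mk k).
have r0 : (0 <= r)%R by exact: fine_ge0.
have pE : P (Ev 0%N) + P (Ev 1%N) = ((1 + r) * expR (- r))%:E.
  rewrite !prm_prob // -/r; move: r0; rewrite le_eqVlt => /predU1P[<-|r0].
    rewrite /poisson_prob ltxx !diracE mem_set // memNset //=.
    by rewrite adde0 addr0 oppr0 expR0 mulr1.
  rewrite !poisson_prob1 // /poisson_pmf r0 -EFinD; congr EFin.
  by rewrite fact0 expr0 expr1 /= invr1; ring.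
have : [set w | 1 < N w A] `<=` ~` (Ev 0%N `|` Ev 1%N).
  move=> w /= gt1 [] e; rewrite e lte_fin in gt1.
    by rewrite ltr10 in gt1.
  by rewrite ltxx in gt1.
move=> h; apply: (@le_trans _ _ (P (~` (Ev 0%N `|` Ev 1%N)))).
  apply: le_measure => //; rewrite inE.
    apply: (prm_event (C := [set x | 1 < x])) => //.
    by rewrite -set_itvoy; exact: emeasurable_itv.
  by apply: measurableC; exact: measurableU.
rewrite probability_setC; last exact: measurableU.
rewrite measureU // ?pE; last first.
  by apply/seteqP; split => // w []; rewrite /Ev /= => -> /eqP; rewrite eqe eqr_nat.
rewrite -EFinB lee_fin.
have := expR_ge1Dx (- r); have := expR_gt0 (- r) => e0 e1; nra.
Qed.

Section atoms.
Variables (n : nat) (A : 'I_n -> set X).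
Hypotheses (mA : forall i, measurable (A i)) (AS : forall i, A i `<=` S).

Definition atom (J : {set 'I_n}) : set X :=
  if [exists i, i \in J] then [set x | forall i, (x \in A i) = (i \in J)] else set0.

Lemma measurable_atom J : measurable (atom J).
Proof.
rewrite /atom; case: ifP => // _.
have -> : [set x | forall i, (x \in A i) = (i \in J)] =
    \bigcap_(i in [set: 'I_n]) (if i \in J then A i else ~` A i).
  apply/seteqP; split => x /= h.
    move=> i _; have := h i; case: ifP => _ => [/set_mem//|].
    by move=> /negP xA Ax; apply: xA; rewrite inE.
  move=> i; have := h i Logic.I; case: ifP => _ => [/mem_set//|xA].
  by apply/negP; rewrite inE.
apply: fin_bigcap_measurable => // i _.
by case: ifP => _ //; exact: measurableC.
Qed.

Lemma atom_sub J : atom J `<=` S.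
Proof.
move=> x; rewrite /atom; case: ifP => // /existsP[i iJ] /= h.
by apply: (AS (i := i)); have := h i; rewrite iJ => /set_mem.
Qed.

Lemma trivIset_atom : trivIset [set: {set 'I_n}] atom.
Proof.
move=> J J' _ _ [x []]; rewrite /atom; do 2 case: ifP => // _.
by move=> /= h h'; apply/setP => i; rewrite -h h'.
Qed.

Lemma atom_cover i : A i = \bigcup_(J in [set J : {set 'I_n} | i \in J]) atom J.
Proof.
apply/seteqP; split => x /=.
  move=> Ax; exists [set j | x \in A j]%SET; first by rewrite /= finset.inE mem_set.
  rewrite /atom ifT; first by move=> j; rewrite finset.inE.
  by apply/existsP; exists i; rewrite finset.inE mem_set.
move=> [J /= iJ]; rewrite /atom; case: ifP => // _ /= /(_ i).
by rewrite iJ => /set_mem.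
Qed.

Lemma prm_indep_family (C : 'I_n -> set (\bar R)) (G : set X) (CG : set (\bar R)) :
  (forall i, measurable (C i)) -> measurable G -> G `<=` S -> measurable CG ->
  (forall i, A i `&` G = set0) ->
  P ([set w | forall i, C i (N w (A i))] `&` [set w | CG (N w G)]) =
  P [set w | forall i, C i (N w (A i))] * P [set w | CG (N w G)].
Proof.
move=> mC mG GS mCG AG.
pose QQ := [set F | exists2 B : {set 'I_n} -> set (\bar R),
  (forall J, measurable (B J)) & F = [set w | forall J, B J (N w (atom J))]].
have mEG := prm_event mG GS mCG.
have mQ (B : {set 'I_n} -> set (\bar R)) : (forall J, measurable (B J)) ->
    measurable [set w | forall J, B J (N w (atom J))].
  move=> mB; have -> : [set w | forall J, B J (N w (atom J))] =
      \bigcap_(J in [set: {set 'I_n}]) [set w | B J (N w (atom J))].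
    by apply/seteqP; split => w /= h; [move=> J _; exact: h|move=> J; exact: h].
  apply: fin_bigcap_measurable => // J _.
  by apply: prm_event => //; [exact: measurable_atom|exact: atom_sub].
have QI : setI_closed QQ.
  move=> _ _ [B mB ->] [B' mB' ->]; exists (fun J => B J `&` B' J).
    by move=> J; exact: measurableI.
  apply/seteqP; split => w /=; first by move=> [h h'] J; split.
  by move=> h; split => J; have [] := h J.
have Qm : QQ `<=` measurable by move=> _ [B mB ->]; exact: mQ.
have indQ F : QQ F -> P (F `&` [set w | CG (N w G)]) = P F * P [set w | CG (N w G)].
  move=> [B mB ->].
  pose D (o : option {set 'I_n}) := if o is Some J then atom J else G.
  pose BD (o : option {set 'I_n}) := if o is Some J then B J else CG.
  have GA J : atom J `&` G = set0.
    apply/seteqP; split => x // [+ Gx]; rewrite /atom; case: ifP => // /existsP[i iJ] /=.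
    move=> /(_ i); rewrite iJ => /set_mem Ax.
    by have : (A i `&` G) x by []; rewrite AG.
  have tD : trivIset [set: option {set 'I_n}] D.
    move=> [J|] [J'|] _ _ // [x [Dx D'x]].
    - by congr Some; apply: trivIset_atom => //; exists x.
    - by have : (atom J `&` G) x by []; rewrite GA.
    - by have : (atom J' `&` G) x by []; rewrite GA.
  have -> : [set w | forall J, B J (N w (atom J))] `&` [set w | CG (N w G)] =
      [set w | forall o, BD o (N w (D o))].
    apply/seteqP; split => w /=; first by move=> [h hG] [J|] //=.
    by move=> h; split => [J|]; [exact: (h (Some J))|exact: (h None)].
  rewrite (prm_indep (A := D) (C := BD)) //; last 3 first.
  - by case => [J|] //=; exact: measurable_atom.
  - by case => [J|] //=; exact: atom_sub.
  - by case.
  rewrite (prm_indep (A := atom) (C := B)) //; last 3 first.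
  - exact: measurable_atom.
  - exact: atom_sub.
  - exact: trivIset_atom.
  rewrite (bigD1 None) //= muleC; congr (_ * _).
  rewrite (reindex_onto Some (fun o => odflt (@finset.set0 _) o)) /=; last by case.
  by apply: eq_bigl => J; rewrite eqxx.
suff /(dynkin_indep mEG QI Qm indQ)[] : <<s QQ >> [set w | forall i, C i (N w (A i))] by [].
have mN J : @measurable_fun _ _ (g_sigma_algebraType QQ) _ setT (fun w => N w (atom J)).
  move=> _ B mB; rewrite setTI; apply: sub_sigma_algebra.
  exists (fun J' => if J' == J then B else setT).
    by move=> J'; case: ifP.
  apply/seteqP; split => w /=; first by move=> Bw J'; case: eqP => // ->.
  by move=> /(_ J); rewrite eqxx.
have mNA i : @measurable_fun _ _ (g_sigma_algebraType QQ) _ setT (fun w => N w (A i)).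
  rewrite (_ : (fun w => N w (A i)) =
    (fun w => \sum_(J \in [set J : {set 'I_n} | i \in J]) N w (atom J))); last first.
    apply/funext => w; rewrite [in LHS]atom_cover measure_fin_bigcup //.
    - exact: finite_finset.
    - by move=> J J' _ _; exact: trivIset_atom.
    - by move=> J _; exact: measurable_atom.
  by apply: emeasurable_fsum; first exact: finite_finset.
have -> : [set w | forall i, C i (N w (A i))] =
    \bigcap_(i in [set: 'I_n]) ((fun w => N w (A i)) @^-1` C i).
  by apply/seteqP; split => w /= h; [move=> J _; exact: h|move=> J; exact: h].
apply: (@fin_bigcap_measurable _ (g_sigma_algebraType QQ)) => // i _.
by have := mNA i measurableT _ (mC i); rewrite setTI.
Qed.

End atoms.

End poisson_random_measure.

(** * Restriction to regions of finite intensity *)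

Definition finite_restr d (T : measurableType d) (R : realType)
    (mu : {measure set T -> \bar R}) (D : set T) (mD : measurable D)
    (muD : mu D < +oo) : {finite_measure set T -> \bar R} := mfrestr mD muD.

Definition image_measure d1 d2 (X : measurableType d1) (Y : measurableType d2)
    (R : realType) (mu : {measure set X -> \bar R}) (f : X -> Y)
    (mf : measurable_fun [set: X] f) : {measure set Y -> \bar R} :=
  measure_function_pushforward__canonical__measure_function_Measure mu mf.

Section sigma_finite_product.
Context d1 d2 (T1 : measurableType d1) (T2 : measurableType d2) (R : realType).
Variable m1 : {sigma_finite_measure set T1 -> \bar R}.
Variable m2 : {sigma_finite_measure set T2 -> \bar R}.

Lemma sigma_finite_product : sigma_finite [set: T1 * T2] (m1 \x m2).
Proof.
have /sigma_finiteP[F [TF ndF Foo]] := sigma_finiteT m1.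
have /sigma_finiteP[G [TG ndG Goo]] := sigma_finiteT m2.
exists (fun n => F n `*` G n).
  rewrite -setXTT TF TG; apply/seteqP; split => -[x y] /=.
    move=> [[n _ Fnx] [k _ Gky]]; exists (maxn n k) => //; split => /=.
    - by move: x Fnx; exact/subsetPset/ndF/leq_maxl.
    - by move: y Gky; exact/subsetPset/ndG/leq_maxr.
  by move=> [n _ []/= ? ?]; split; exists n.
move=> k; have [? ?] := Foo k; have [? ?] := Goo k.
split; first exact: measurableX.
by rewrite product_measure1E // lte_mul_pinfty // ge0_fin_numE.
Qed.

Definition sigma_product : {sigma_finite_measure set (T1 * T2)%type -> \bar R} :=
  HB.pack (m1 \x m2)
    (Measure_isSigmaFinite.Build _ _ _ (m1 \x m2) sigma_finite_product).

Lemma sigma_productX (A : set T1) (B : set T2) : measurable A -> measurable B ->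
  sigma_product (A `*` B) = m1 A * m2 B.
Proof. exact: product_measure1E. Qed.

End sigma_finite_product.

(* [lebesgue_measure] lives on a type whose display differs from the one of the
   sigma-algebra of [R] used for products in the statement. *)
Lemma measurable_unlock_display (R : realType) :
  measurable_fun [set: measurableTypeR R] (id : measurableTypeR R -> R).
Proof. by move=> _ B mB; rewrite setTI. Qed.

Definition lebR (R : realType) : {measure set R -> \bar R} :=
  image_measure (@lebesgue_measure R) (@measurable_unlock_display R).

Section region.
Context {R : realType} d (Omega : measurableType d) (P : probability Omega R).
Hypothesis hP : measure_is_complete P.
Variables (T : R) (E : pmetricType R).
Hypothesis hT : (0 < T)%R.
Variables (m : {finite_measure set (borel E) -> \bar R}) (l : {measure set R -> \bar R}).
Local Notation leb := (@lebesgue_measure R).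
Local Notation RR := (measurableTypeR R).
Local Notation mark := (R * borel E * R * R)%type.
Local Notation rest := (borel E * R * R)%type.
Variable N : Omega -> {measure set mark -> \bar R}.
Hypothesis hN : poisson_random_measure P (marks T) (intensity m l) N.

Definition mark_time (a : mark) : R := a.1.1.1.
Definition mark_rest (a : mark) : rest := (a.1.1.2, a.1.2, a.2).

Lemma measurable_mark_time : measurable_fun [set: mark] mark_time.
Proof.
apply: (measurableT_comp measurable_fst); apply: (measurableT_comp measurable_fst).
exact: measurable_fst.
Qed.

Lemma measurable_mark_rest : measurable_fun [set: mark] mark_rest.
Proof.
apply: measurable_fun_pair; last exact: measurable_snd.
apply: measurable_fun_pair.
  apply: (measurableT_comp measurable_snd); apply: (measurableT_comp measurable_fst).
  exact: measurable_fst.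
by apply: (measurableT_comp measurable_snd); exact: measurable_fst.
Qed.

Variables (Z U : set R).
Hypotheses (mZ : measurable Z) (mU : measurable U).
Hypotheses (Z0 : forall z, Z z -> (0 <= z)%R) (U0 : forall u, U u -> (0 <= u)%R).
Hypotheses (lZ : l Z < +oo) (lU : lebR R U < +oo).

Let TI : set R := `]0%R, T]%classic.
Let mTI : measurable TI. Proof. exact: measurable_itv. Qed.
Let lTI : lebR R TI < +oo.
Proof. by rewrite [lebR R TI] lebesgue_measure_itv /= lte_fin hT -EFinB ltry. Qed.

Definition region : set mark := TI `*` [set: borel E] `*` Z `*` U.

Lemma measurable_region : measurable region.
Proof. by do 3 (apply: measurableX => //). Qed.
Let mreg := measurable_region.

Definition leb_time : {finite_measure set R -> \bar R} := finite_restr (mu := lebR R) mTI lTI.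
Definition jump_size : {finite_measure set R -> \bar R} := finite_restr (mu := l) mZ lZ.
Definition level : {finite_measure set R -> \bar R} := finite_restr (mu := lebR R) mU lU.

Definition time_space := sigma_product leb_time m.
Definition region_intensity := sigma_product (sigma_product time_space jump_size) level.

(* Zero on the null event where the region carries infinitely many points, so that all
   realizations are finite measures. *)
Definition region_measure (w : Omega) : {measure set mark -> \bar R} :=
  if N w region < +oo then mrestr (N w) mreg : {measure set mark -> \bar R}
  else mzero : {measure set mark -> \bar R}.

Lemma intensity_measurable :
  measurable_fun [set: RR * borel E * R * RR] (id : (RR * borel E * R * RR) -> mark).
Proof. by move=> _ B mB; rewrite setTI. Qed.

Let intensity3_measurable :
  measurable_fun [set: RR * borel E * R] (id : (RR * borel E * R) -> (R * borel E * R)%type).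
Proof. by move=> _ B mB; rewrite setTI. Qed.

Let intensity2_measurable :
  measurable_fun [set: RR * borel E] (id : (RR * borel E) -> (R * borel E)%type).
Proof. by move=> _ B mB; rewrite setTI. Qed.

Let M2 : {sigma_finite_measure set (RR * borel E)%type -> \bar R} := sigma_product leb m.
Let M3 : {measure set (RR * borel E * R)%type -> \bar R} := M2 \x^ l.
Let M4 : {measure set (RR * borel E * R * RR)%type -> \bar R} := M3 \x leb.
Let I2 := image_measure M2 intensity2_measurable.
Let I3 := image_measure M3 intensity3_measurable.
Let I4 := image_measure M4 intensity_measurable.

Let I2X (A : set R) (B : set (borel E)) : measurable A -> measurable B ->
  I2 (A `*` B) = lebR R A * m B.
Proof. by move=> mA mB; exact: (@product_measure1E _ _ RR (borel E) R leb m A B). Qed.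

Let I3X (A : set (R * borel E)) (B : set R) : measurable A -> measurable B ->
  I3 (A `*` B) = I2 A * l B.
Proof.
move=> mA mB.
exact: (@product_measure2E _ _ (RR * borel E)%type R R M2 l A B).
Qed.

Let I4X (A : set (R * borel E * R)) (B : set R) : measurable A -> measurable B ->
  I4 (A `*` B) = I3 A * lebR R B.
Proof.
move=> mA mB.
exact: (@product_measure1E _ _ (RR * borel E * R)%type RR R M3 leb A B).
Qed.

Lemma region_intensityE (F : set mark) : measurable F ->
  region_intensity F = intensity m l (F `&` region).
Proof.
move=> mF; rewrite /region_intensity.
pose S1 := TI `*` [set: borel E]; pose S2 := S1 `*` Z.
have mS1 : measurable S1 by exact: measurableX.
have mS2 : measurable S2 by exact: measurableX.
have e1 A : measurable A -> time_space A = I2 (A `&` S1).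
  move=> mA; apply: (product_measure_unique (m' := mrestr I2 mS1)) => //.
  move=> A1 B1 mA1 mB1; change (I2 ((A1 `*` B1) `&` S1) = leb_time A1 * m B1).
  rewrite -setXI setIT.
  by rewrite I2X //; exact: measurableI.
have e2 A : measurable A ->
    sigma_product time_space jump_size A = I3 (A `&` S2).
  move=> mA; apply: (product_measure_unique (m' := mrestr I3 mS2)) => //.
  move=> A1 B1 mA1 mB1; change (I3 ((A1 `*` B1) `&` S2) = time_space A1 * jump_size B1); rewrite -setXI.
  rewrite I3X -?e1 //; exact: measurableI.
apply: (product_measure_unique (m' := mrestr I4 mreg)) => //.
move=> A1 B1 mA1 mB1; 
change (I4 ((A1 `*` B1) `&` (S2 `*` U)) =
  sigma_product time_space jump_size A1 * level B1); rewrite -setXI.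
by rewrite I4X -?e2 //; exact: measurableI.
Qed.

Lemma region_intensityX (I : set R) (B : set (borel E)) (A C : set R) :
  measurable I -> measurable B -> measurable A -> measurable C ->
  region_intensity (I `*` B `*` A `*` C) =
  lebR R (I `&` TI) * m B * l (A `&` Z) * lebR R (C `&` U).
Proof.
move=> mI mB mA mC; rewrite /region_intensity.
rewrite sigma_productX //; last by do 2 (apply: measurableX => //).
rewrite sigma_productX //; last by apply: measurableX.
by rewrite sigma_productX.
Qed.

Lemma region_intensity_fin : region_intensity [set: mark] < +oo.
Proof.
rewrite -[[set: mark]](_ : [set: R] `*` [set: borel E] `*` [set: R] `*` [set: R] = _);
  last by rewrite !setXTT.
rewrite region_intensityX // !setTI.
by rewrite ltey_eq !fin_numM // ?fin_num_measure // ge0_fin_numE.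
Qed.

Let reg_marks : region `<=` marks T.
Proof.
move=> [[[s y] z] u] [[[/= ti _] Zz] Uu].
move: ti; rewrite /TI /= in_itv /= => /andP[s0 sT].
by split; rewrite /= ?sT ?(ltW s0) //; [exact: Z0|exact: U0].
Qed.

Local Notation tm := mark_time.
Local Notation pr := mark_rest.

Let mcyl a b B : measurable B -> measurable (cyl tm pr a b B).
Proof.
move=> mB; have -> : cyl tm pr a b B = tm @^-1` `]a, b]%classic `&` pr @^-1` B.
  by apply/seteqP; split => x; rewrite /cyl /= in_itv.
apply: measurableI; rewrite -[X in measurable X]setTI.
  exact: measurable_mark_time.
exact: measurable_mark_rest.
Qed.

Lemma raw_indep q (G : set mark) (C : set (\bar R)) (A : set Omega) :
  (0 <= q <= T)%R -> measurable G -> G `<=` marks T ->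
  (forall x, G x -> (q < tm x)%R) -> measurable C ->
  raw_filtration P N q A ->
  measurable A /\ P (A `&` [set w | C (N w G)]) = P A * P [set w | C (N w G)].
Proof.
move=> /andP[q0 qT] mG GS Gq mC rawA.
pose cylinder := [set F | exists n (A : 'I_n -> set mark) (B : 'I_n -> set (\bar R)),
  [/\ forall i, measurable (A i), forall i, A i `<=` marks T,
      forall i x, A i x -> (tm x <= q)%R, forall i, measurable (B i)
    & F = [set w | forall i, B i (N w (A i))]]].
pose PP : set (set Omega) := cylinder `|` [set F | P.-negligible F].
have mEv : measurable [set w | C (N w G)] by exact: (prm_event hN).
have mPP : PP `<=` measurable.
  move=> F [[n [A' [B [mA AS Aq mB ->]]]]|]; last exact: hP.
  have -> : [set w | forall i, B i (N w (A' i))] =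
      \bigcap_(i in [set: 'I_n]) [set w | B i (N w (A' i))].
    by apply/seteqP; split => w /= h; [move=> i _; exact: h|move=> i; exact: h].
  by apply: fin_bigcap_measurable => // i _; exact: (prm_event hN).
apply: (dynkin_indep (G := PP)) => //.
- move=> F F' [cF|nF] [cF'|nF']; [left|right|right|right].
  + move: cF cF' => [n [A1 [B1 [mA1 AS1 Aq1 mB1 ->]]]] [n' [A2 [B2 [mA2 AS2 Aq2 mB2 ->]]]].
    exists (n + n')%N, (fun i => match fintype.split i with inl j => A1 j | inr j => A2 j end).
    exists (fun i => match fintype.split i with inl j => B1 j | inr j => B2 j end).
    split; try by move=> i; case: (fintype.split i).
    apply/seteqP; split => w /=.
      by move=> [h1 h2] i; case: (fintype.split i).
    move=> h; split => i.
      by have := h (unsplit (inl i)); rewrite unsplitK.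
    by have := h (unsplit (inr i)); rewrite unsplitK.
  + by apply: negligibleS nF'; exact: subIsetr.
  + by apply: negligibleS nF; exact: subIsetl.
  + by apply: negligibleS nF; exact: subIsetl.
- move=> F [[n [A' [B [mA AS Aq mB ->]]]]|nF].
    apply: (prm_indep_family hN) => // i; apply/seteqP; split => // x [/Aq xq /Gq].
    by move=> /lt_le_trans/(_ xq); rewrite ltxx.
  have mF := hP nF.
  have PF : P F = 0 by exact: measure_negligible.
  rewrite PF mul0e; apply: (@subset_measure0 _ _ _ P _ F) => //.
  exact: measurableI.
apply: sub_sigma_algebra2 rawA => F [|nF]; last by right.
move=> [s [B [C' [/andP[s0 sq] mB BS mC' ->]]]]; left.
exists 1%N, (fun=> slab s B), (fun=> C'); split => //.
- by move=> _; exact: (@mcyl 0 s B mB).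
- move=> _ x [/andP[x0 xs] /BS [z0 u0]]; split => //.
  by rewrite ltW //= (le_trans xs) // (le_trans sq).
- by move=> _ x [/andP[_ xs] _]; exact: le_trans sq.
- by apply/seteqP; split => w /= h; [move=> _|exact: (h ord0)].
Qed.

Let intensity_sub (G : set mark) : measurable G -> G `<=` region ->
  intensity m l G = region_intensity G.
Proof. by move=> mG Gr; rewrite region_intensityE // setIidl. Qed.

Let region_fin (G : set mark) : measurable G -> region_intensity G < +oo.
Proof.
move=> mG; apply: le_lt_trans region_intensity_fin.
by apply: le_measure; rewrite ?inE //; exact: subsetT.
Qed.

Let mean_sub (G : set mark) (A : set Omega) : measurable G -> G `<=` region ->
  measurable A ->
  (forall k : nat, P (A `&` [set w | N w G = k%:R%:E]) =
    P A * P [set w | N w G = k%:R%:E]) ->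
  \int[P]_(w in A) N w G = P A * region_intensity G.
Proof.
move=> mG Gr mA ind; rewrite (prm_indep_mean hN) // ?intensity_sub //.
- exact: subset_trans reg_marks.
- exact: region_fin.
Qed.

Let bad := [set w | N w region = +oo].

Let mbad : measurable bad.
Proof. exact: (prm_event hN mreg reg_marks (emeasurable_set1 +oo)). Qed.

Let badE w : (N w region < +oo) = (w \notin bad).
Proof.
apply/idP/idP => [h|/negP h]; first by apply/negP; rewrite inE /bad /= => e; rewrite e in h.
by rewrite ltey; apply/eqP => e; apply: h; rewrite inE.
Qed.

Let bad_null : P bad = 0.
Proof.
have mN := prm_measurable hN mreg reg_marks.
have intN : \int[P]_w N w region = region_intensity region.
  rewrite mean_sub // ?probability_setT ?mul1e // => k.
  by rewrite setTI mul1e.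
have iN : P.-integrable [set: Omega] (fun w => N w region).
  apply/integrableP; split => //.
  under eq_integral do rewrite gee0_abs //.
  by rewrite intN; exact: region_fin.
have := integrable_ae measurableT iN => -[B [mB PB Bsub]].
apply: (@subset_measure0 _ _ _ P _ B) => // w bw; apply: Bsub => /= /(_ Logic.I).
by rewrite (bw : N w region = +oo).
Qed.

Lemma region_finite_ae : {ae P, forall w, N w region < +oo}.
Proof.
exists bad; split; [exact: mbad|exact: bad_null|] => w /= /negP.
by rewrite badE negbK inE.
Qed.

Let NSE w A : region_measure w A = if w \in bad then 0 else N w (A `&` region).
Proof. by rewrite /region_measure badE; case: (w \in bad). Qed.

Lemma raw_mono s t : (s <= t)%R -> raw_filtration P N s `<=` raw_filtration P N t.
Proof.
move=> st; apply: sub_sigma_algebra2 => F [[s' [B [C [/andP[s0 ss] mB BS mC ->]]]]|nF].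
  by left; exists s', B, C; split => //; rewrite s0 (le_trans ss).
by right.
Qed.

Let Fil := filtration T P N.

Lemma raw_sub_filtration t : (0 <= t <= T)%R -> raw_filtration P N t `<=` Fil t.
Proof.
move=> /andP[t0 tT] A rA; rewrite /Fil /filtration; case: ifPn => [ltT|].
  by move=> r /=; rewrite in_itv /= => /andP[/ltW tr _]; exact: raw_mono rA.
by rewrite -leNgt => Tt; apply: raw_mono rA.
Qed.

Lemma filtration_sub_raw s t : (0 <= s)%R -> (s < t)%R -> (t <= T)%R ->
  Fil s `<=` raw_filtration P N t.
Proof.
move=> s0 st tT A; rewrite /Fil /filtration (lt_le_trans st tT) => h.
by apply: h; rewrite /= in_itv /= st.
Qed.

Lemma filtration_sigma_algebra t : sigma_algebra [set: Omega] (Fil t).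
Proof.
have raw_sa s : sigma_algebra [set: Omega] (raw_filtration P N s).
  exact: smallest_sigma_algebra.
rewrite /Fil /filtration; case: ifP => _; last exact: raw_sa.
split.
- by move=> r _; have [h _ _] := raw_sa r.
- by move=> A hA r hr; have [_ h _] := raw_sa r; apply: h; exact: hA.
- by move=> F hF r hr; have [_ _ h] := raw_sa r; apply: h => n; exact: hF.
Qed.

Lemma filtration_measurable t : (0 <= t <= T)%R -> Fil t `<=` measurable.
Proof.
move=> /andP[t0 tT] A fA.
have rA : raw_filtration P N T A.
  move: fA; rewrite /Fil /filtration; case: ifP => // tT' h; apply: h.
  by rewrite /= in_itv /= tT' lexx.
have TT : (0 <= T <= T)%R by rewrite lexx ltW.
have [] := @raw_indep T set0 setT A TT measurable0 _ _ measurableT rA => //.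
Qed.

Lemma filtration_mono s t : (0 <= s)%R -> (s <= t)%R -> (t <= T)%R -> Fil s `<=` Fil t.
Proof.
move=> s0; rewrite le_eqVlt => /predU1P[-> _ A|st tT] //.
have t0 : (0 <= t)%R by exact: le_trans s0 (ltW st).
move=> A /(filtration_sub_raw s0 st tT) rA.
by apply: raw_sub_filtration rA; rewrite t0.
Qed.

Lemma region_adapted a b B : (0 <= a)%R -> (a <= b)%R -> (b <= T)%R -> measurable B ->
  measurable_fun [set: FilT Fil b] (fun w => region_measure w (cyl tm pr a b B)).
Proof.
move=> a0 ab bT mB.
pose RT := g_sigma_algebraType ([set F | exists (s : R) (B : set rest) (C : set (\bar R)),
         [/\ (0 <= s <= b)%R, measurable B,
             B `<=` [set c | (0 <= c.1.2)%R /\ (0 <= c.2)%R],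
             measurable C
           & F = [set w | C (N w (slab s B))]]]
      `|` [set F | P.-negligible F]).
pose B' : set rest := B `&` [set: borel E] `*` Z `*` U.
have mB' : measurable B'.
  by apply: measurableI => //; do 2 (apply: measurableX => //).
have mg s : (0 <= s)%R -> (s <= b)%R ->
    @measurable_fun _ _ RT _ setT (fun w => N w (slab s B')).
  move=> s0 sb _ C mC; rewrite setTI; apply: sub_sigma_algebra; left.
  exists s, B', C; split => //; first by rewrite s0.
  by move=> [[y z] u] /= [_ [[_ Zz] Uu]]; split; [exact: Z0|exact: U0].
have mbadR : measurable (bad : set RT).
  by apply: sub_sigma_algebra; right; exact/negligibleP.
have -> : (fun w => region_measure w (cyl tm pr a b B)) =
    ((fun w => N w (slab b B') - N w (slab a B')) \_ (~` bad)).
  apply/funext => w; rewrite NSE patchE in_setC.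
  case: (boolP (w \in bad)) => //= wbad.
  have slabE s : (s <= T)%R -> slab s B' = cyl tm pr 0 s B `&` region.
    move=> sT; apply/seteqP; split => -[[[r y] z] u]; rewrite /slab /cyl /region /B' /TI /=.
      move=> [/andP[r0 rs] [By [[_ Zz] Uu]]]; split; first by rewrite r0 rs.
      by rewrite in_itv /= r0 (le_trans rs sT).
    by move=> [[-> By] [[_ Zz] Uu]].
  have msl s : (s <= T)%R -> measurable (slab s B').
    by move=> sT; rewrite slabE //; apply: measurableI => //; exact: mcyl.
  have aT := le_trans ab bT.
  have slab_sub : slab a B' `<=` slab b B'.
    by move=> x [/andP[x0 xa] Bx]; split => //; rewrite x0 (le_trans xa).
  have -> : N w (slab a B') = N w (slab b B' `&` slab a B').
    by congr (N w _); rewrite setIidr.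
  rewrite -measureD; [|exact: msl|exact: msl|]; last first.
    apply: (@le_lt_trans _ _ (N w region)); last by rewrite badE.
    apply: le_measure; rewrite ?inE; [exact: msl|exact: mreg|].
    by rewrite slabE //; exact: subIsetr.
  congr (N w _); rewrite !slabE //.
  apply/seteqP; split => x; rewrite /cyl /=.
    move=> [[/andP[ax xb] Bx] rx]; split.
      by split => //; split => //; rewrite (le_lt_trans a0 ax).
    by move=> [[/andP[_ xa] _] _]; have := lt_le_trans ax xa; rewrite ltxx.
  move=> [[[/andP[x0 xb] Bx] rx] nx]; split => //; split => //.
  rewrite xb andbT ltNge; apply/negP => xa; apply: nx; split => //; split => //.
  by rewrite x0.
have bT' : (0 <= b <= T)%R by rewrite bT (le_trans a0 ab).
have mR : @measurable_fun _ _ RT _ setT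
    ((fun w => N w (slab b B') - N w (slab a B')) \_ (~` bad)).
  apply/(@measurable_restrictT _ _ RT _ _ _ (measurableC mbadR)).
  apply: (@measurable_funTS _ _ RT).
  by apply: emeasurable_funB; [apply: mg => //; exact: le_trans ab|exact: mg].
move=> _ C mC; apply: sub_sigma_algebra; apply: (raw_sub_filtration bT').
exact: mR.
Qed.

Lemma region_comp a b B A : (0 <= a)%R -> (a <= b)%R -> (b <= T)%R ->
  Fil a A -> measurable B ->
  \int[P]_(w in A) region_measure w (cyl tm pr a b B) =
  P A * region_intensity (cyl tm pr a b B).
Proof.
move=> a0; rewrite le_eqVlt => /predU1P[<-|ab] bT fA mB.
  have -> : cyl tm pr a a B = set0.
    apply/seteqP; split => x // [/andP[ax xa] _].
    by have := lt_le_trans ax xa; rewrite ltxx.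
  by under eq_integral do rewrite measure0; rewrite integral0 measure0 mule0.
have aT := lt_le_trans ab bT.
have mA : measurable A by apply: filtration_measurable fA; rewrite a0 ltW.
have nuE F : measurable F -> region_intensity (F `&` region) = region_intensity F.
  move=> mF; have mI : measurable (F `&` region) by exact: measurableI.
  by rewrite (region_intensityE mF) (region_intensityE mI) -setIA setIid.
pose G q := cyl tm pr q b B `&` region.
have mG q : measurable (G q) by apply: measurableI => //; exact: mcyl.
have G_marks q : G q `<=` marks T by apply: subset_trans reg_marks; exact: subIsetr.
have mNG q : measurable_fun [set: Omega] (fun w => N w (G q)).
  exact: (prm_measurable hN).
have step q : (a < q)%R ->
    \int[P]_(w in A) N w (G q) = P A * region_intensity (cyl tm pr q b B).
  move=> aq; case: (leP b q) => bq.
    have -> : G q = set0.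
      apply/seteqP; split => x // [[/andP[qx xb] _] _].
      by have := le_lt_trans (le_trans xb bq) qx; rewrite ltxx.
    have -> : cyl tm pr q b B = set0.
      apply/seteqP; split => x // [/andP[qx xb] _].
      by have := le_lt_trans (le_trans xb bq) qx; rewrite ltxx.
    by under eq_integral do rewrite measure0; rewrite integral0 measure0 mule0.
  have qT : (q <= T)%R by rewrite ltW // (lt_le_trans bq).
  have rA := filtration_sub_raw a0 aq qT fA.
  have qT' : (0 <= q <= T)%R by rewrite qT (le_trans a0 (ltW aq)).
  have Gsub : G q `<=` region by exact: subIsetr.
  rewrite (mean_sub (mG q) Gsub mA) => [|k]; first by rewrite nuE //; exact: mcyl.
  have Gq x : G q x -> (q < tm x)%R by move=> [[/andP[]]].
  by have [] := raw_indep qT' (mG q) (G_marks q) Gq (emeasurable_set1 k%:R%:E) rA.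
transitivity (\int[P]_(w in A) N w (G a)).
  apply: ge0_ae_eq_integral => //.
  - apply: measurable_funTS; have bT' : (0 <= b <= T)%R by rewrite bT (le_trans a0 (ltW ab)).
    move=> _ C mC; apply: (filtration_measurable bT').
    have := region_adapted a0 (ltW ab) bT mB measurableT mC.
    by rewrite /measurable /= sigma_algebra_id //; exact: filtration_sigma_algebra.
  - exact: measurable_funTS.
  - exists bad; split => // w /= /not_implyP[_]; rewrite NSE.
    by case: (boolP (w \in bad)) => // wb _; rewrite inE in wb.
pose q n : R := (a + n.+1%:R^-1)%R.
have aq n : (a < q n)%R by rewrite ltrDl invr_gt0 ltr0n.
have qmono i j : (i <= j)%N -> (q j <= q i)%R.
  by move=> ij; rewrite lerD2l lef_pV2 ?posrE ?ltr0n // ler_nat.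
have cylU : \bigcup_n cyl tm pr (q n) b B = cyl tm pr a b B.
  apply/seteqP; split => x.
    by move=> [n _ [/andP[qx xb] Bx]]; split => //; rewrite xb andbT (lt_trans (aq n)).
  move=> [/andP[ax xb] Bx]; have e0 : (0 < tm x - a)%R by rewrite subr_gt0.
  exists (Num.bound (tm x - a)^-1) => //; split => //; rewrite xb andbT /q.
  rewrite -ltrBrDl -[ltRHS]invrK ltf_pV2 ?posrE ?ltr0n ?invr_gt0 //.
  rewrite (lt_le_trans (archi_boundP _)) ?ler_nat // invr_ge0 ltW //.
have ndcyl : nondecreasing_seq (fun n => cyl tm pr (q n) b B).
  move=> i j ij; apply/subsetPset => x [/andP[qx xb] Bx]; split => //.
  by rewrite xb andbT (le_lt_trans (qmono _ _ ij)).
have c1 : (fun n => \int[P]_(w in A) N w (G (q n))) @ \oo --> \int[P]_(w in A) N w (G a).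
  apply: cvg_monotone_integral => //.
  - by move=> n; exact: measurable_funTS.
  - move=> w _ i j ij; apply: le_measure; rewrite ?inE //.
    by apply: setSI; apply/subsetPset; exact: ndcyl.
  - move=> w _; have -> : G a = \bigcup_n G (q n) by rewrite /G -cylU setI_bigcupl.
    apply: nondecreasing_cvg_mu => //; first by apply: bigcupT_measurable.
    by move=> i j ij; apply/subsetPset; apply: setSI; apply/subsetPset; exact: ndcyl.
have c2 : (fun n => P A * region_intensity (cyl tm pr (q n) b B)) @ \oo -->
    P A * region_intensity (cyl tm pr a b B).
  apply: cvgeZl; first exact: fin_num_measure.
  rewrite -cylU; apply: nondecreasing_cvg_mu => //.
    by move=> n; exact: mcyl.
  by apply: bigcupT_measurable => n; exact: mcyl.
have e : (fun n => \int[P]_(w in A) N w (G (q n))) =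
    (fun n => P A * region_intensity (cyl tm pr (q n) b B)).
  by apply/funext => n; exact: step.
by rewrite e in c1; exact: (cvg_unique (@ereal_hausdorff R) c1 c2).
Qed.

Lemma region_sub_support : region `<=` cyl tm pr 0 T [set: rest].
Proof.
move=> [[[s y] z] u] [[[/= ti _] _] _]; split => //.
Qed.

Lemma region_compensated :
  compensated P T tm pr Fil region_measure region_intensity.
Proof.
have mD : measurable (cyl tm pr 0 T [set: rest]) by exact: mcyl.
have DI : ~` cyl tm pr 0 T [set: rest] `&` region = set0.
  by apply/seteqP; split => x // [nx rx]; apply: nx; exact: region_sub_support.
split => //.
- exact: measurable_mark_time.
- exact: measurable_mark_rest.
- by move=> t _; exact: filtration_sigma_algebra.
- exact: filtration_measurable.
- exact: filtration_mono.
- move=> w; rewrite NSE; case: (boolP (w \in bad)) => [_|wb]; first exact: ltry.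
  by rewrite setTI badE.
- exact: region_intensity_fin.
- by move=> w; rewrite NSE DI measure0; case: ifP.
- apply: (etrans (region_intensityE (measurableC mD))).
  by rewrite DI intensity_sub // measure0.
- exact: region_adapted.
- by move=> a b A B *; exact: region_comp.
Qed.

Definition region_rate : R := fine (m [set: borel E] * l Z * lebR R U).

Lemma region_simple a b : (0 <= a)%R -> (a <= b)%R -> (b <= T)%R ->
  P [set w | 1 < region_measure w (cyl tm pr a b [set: rest])] <=
  (region_rate ^+ 2 * (b - a) ^+ 2)%:E.
Proof.
move=> a0 ab bT; set G := cyl tm pr a b [set: rest].
have mG : measurable G by exact: mcyl.
have mGr : measurable (G `&` region) by exact: measurableI.
apply: (@le_trans _ _ (P [set w | 1 < N w (G `&` region)])).
  apply: le_measure; rewrite ?inE.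
  - have TT : (0 <= b <= T)%R by rewrite bT (le_trans a0 ab).
    have mf := FilT_fun region_compensated TT (region_adapted a0 ab bT measurableT).
    have m1 : measurable_fun [set: Omega] (fun=> 1 : \bar R) by exact: measurable_cst.
    by have := measurable_lte measurableT m1 mf; rewrite setTI.
  - apply: (prm_event hN (C := [set x | 1 < x])) => //.
      by apply: subset_trans reg_marks; exact: subIsetr.
    by rewrite -set_itvoy; exact: emeasurable_itv.
  - move=> w /=; rewrite NSE; case: ifP => // _.
    by rewrite lte_fin ltr10.
have nuG : intensity m l (G `&` region) = ((b - a) * region_rate)%:E.
  rewrite -region_intensityE //.
  have -> : G = `]a, b]%classic `*` [set: borel E] `*` [set: R] `*` [set: R].
    by apply/seteqP; split => -[[[s y] z] u]; rewrite /G /cyl /mark_time /= in_itv /=;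
      [move=> [? _]|move=> [[[? _] _] _]].
  rewrite region_intensityX // !setTI.
  have -> : `]a, b]%classic `&` TI = `]a, b]%classic.
    apply/setIidl => s; rewrite /TI /= !in_itv /= => /andP[a_s sb].
    by rewrite (le_lt_trans a0 a_s) (le_trans sb bT).
  have -> : lebR R `]a, b]%classic = (b - a)%:E.
    rewrite [LHS]lebesgue_measure_itv /= lte_fin; case: ifPn => //.
    by rewrite -leNgt => ba; have -> : a = b; [apply/le_anti; rewrite ab|rewrite subrr].
  rewrite EFinM /region_rate fineK ?muleA //.
  by rewrite !fin_numM // ?fin_num_measure // ge0_fin_numE.
rewrite (le_trans (prm_gt1 hN _ _ _ _)) // ?nuG //.
- by apply: subset_trans reg_marks; exact: subIsetr.
- by rewrite lee_fin mulr_ge0 ?subr_ge0 // fine_ge0 // !mule_ge0.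
- exact: ltry.
- by rewrite lee_fin /= exprMn mulrC.
Qed.

End region.

(** * Integrals over time and space *)

Lemma ge0_integral_mrestr d (T : measurableType d) (R : realType)
    (mu : {measure set T -> \bar R}) (D : set T) (mD : measurable D) (f : T -> \bar R) :
  measurable_fun [set: T] f -> (forall x, 0 <= f x) ->
  \int[mrestr mu mD]_x f x = \int[mu]_(x in D) f x.
Proof.
move=> mf f0.
suff [] : measurable_fun [set: T] f /\ \int[mrestr mu mD]_x f x = \int[mu]_(x in D) f x by [].
move: f mf f0; apply: ge0_measurable_fun_ind.
- move=> A mA; split; first by apply/measurable_EFinP; exact: measurable_indic.
  by rewrite !integral_indic // setIT.
- move=> c f c0 f0 [mf ef]; split; first exact: measurable_funeM.
  rewrite !ge0_integralZl_EFin ?ef //; exact: measurable_funTS.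
- move=> f g f0 g0 [mf ef] [mg eg]; split; first exact: emeasurable_funD.
  rewrite !ge0_integralD ?ef ?eg //; exact: measurable_funTS.
- move=> f_ f f_0 ndf cvf Qf.
  have mf : measurable_fun [set: T] f.
    by apply: (emeasurable_fun_cvg f_) => // n; have [] := Qf n.
  split => //.
  have c1 : (fun n => \int[mrestr mu mD]_x f_ n x) @ \oo --> \int[mrestr mu mD]_x f x.
    by apply: cvg_monotone_integral => // n; have [] := Qf n.
  have c2 : (fun n => \int[mu]_(x in D) f_ n x) @ \oo --> \int[mu]_(x in D) f x.
    by apply: cvg_monotone_integral => // n; apply: measurable_funTS; have [] := Qf n.
  have e : (fun n => \int[mrestr mu mD]_x f_ n x) = (fun n => \int[mu]_(x in D) f_ n x).
    by apply/funext => n; have [] := Qf n.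
  by rewrite e in c1; exact: (cvg_unique (@ereal_hausdorff R) c1 c2).
Qed.

Section lebesgue_reflection.
Context {R : realType}.
Local Notation leb := (@lebesgue_measure R).
Local Notation RR := (measurableTypeR R).

Let mrefl (t : R) : measurable_fun [set: RR] ((fun s => t - s)%R : RR -> RR).
Proof. by apply: measurable_funB. Qed.

Lemma lebesgue_measure_reflect (t : R) (A : set RR) : measurable A ->
  leb ((fun s => t - s)%R @^-1` A) = leb A.
Proof.
move=> mA; apply/esym.
apply: (lebesgue_measure_unique (mu := image_measure leb (mrefl t))) => // _ [[a b]] _ <-.
change (leb `]a, b] = leb ((fun s => t - s)%R @^-1` `]a, b]%classic)).
have -> : (fun s => t - s)%R @^-1` `]a, b]%classic = `[(t - b)%R, (t - a)%R[%classic.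
  by apply/seteqP; split => s; rewrite /= !in_itv /= => /andP[? ?]; apply/andP; split; lra.
rewrite !lebesgue_measure_itv /= !lte_fin ltrD2l ltrN2.
by case: ifP => // _; rewrite -!EFinB; congr EFin; ring.
Qed.

Lemma ge0_integral_lebR (D : set R) (f : R -> \bar R) :
  measurable D -> measurable_fun D f -> (forall x, D x -> 0 <= f x) ->
  \int[lebR R]_(x in D) f x = \int[leb]_(x in D) f x.
Proof.
move=> mD mf f0.
apply: (@ge0_integral_pushforward _ _ RR R R id (@measurable_unlock_display R) leb D f) => //.
by move=> x; rewrite inE; exact: f0.
Qed.

Lemma ge0_integral_reflect (t : R) (f : R -> \bar R) :
  measurable_fun [set: R] f -> (forall x, 0 <= f x) ->
  \int[lebR R]_s f (t - s)%R = \int[lebR R]_s f s.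
Proof.
move=> mf f0; have mr : measurable_fun [set: R] (fun s : R => t - s)%R.
  exact: measurable_funB.
rewrite -(@ge0_integral_pushforward _ _ R R R _ mr (lebR R) setT f) //.
apply: eq_measure_integral => A mA _; exact: lebesgue_measure_reflect.
Qed.

End lebesgue_reflection.

Section time_space_bound.
Context {R : realType} (E : pmetricType R) (T : R) (hT : (0 < T)%R).
Variable m : {finite_measure set (borel E) -> \bar R}.
Local Notation leb := (@lebesgue_measure R).

Lemma time_space_le (t : R) (F : R * borel E -> \bar R) (kap : R -> \bar R) :
  (t <= T)%R -> measurable_fun [set: R * borel E] F -> (forall a, 0 <= F a) ->
  (forall s y, ~ (0 < s < t)%R -> F (s, y) = 0) ->
  measurable_fun `]0%R, T]%classic kap -> (forall r, (0 < r <= T)%R -> 0 <= kap r) ->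
  (forall s, (0 < s < t)%R -> \int[m]_y F (s, y) <= kap (t - s)%R) ->
  \int[time_space hT m]_a F a <= \int[leb]_(r in `]0%R, T]) kap r.
Proof.
move=> tT mF F0 Fout mk k0 Fk.
pose k' := kap \_ `]0%R, T]%classic.
have mk' : measurable_fun [set: R] k'.
  exact: (measurable_restrictT kap (measurable_itv _)).1 mk.
have k'0 r : 0 <= k' r.
  by rewrite /k' patchE; case: ifPn => //; rewrite inE /= in_itv /= => /k0.
rewrite (fubini_tonelli1 _ mF F0).
apply: (@le_trans _ _ (\int[leb_time hT]_s k' (t - s)%R)).
  apply: ge0_le_integral => //.
  - by move=> s _; exact: integral_ge0.
  - exact: measurable_fun_fubini_tonelli_F.
  - apply: (measurableT_comp mk'); exact: measurable_funB.
  - move=> s _; case: (boolP (0 < s < t)%R) => st.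
      apply: (le_trans (Fk s st)); rewrite /k' patchE ifT //.
      by rewrite inE /= in_itv /=; case/andP: st => ? ?; apply/andP; split; lra.
    rewrite [X in X <= _](_ : _ = 0); first exact: k'0.
    by apply: integral0_eq => y _; apply: Fout; exact/negP.
have mc : measurable_fun [set: R] (fun s => k' (t - s)%R).
  by apply: (measurableT_comp mk'); exact: measurable_funB.
rewrite (_ : \int[leb_time hT]_s k' (t - s)%R =
    \int[lebR R]_(s in `]0%R, T]) k' (t - s)%R); last by exact: ge0_integral_mrestr.
apply: (@le_trans _ _ (\int[lebR R]_s k' (t - s)%R)).
  by apply: ge0_subset_integral => //; exact: subsetT.
rewrite ge0_integral_reflect // /k' -integral_mkcond.
by rewrite ge0_integral_lebR // => r /=; rewrite in_itv /= => /k0.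
Qed.

End time_space_bound.

(** * Predictable fields *)

Lemma measurable_fun_pair_in d d1 d2 (T : measurableType d) (T1 : measurableType d1)
    (T2 : measurableType d2) (D : set T) (f : T -> T1) (g : T -> T2) : measurable D ->
  measurable_fun D f -> measurable_fun D g -> measurable_fun D (fun x => (f x, g x)).
Proof.
move=> mD.
have ext d' (T' : measurableType d') (u : T -> T') : measurable_fun D u ->
    measurable_fun [set: T] (fun x => if x \in D then u x else point).
  move=> mu _ B mB; rewrite setTI.
  rewrite (_ : _ @^-1` B = (D `&` u @^-1` B) `|` (~` D `&` [set _ | B point])).
    apply: measurableU; first exact: mu.
    apply: measurableI; first exact: measurableC.
    case: (pselect (B point)) => Bp.
      rewrite (_ : [set _ | _] = setT); first exact: measurableT.
      by apply/seteqP; split => x.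
    rewrite (_ : [set _ | _] = set0); first exact: measurable0.
    by apply/seteqP; split => x.
  apply/seteqP; split => x /=; case: ifPn; rewrite ?inE ?notin_setE => Dx Bx; [left|right| |] => //.
    by case: Bx => [[]//|[]].
  by case: Bx => [[]//|[]].
move=> /ext mf /ext mg.
have := measurable_funTS (D := D) (measurable_fun_pair mf mg).
by apply: eq_measurable_fun => x xD; rewrite xD.
Qed.

Section predictable_field.
Context {R : realType} d (Omega : measurableType d) (P : probability Omega R).
Hypothesis hP : measure_is_complete P.
Variables (T : R) (E : pmetricType R).
Hypothesis hT : (0 < T)%R.
Variables (m : {finite_measure set (borel E) -> \bar R}) (l : {measure set R -> \bar R}).
Local Notation mark := (R * borel E * R * R)%type.
Local Notation rest := (borel E * R * R)%type.
Variable N : Omega -> {measure set mark -> \bar R}.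
Hypothesis hN : poisson_random_measure P (marks T) (intensity m l) N.
Local Notation Fil := (filtration T P N).
Local Notation pT := (ptype T (@mark_time R E) (@mark_rest R E) Fil).
Variable V : R -> E -> Omega -> \bar R.
Hypothesis hV : predictable T P N V.
Hypothesis hV0 : forall t x w, (0 <= t <= T)%R -> 0 <= V t x w.

(* The marks that enter the equation have positive times; restricting to them discards
   the generators of the predictable sigma-algebra that live at time 0. *)
Let D0 : set (Omega * R * borel E) := [set a | (0 < a.1.2 <= T)%R].

Lemma predictable_pullback dQ (Q : measurableType dQ)
    (phi : Q -> Omega * R * borel E) : measurable (phi @^-1` D0) ->
  (forall s t A B, (0 <= s < t)%R -> (t <= T)%R -> Fil s A -> measurable B ->
    measurable (phi @^-1` (A `*` `]s, t]%classic `*` B))) ->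
  measurable_fun [set: Q]
    (fun q => if (0 < (phi q).1.2 <= T)%R then V (phi q).1.2 (phi q).2 (phi q).1.1 else 0).
Proof.
move=> mD mrect.
have pull F : predictable_sets T P N F -> measurable (phi @^-1` (F `&` D0)).
  apply: (smallest_sub (X := [set F | measurable (phi @^-1` (F `&` D0))])) => /=.
    split => /=.
    - by rewrite set0I preimage_set0.
    - move=> A mA; rewrite (_ : _ `&` D0 = D0 `\` (A `&` D0)).
        exact: (measurableD mD mA).
      apply/seteqP; split => a; rewrite /D0 /=.
        by move=> [[_ nA] a0]; split => // -[].
      move=> [/andP[a0 aT] nA]; split; last by rewrite a0.
      by split; [rewrite (ltW a0)|move=> Aa; apply: nA; split => //; rewrite a0].
    - move=> A mA; rewrite setI_bigcupl preimage_bigcup.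
      exact: bigcupT_measurable.
  move=> _ [[A [B [fA mB ->]]]|[s [t [A [B [[st tT] fA mB ->]]]]]] /=.
    rewrite (_ : _ `&` D0 = set0) ?preimage_set0 //.
    apply/seteqP; split => -[[w s] y] //; rewrite /D0 /= => -[[[_ ->] _]].
    by rewrite ltxx.
  rewrite setIidl; first exact: mrect.
  move=> [[w r] y]; rewrite /D0 /= => -[[_ +] _].
  rewrite in_itv /= => /andP[sr rt]; case/andP: st => s0 _.
  by rewrite (le_lt_trans s0 sr) (le_trans rt tT).
have -> : (fun q => if (0 < (phi q).1.2 <= T)%R
    then V (phi q).1.2 (phi q).2 (phi q).1.1 else 0) =
    (fun q => V (phi q).1.2 (phi q).2 (phi q).1.1) \_ (phi @^-1` D0).
  apply/funext => q; rewrite patchE; case: ifPn => [h|/negP h].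
    by rewrite ifT // inE.
  by rewrite ifF //; apply/negP; rewrite inE => /h.
apply/(measurable_restrictT _ mD) => _ C mC.
have := pull _ (hV mC).
congr measurable; apply/seteqP; split => q; rewrite /D0 /=.
  by move=> [[_ ?] ?]; split.
by move=> [/andP[q0 qT] ?]; split; [split => //; rewrite qT ltW|rewrite q0].
Qed.

Definition field_mark (z : Omega * mark) : \bar R :=
  if (0 < z.2.1.1.1 <= T)%R then V z.2.1.1.1 z.2.1.1.2 z.1 else 0.

Definition field_point (z : Omega * (R * borel E)) : \bar R :=
  if (0 < z.2.1 <= T)%R then V z.2.1 z.2.2 z.1 else 0.

Lemma field_point_ge0 z : 0 <= field_point z.
Proof. by rewrite /field_point; case: ifP => // /andP[/ltW ? ?]; apply: hV0; apply/andP. Qed.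

Lemma measurable_field_point : measurable_fun [set: Omega * (R * borel E)] field_point.
Proof.
apply: (@predictable_pullback _ (Omega * (R * borel E))%type
  (fun z => (z.1, z.2.1, z.2.2))).
  rewrite (_ : _ @^-1` _ = setT `*` (`]0%R, T]%classic `*` setT)).
    by apply: measurableX => //; apply: measurableX.
  apply/seteqP; split => -[w [s y]]; rewrite /D0 /= in_itv /=; last by move=> [_ []].
  by move=> h; split.
move=> s t A B /andP[s0 st] tT fA mB.
have sT : (0 <= s <= T)%R by rewrite s0 (le_trans (ltW st)).
rewrite (_ : _ @^-1` _ = A `*` (`]s, t]%classic `*` B)).
  apply: measurableX; last exact: measurableX.
  exact: (filtration_measurable hP hT hN sT).
by apply/seteqP; split => -[w [r y]] /=; [move=> [[? ?] ?]|move=> [? [? ?]]].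
Qed.

Lemma ptype_cyl s t A (B : set rest) : (0 <= s <= T)%R -> (0 <= t <= T)%R -> Fil s A ->
  measurable B ->
  measurable (A `*` cyl (@mark_time R E) (@mark_rest R E) s t B : set pT).
Proof.
by move=> sT tT fA mB; apply: sub_sigma_algebra; exists s, t, A, B; split.
Qed.

Let fil_setT s : Fil s [set: Omega].
Proof.
have [F0 FC _] := filtration_sigma_algebra P T N s.
by have := FC _ F0; rewrite setD0.
Qed.

Let T0T : (0 <= T <= T)%R. Proof. by rewrite lexx ltW. Qed.
Let T00 : (0 <= (0:R) <= T)%R. Proof. by rewrite lexx ltW. Qed.

Lemma measurable_field_mark : measurable_fun [set: pT] (field_mark : pT -> \bar R).
Proof.
apply: (@predictable_pullback _ pT (fun z => (z.1, z.2.1.1.1, z.2.1.1.2))).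
  rewrite (_ : _ @^-1` _ = setT `*` cyl (@mark_time R E) (@mark_rest R E) 0 T setT).
    exact: ptype_cyl.
  by apply/seteqP; split => -[w a]; rewrite /D0 /cyl /=; [|move=> [_ []]].
move=> s t A B /andP[s0 st] tT fA mB.
rewrite (_ : _ @^-1` _ = A `*` cyl (@mark_time R E) (@mark_rest R E) s t (B `*` setT `*` setT)).
  apply: ptype_cyl => //.
  - by rewrite s0 (le_trans (ltW st)).
  - by rewrite tT (le_trans s0 (ltW st)).
  - by apply: measurableX => //; exact: measurableX.
apply/seteqP; split => -[w a]; rewrite /cyl /= in_itv /=.
  by move=> [[? ?] ?].
by move=> [? [? [[? _] _]]].
Qed.

Let DT : set mark := cyl (@mark_time R E) (@mark_rest R E) 0 T setT.

Let mDT : measurable ([set: Omega] `*` DT : set pT).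
Proof. exact: ptype_cyl. Qed.

Lemma ptype_time_restrict : @measurable_fun _ _ pT R ([set: Omega] `*` DT) (fun z => z.2.1.1.1).
Proof.
apply: (measurability _ (RGenOInfty.measurableE R)) => _ [_ [x ->] <-].
rewrite (_ : _ `&` _ =
  setT `*` cyl (@mark_time R E) (@mark_rest R E) (Num.max 0%R (Num.min x T)) T setT).
  apply: ptype_cyl => //.
  by rewrite le_max lexx /= ge_max ltW //= ge_min lexx orbT.
apply/seteqP; split => -[w a]; rewrite /DT /cyl /mark_time /= in_itv /= gt_max gt_min.
  by move=> [[_ [/andP[-> ->] _]]]; rewrite andbT => ->.
move=> [_ [/andP[/andP[a0 aT'] aT] _]]; rewrite a0 aT andbT; split => //.
by case/orP: aT' => [->//|]; rewrite ltNge aT.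
Qed.

Let DB (B : set rest) : measurable B ->
  measurable ([set: Omega] `*` DT `&` (fun z : pT => mark_rest z.2) @^-1` B : set pT).
Proof.
move=> mB; rewrite (_ : _ `&` _ = setT `*` cyl (@mark_time R E) (@mark_rest R E) 0 T B).
  exact: ptype_cyl.
by apply/seteqP; split => -[w a]; rewrite /DT /cyl /=;
  [move=> [[_ [? _]] ?]|move=> [_ [? ?]]].
Qed.

Lemma ptype_mark_restrict :
  @measurable_fun _ _ pT mark ([set: Omega] `*` DT) (fun z => z.2).
Proof.
have my : @measurable_fun _ _ pT (borel E) ([set: Omega] `*` DT) (fun z => z.2.1.1.2).
  move=> _ B mB; have := @DB (B `*` setT `*` setT).
  move=> /(_ (measurableX (measurableX mB measurableT) measurableT)).
  by congr measurable; apply/seteqP; split => -[w a] /=; [move=> [? [[? _] _]]|move=> [? ?]].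
have mz : @measurable_fun _ _ pT R ([set: Omega] `*` DT) (fun z => z.2.1.2).
  move=> _ B mB; have := @DB (setT `*` B `*` setT).
  move=> /(_ (measurableX (measurableX measurableT mB) measurableT)).
  by congr measurable; apply/seteqP; split => -[w a] /=; [move=> [? [[_ ?] _]]|move=> [? ?]].
have mu : @measurable_fun _ _ pT R ([set: Omega] `*` DT) (fun z => z.2.2).
  move=> _ B mB; have := @DB (setT `*` setT `*` B).
  move=> /(_ (measurableX (measurableX measurableT measurableT) mB)).
  by congr measurable; apply/seteqP; split => -[w a] /=; [move=> [? [[_ _] ?]]|move=> [? ?]].
have pair := measurable_fun_pair_in mDT.
have := pair _ _ _ _ _ _ (pair _ _ _ _ _ _ (pair _ _ _ _ _ _ ptype_time_restrict my) mz) mu.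
by apply: eq_measurable_fun => -[w [[[s y] z] u]].
Qed.

Lemma measurable_ptype_mark (f : mark -> R) : measurable_fun [set: mark] f ->
  measurable_fun [set: pT] (fun z : pT => f z.2 * \1_DT z.2)%R.
Proof.
move=> mf.
have h : @measurable_fun _ _ pT R ([set: Omega] `*` DT) (fun z => f z.2).
  exact: (measurableT_comp mf ptype_mark_restrict).
rewrite (_ : (fun z : pT => _) = (fun z : pT => f z.2)%R \_ ([set: Omega] `*` DT)).
  exact: ((measurable_restrictT _ mDT).1 h).
apply/funext => -[w a]; rewrite patchE indicE /=.
have -> : ((w, a) \in [set: Omega] `*` DT) = (a \in DT).
  by apply/idP/idP; rewrite !inE //= => -[].
by case: ifP => _; rewrite ?mulr1 ?mulr0.
Qed.

End predictable_field.

Lemma integral_sigma_product d1 d2 (T1 : measurableType d1) (T2 : measurableType d2)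
    (R : realType) (m1 : {sigma_finite_measure set T1 -> \bar R})
    (m2 : {sigma_finite_measure set T2 -> \bar R}) (f : T1 * T2 -> \bar R) :
  measurable_fun [set: T1 * T2] f -> (forall z, 0 <= f z) ->
  \int[sigma_product m1 m2]_z f z = \int[m1]_x fubini_F m2 f x.
Proof. exact: fubini_tonelli1. Qed.

Section compensator_bound.
Context {R : realType} (T : R) (E : pmetricType R) (hT : (0 < T)%R).
Variables (m : {finite_measure set (borel E) -> \bar R}) (l : {measure set R -> \bar R}).
Local Notation mark := (R * borel E * R * R)%type.
Variables (Z : set R) (c : R).
Hypotheses (mZ : measurable Z) (lZ : l Z < +oo) (c0 : (0 <= c)%R).
Let U : set R := `[0%R, c]%classic.
Hypothesis mU : measurable U.
Hypothesis lU : lebR R U < +oo.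

Lemma measurable_thinning (L : R * borel E -> \bar R) :
  measurable_fun [set: R * borel E] L ->
  measurable_fun [set: mark] (fun a => (a.2%:E <= L a.1.1)%E%:R : R)%R.
Proof.
move=> mL.
rewrite (_ : (fun a : mark => _) = \1_[set a : mark | a.2%:E <= L a.1.1]).
  apply: measurable_indic; rewrite -[X in measurable X]setTI.
  apply: measurable_lee => //.
    by apply/measurable_EFinP; exact: measurable_snd.
  apply: (measurableT_comp mL); apply: (measurableT_comp measurable_fst).
  exact: measurable_fst.
by apply/funext => a; rewrite indicE; congr (nat_of_bool _)%:R; apply/idP/idP; rewrite inE.
Qed.

Lemma region_integral_le (g : R * borel E -> R) (h : R -> R) (L : R * borel E -> \bar R)
    (zb : R) :
  measurable_fun [set: R * borel E] g -> measurable_fun [set: R] h ->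
  measurable_fun [set: R * borel E] L ->
  (forall q, 0 <= g q)%R -> (forall z, 0 <= h z)%R -> (forall q, 0 <= L q) ->
  (0 <= zb)%R -> \int[jump_size mZ lZ]_z (h z)%:E <= zb%:E ->
  \int[region_intensity hT m mZ mU lZ lU]_a
    (g a.1.1 * h a.1.2 * (a.2%:E <= L a.1.1)%E%:R)%:E <=
  zb%:E * \int[time_space hT m]_q (g q * fine (mine (L q) c%:E))%:E.
Proof.
move=> mg mh mL g0 h0 L0 zb0 hzb.
pose f (a : mark) : \bar R := (g a.1.1 * h a.1.2 * (a.2%:E <= L a.1.1)%E%:R)%:E.
have f0 a : 0 <= f a by rewrite lee_fin !mulr_ge0.
have m11 : measurable_fun [set: mark] (fun a : mark => a.1.1).
  by apply: (measurableT_comp measurable_fst); exact: measurable_fst.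
have m12 : measurable_fun [set: mark] (fun a : mark => a.1.2).
  by apply: (measurableT_comp measurable_snd); exact: measurable_fst.
have mf : measurable_fun [set: mark] f.
  apply/measurable_EFinP; apply: measurable_funM; last exact: measurable_thinning.
  by apply: measurable_funM; [exact: (measurableT_comp mg m11)|exact: (measurableT_comp mh m12)].
pose u q := fine (mine (L q) c%:E).
have u0 q : (0 <= u q)%R by rewrite fine_ge0 // le_min L0 lee_fin.
have mu : measurable_fun [set: R * borel E] u.
  by apply: measurableT_comp => //; apply: measurable_mine => //.
have mf1 : measurable_fun [set: R * borel E * R] (fubini_F (level mU lU) f).
  exact: measurable_fun_fubini_tonelli_F.
have inner b : fubini_F (level mU lU) f b <= (g b.1 * h b.2 * u b.1)%:E.
  rewrite /fubini_F /f /=.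
  under eq_integral do rewrite EFinM.
  have mi : measurable_fun [set: R] (fun y => ((y%:E <= L b.1)%E%:R : R)%:E).
    apply/measurable_EFinP.
    exact: (measurable_fun_pair2 (b.1, b.2) (measurable_thinning mL)).
  rewrite ge0_integralZl_EFin // ?mulr_ge0 //.
  rewrite [X in _ <= X]EFinM; apply: lee_wpmul2l; first by rewrite lee_fin mulr_ge0.
  pose S : set R := [set y | (y%:E <= L b.1)%E].
  have mS : measurable S.
    by rewrite -[S]setTI; apply: measurable_lee => //.
  rewrite (_ : \int[_]_y _ = level mU lU S); last first.
    rewrite -[S]setIT -integral_indic //; apply: eq_integral => y _.
    by rewrite indicE; congr (nat_of_bool _)%:R%:E; apply/idP/idP; rewrite inE.
  change (lebR R (S `&` U) <= (u b.1)%:E).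
  apply: (@le_trans _ _ (lebR R `[0%R, u b.1]%classic)).
    apply: le_measure; rewrite ?inE //; first exact: measurableI.
    move=> y; rewrite /S /U /= !in_itv /= => -[yL /andP[-> yc]] /=.
    rewrite -lee_fin fineK; first by rewrite le_min yL lee_fin.
    rewrite ge0_fin_numE ?le_min ?L0 ?lee_fin //.
    by rewrite gt_min ltry orbT.
  rewrite [lebR R _]lebesgue_measure_itv /= lte_fin; case: ifP => _.
    by rewrite sube0.
  by rewrite lee_fin.
have mid q : fubini_F (jump_size mZ lZ) (fubini_F (level mU lU) f) q <=
    zb%:E * (g q * u q)%:E.
  rewrite [X in X <= _]/fubini_F.
  apply: (@le_trans _ _ (\int[jump_size mZ lZ]_z ((g q * u q)%:E * (h z)%:E))).
    apply: ge0_le_integral => //.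
    - by move=> z _; exact: integral_ge0.
    - exact: (measurable_fun_pair2 q mf1).
    - by apply: measurable_funeM; exact/measurable_EFinP.
    - by move=> z _; apply: (le_trans (inner _)); rewrite -EFinM lee_fin /= mulrAC.
  rewrite ge0_integralZl_EFin ?mulr_ge0 //; [|by move=> z _; rewrite lee_fin|exact/measurable_EFinP].
  by rewrite muleC; apply: lee_wpmul2r => //; rewrite lee_fin mulr_ge0.
have f10 b : 0 <= fubini_F (level mU lU) f b by exact: integral_ge0.
rewrite /region_intensity (integral_sigma_product _ _ mf f0).
rewrite (integral_sigma_product _ _ mf1 f10).
have gu0 q : [set: R * borel E] q -> 0 <= (g q * u q)%:E by rewrite lee_fin mulr_ge0.
have mgu : measurable_fun [set: R * borel E] (fun q => (g q * u q)%:E).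
  by apply/measurable_EFinP; exact: measurable_funM.
rewrite -(ge0_integralZl_EFin _ _ gu0 mgu zb0) //.
apply: ge0_le_integral => //.
- by move=> q _; do 2 (apply: integral_ge0 => ? _).
- apply: measurable_fun_fubini_tonelli_F => // b; exact: integral_ge0.
- exact: measurable_funeM.
Qed.

End compensator_bound.

(** * Thinned sums *)

Lemma limn_einf_ge (R : realType) (u : nat -> \bar R) (c : \bar R) :
  (\forall n \near \oo, c <= u n) -> c <= limn_einf u.
Proof.
move=> [n0 _ cu]; rewrite limn_einf_lim.
apply: lime_ge; first exact: is_cvg_einfs.
exists n0 => // n /= nn; apply: le_ereal_inf_tmp => _ [k /= nk <-].
by apply: cu; exact: leq_trans nk.
Qed.

Lemma limn_einf_le (R : realType) (u : nat -> \bar R) (c : \bar R) :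
  (forall n, u n <= c) -> limn_einf u <= c.
Proof.
move=> uc; rewrite limn_einf_lim.
apply: lime_le; first exact: is_cvg_einfs.
apply: nearW => n; apply: le_trans (uc n); apply: ereal_inf_lbound.
by exists n => /=.
Qed.

Section thinned_sums.
Context {R : realType} d (Omega : measurableType d) (P : probability Omega R).
Hypothesis hP : measure_is_complete P.
Variables (T : R) (E : pmetricType R).
Hypothesis hT : (0 < T)%R.
Variables (m : {finite_measure set (borel E) -> \bar R}) (l : {measure set R -> \bar R}).
Local Notation mark := (R * borel E * R * R)%type.
Local Notation rest := (borel E * R * R)%type.
Variable N : Omega -> {measure set mark -> \bar R}.
Hypothesis hN : poisson_random_measure P (marks T) (intensity m l) N.
Local Notation Fil := (filtration T P N).
Local Notation pT := (ptype T (@mark_time R E) (@mark_rest R E) Fil).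
Variable V : R -> E -> Omega -> \bar R.
Hypothesis hV : predictable T P N V.
Hypothesis hV0 : forall t x w, (0 <= t <= T)%R -> 0 <= V t x w.
Variables (lambda0 lambda1 p : R).
Hypotheses (hlambda0 : (0 <= lambda0)%R) (hlambda1 : (0 <= lambda1)%R) (hp : (1 <= p)%R).
Hypothesis hl1 : \int[l]_(z in `]0%R, +oo[) z%:E < +oo.
Hypothesis hlp : \int[l]_(z in `]0%R, +oo[) (z `^ p)%:E < +oo.

Definition size_range (n : nat) : set R := `](n.+1%:R^-1)%R, n%:R%R]%classic.
Definition level_range (n : nat) : set R := `[0%R, n%:R%R]%classic.

Let mZ n : measurable (size_range n). Proof. exact: measurable_itv. Qed.
Let mU n : measurable (level_range n). Proof. exact: measurable_itv. Qed.
Let Z0 n z : size_range n z -> (0 < z)%R.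
Proof.
by rewrite /size_range /= in_itv /= => /andP[h _]; apply: le_lt_trans h; rewrite invr_ge0.
Qed.
Let Z0' n z : size_range n z -> (0 <= z)%R. Proof. by move=> /Z0/ltW. Qed.
Let U0 n u : level_range n u -> (0 <= u)%R.
Proof. by rewrite /level_range /= in_itv /= => /andP[]. Qed.
Let Zsub n : size_range n `<=` `]0%R, +oo[%classic.
Proof. by move=> z /Z0 z0; rewrite /= in_itv /= z0. Qed.

Let lU n : lebR R (level_range n) < +oo.
Proof.
rewrite [lebR R _]lebesgue_measure_itv /=; case: ifP => _; last exact: ltry.
by rewrite -EFinB ltry.
Qed.

Let mid (D : set R) : measurable_fun D (fun z : R => z%:E).
Proof. by apply: EFin_measurable. Qed.

Let lZ n : l (size_range n) < +oo.
Proof.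
have n0 : (0 < n.+1%:R^-1 :> R)%R by rewrite invr_gt0.
suff : (n.+1%:R^-1)%:E * l (size_range n) < +oo.
  rewrite [l _ < _]ltey; apply: contraTneq => ->.
  by rewrite gt0_muley ?lte_fin // ltxx.
apply: le_lt_trans hl1; rewrite -integral_cst //.
apply: (@le_trans _ _ (\int[l]_(z in size_range n) z%:E)).
  apply: ge0_le_integral => //.
  - by move=> z _; rewrite lee_fin ltW.
  - by move=> z; rewrite /size_range /= in_itv /= lee_fin => /andP[/ltW].
by apply: ge0_subset_integral => // z; rewrite /= in_itv /= andbT lee_fin => /ltW.
Qed.

Local Notation NR n := (region_measure T N (mZ n) (mU n)).
Local Notation nuR n := (region_intensity hT m (mZ n) (mU n) (lZ n) (lU n)).
Local Notation ts := (time_space hT m).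

Definition thin_level (q : Omega * (R * borel E)) : \bar R :=
  lambda0%:E + lambda1%:E * field_point T V q.

Definition cut_level n (q : Omega * (R * borel E)) : R :=
  fine (mine (thin_level q) n%:R%:E).

Lemma thin_level_ge0 q : 0 <= thin_level q.
Proof.
by apply: adde_ge0; [rewrite lee_fin|apply: mule_ge0; rewrite ?lee_fin //; exact: field_point_ge0].
Qed.

Lemma measurable_thin_level : measurable_fun [set: Omega * (R * borel E)] thin_level.
Proof.
apply: emeasurable_funD; first exact: measurable_cst.
by apply: measurable_funeM; exact: (measurable_field_point hP hT hN).
Qed.

Lemma cut_level_ge0 n q : (0 <= cut_level n q)%R.
Proof. by rewrite fine_ge0 // le_min thin_level_ge0 lee_fin ler0n. Qed.

Lemma cut_level_le n q : (cut_level n q)%:E <= thin_level q.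
Proof.
rewrite /cut_level fineK; first by rewrite ge_min lexx.
by rewrite ge0_fin_numE ?le_min ?thin_level_ge0 ?lee_fin ?ler0n // gt_min ltry orbT.
Qed.

Lemma cut_level_le_cst n q : (cut_level n q <= n%:R)%R.
Proof.
rewrite -lee_fin /cut_level fineK; first by rewrite ge_min lexx orbT.
by rewrite ge0_fin_numE ?le_min ?thin_level_ge0 ?lee_fin ?ler0n // gt_min ltry orbT.
Qed.

Lemma measurable_cut_level n : measurable_fun [set: Omega * (R * borel E)] (cut_level n).
Proof.
apply: measurableT_comp => //; apply: measurable_mine => //.
exact: measurable_thin_level.
Qed.

Let DT : set mark := cyl (@mark_time R E) (@mark_rest R E) 0 T setT.

Definition jump_mean : R := fine (\int[l]_(z in `]0%R, +oo[) z%:E).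
Definition jump_moment : R := fine (\int[l]_(z in `]0%R, +oo[) (z `^ p)%:E).
Definition burkholder_cst : R := (2 `^ p * 2 `^ (p - 1))%R.
Definition drift_cst (th : R) : R :=
  (2 * (burkholder_cst * (2 * burkholder_cst) `^ (p - 1)) *
   (Num.max 1 jump_mean `^ p * (2 * (2 * th) `^ (p - 1))))%R.
Definition jump_cst : R := (2 * burkholder_cst * 2 `^ p * jump_moment)%R.

Lemma time_space_exchange (g : R * borel E -> R) (f : Omega * (R * borel E) -> R) :
  measurable_fun [set: R * borel E] g -> (forall q, 0 <= g q)%R ->
  measurable_fun [set: Omega * (R * borel E)] f -> (forall z, 0 <= f z)%R ->
  \int[P]_w \int[ts]_q (g q * f (w, q))%:E = \int[ts]_q ((g q)%:E * \int[P]_w (f (w, q))%:E).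
Proof.
move=> mg g0 mf f0.
pose F (z : Omega * (R * borel E)) : \bar R := (g z.2 * f z)%:E.
have mF : measurable_fun [set: Omega * (R * borel E)] F.
  apply/measurable_EFinP; apply: measurable_funM => //.
  exact: (measurableT_comp mg measurable_snd).
have F0 z : 0 <= F z by rewrite lee_fin mulr_ge0.
apply: (etrans (@fubini_tonelli _ _ Omega (R * borel E)%type R P ts F mF F0)).
apply: eq_integral => q _; rewrite /F /=.
under eq_integral do rewrite EFinM.
rewrite ge0_integralZl_EFin //; first by move=> w _; rewrite lee_fin.
by apply/measurable_EFinP; exact: (measurable_fun_pair1 q mf).
Qed.

Section kernel.
Variable G : R * borel E -> R.
Hypotheses (mG : measurable_fun [set: R * borel E] G) (G0 : forall q, (0 <= G q)%R).

(* [thin_mark] truncated to a region of finite intensity and to a bounded kernel; the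
   factor [\1_DT] makes it predictable on the whole product space. *)
Definition cut_mark n (z : Omega * mark) : R :=
  (Num.min (G z.2.1.1) n%:R * (z.2.1.2 * \1_(size_range n) z.2.1.2) *
   (z.2.2%:E <= thin_level (z.1, z.2.1.1))%E%:R * \1_DT z.2)%R.

Definition cut_sum n (w : Omega) : \bar R := \int[NR n w]_a (cut_mark n (w, a))%:E.

Definition live : set mark := [set a | [/\ (0 < a.1.1.1 <= T)%R, (0 <= a.1.2)%R & (0 <= a.2)%R]].

Definition thin_mark (z : Omega * mark) : R :=
  (G z.2.1.1 * z.2.1.2 * (z.2.2%:E <= thin_level (z.1, z.2.1.1))%E%:R)%R.

Definition thin_sum (w : Omega) : \bar R := \int[N w]_(a in live) (thin_mark (w, a))%:E.

(* A version of [thin_sum] that is measurable without any completeness argument. *)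
Definition lim_sum (w : Omega) : \bar R := limn_esup (cut_sum ^~ w).

Let size_ind_ge0 n z : (0 <= z * \1_(size_range n) z :> R)%R.
Proof.
rewrite indicE; case: (boolP (z \in _)); last by rewrite mulr0.
by rewrite inE mulr1 => /Z0/ltW.
Qed.

Let size_ind_le n z : (z * \1_(size_range n) z <= n%:R :> R)%R.
Proof.
rewrite indicE; case: (boolP (z \in _)); last by rewrite mulr0.
by rewrite inE mulr1 /size_range /= in_itv /= => /andP[].
Qed.

Lemma cut_mark_ge0 n z : (0 <= cut_mark n z)%R.
Proof.
apply: mulr_ge0; last by rewrite indicE.
apply: mulr_ge0 => //; apply: mulr_ge0 => //.
by rewrite le_min G0 ler0n.
Qed.

Lemma cut_mark_le n z : (cut_mark n z <= n%:R * n%:R)%R.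
Proof.
rewrite /cut_mark -mulrA.
apply: (@le_trans _ _ (Num.min (G z.2.1.1) n%:R * (z.2.1.2 * \1_(size_range n) z.2.1.2))%R).
  apply: ler_piMr; first by rewrite mulr_ge0 // le_min G0 ler0n.
  by rewrite indicE; case: (_ <= _)%E; case: (_ \in _); rewrite ?mulr1 ?mulr0 ?mul0r.
by apply: ler_pM => //; [rewrite le_min G0 ler0n|rewrite ge_min lexx orbT].
Qed.

Let m11 : measurable_fun [set: mark] (fun a : mark => a.1.1).
Proof. by apply: (measurableT_comp measurable_fst); exact: measurable_fst. Qed.

Let m12 : measurable_fun [set: mark] (fun a : mark => a.1.2).
Proof. by apply: (measurableT_comp measurable_snd); exact: measurable_fst. Qed.

Let m2 : measurable_fun [set: mark] (fun a : mark => a.2).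
Proof. exact: measurable_snd. Qed.

Let msize n : measurable_fun [set: R] (fun z : R => z * \1_(size_range n) z)%R.
Proof. by apply: measurable_funM => //; exact: measurable_indic. Qed.

Lemma measurable_cut_mark n : measurable_fun [set: pT] (cut_mark n : pT -> R).
Proof.
pose f (a : mark) := (Num.min (G a.1.1) n%:R * (a.1.2 * \1_(size_range n) a.1.2))%R.
have mf : measurable_fun [set: mark] f.
  apply: measurable_funM; last exact: (measurableT_comp (msize n) m12).
  by apply: measurable_minr => //; exact: (measurableT_comp mG m11).
pose S : set pT := [set z : pT | ((z.2.2 * \1_DT z.2)%R%:E <=
  lambda0%:E + lambda1%:E * field_mark T V z)%E].
have mS : measurable S.
  rewrite -[S]setTI; apply: measurable_lee => //.
    by apply/measurable_EFinP; exact: (@measurable_ptype_mark _ _ _ P _ _ hT N _ m2).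
  apply: emeasurable_funD; first exact: measurable_cst.
  by apply: measurable_funeM; exact: (measurable_field_mark hT hV).
rewrite (_ : cut_mark n = (fun z : pT => f z.2 * \1_DT z.2 * \1_S z)%R :> (pT -> R)).
  apply: measurable_funM; last exact: measurable_indic.
  exact: (@measurable_ptype_mark _ _ _ P _ _ hT N _ mf).
apply/funext => z; rewrite /cut_mark -/(f z.2) mulrAC.
rewrite !indicE; case: (boolP (z.2 \in DT)) => zD; last by rewrite !mulr0 !mul0r.
congr (_ * (nat_of_bool _)%:R)%R; apply/idP/idP; rewrite inE /S /= indicE zD mulr1 //.
Qed.

Let CP n := region_compensated hP hT hN (mZ n) (mU n) (@Z0' n) (@U0 n) (lZ n) (lU n).

Let mcutE n : measurable_fun [set: pT] ((fun z => (cut_mark n z)%:E) : pT -> \bar R).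
Proof. by apply/measurable_EFinP; exact: measurable_cut_mark. Qed.

Let cutE0 n (z : pT) : 0 <= (cut_mark n z)%:E.
Proof. by rewrite lee_fin cut_mark_ge0. Qed.

Let mcut n w : measurable_fun [set: mark] (fun a => (cut_mark n (w, a))%:E).
Proof. by have [h _ _ _] := predictable_compensation (CP n) (mcutE n) (cutE0 n); exact: h. Qed.

Lemma measurable_cut_sum n : measurable_fun [set: Omega] (cut_sum n).
Proof. exact: (measurable_point_integral (CP n) (mcutE n) (cutE0 n)). Qed.

Lemma measurable_lim_sum : measurable_fun [set: Omega] lim_sum.
Proof. by apply: measurable_fun_limn_esup => n; exact: measurable_cut_sum. Qed.

Lemma measurable_live : measurable live.
Proof.
rewrite (_ : live = `]0%R, T]%classic `*` [set: borel E] `*` `[0%R, +oo[%classic `*` `[0%R, +oo[%classic).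
  by do 3 (apply: measurableX => //).
apply/seteqP; split => -[[[s y] z] u]; rewrite /live /= !in_itv /= !andbT.
  by move=> [? ? ?].
by move=> [[[? _] ?] ?].
Qed.

Lemma cut_sum_cvg : {ae P, forall w, cut_sum ^~ w @ \oo --> thin_sum w}.
Proof.
have ae n := region_finite_ae hT hN (mZ n) (mU n) (@Z0' n) (@U0 n) (lZ n) (lU n).
apply: filterS (ae_foralln ae) => w hw.
pose reg n := region T (E := E) (size_range n) (level_range n).
have mreg n : measurable (reg n) by exact: measurable_region.
have reg_live n : reg n `<=` live.
  move=> [[[s y] z] u] [[[/= ti _] Zz] Uu]; split => //=; last exact: U0 Uu.
  exact: Z0' Zz.
have -> : cut_sum ^~ w = (fun n => \int[N w]_(a in live) (cut_mark n (w, a) * \1_(reg n) a)%:E).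
  apply/funext => n; rewrite /cut_sum /region_measure hw.
  rewrite ge0_integral_mrestr //.
  rewrite integral_mkcond [RHS]integral_mkcond; apply: eq_integral => a _.
  rewrite !patchE indicE -/(reg n); case: ifPn => [ra|_].
    by rewrite mulr1 ifT //; rewrite !inE in ra *; exact: reg_live ra.
  by rewrite mulr0; case: ifP.
apply: cvg_monotone_integral.
- exact: measurable_live.
- move=> n; apply: measurable_funTS; under eq_fun do rewrite EFinM.
  apply: emeasurable_funM; first exact: mcut.
  by apply/measurable_EFinP; exact: measurable_indic.
- by move=> n a _; rewrite lee_fin mulr_ge0 // ?cut_mark_ge0 // indicE.
- move=> [[[s y] z] u] [_ /= z0 u0] n k nk.
  have nkR : (n%:R <= k%:R :> R)%R by rewrite ler_nat.
  have Zz : (\1_(size_range n) z <= \1_(size_range k) z :> R)%R.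
    rewrite !indicE; case: (boolP (z \in size_range n)) => [|_]; last exact: ler0n.
    rewrite inE /size_range /= in_itv /= => /andP[nz zn].
    rewrite mem_set //= in_itv /= (le_trans zn nkR) andbT.
    by apply: le_lt_trans nz; rewrite lef_pV2 ?posrE // ler_nat.
  have Rr : (\1_(reg n) (s, y, z, u) <= \1_(reg k) (s, y, z, u) :> R)%R.
    rewrite !indicE; case: (boolP (_ \in reg n)) => [|_]; last exact: ler0n.
    rewrite inE => -[[[/= sT _] zn] un].
    rewrite mem_set //; split; [split; [by split|]|]; rewrite /=.
      move: Zz; rewrite !indicE mem_set //.
      by case: (boolP (z \in size_range k)) => [/set_mem //|_]; rewrite ler10.
    move: un; rewrite /level_range /= !in_itv /= => /andP[-> un].
    exact: le_trans un nkR.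
  rewrite lee_fin; apply: ler_pM; rewrite ?cut_mark_ge0 ?indicE ?ler0n // -?indicE //.
  rewrite /cut_mark /= ler_wpM2r ?indicE // ler_wpM2r //.
  apply: ler_pM; rewrite ?size_ind_ge0 ?le_min ?G0 ?ler0n //.
    by rewrite ge_min lexx /= ge_min nkR orbT.
  by rewrite ler_wpM2l.
- move=> [[[s y] z] u] [/= sT z0 u0].
  have [->|zn0] := eqVneq z 0%R.
    rewrite /thin_mark /= mulr0 mul0r.
    rewrite (_ : (fun _ => _) = fun=> 0); first exact: cvg_cst.
    by apply/funext => n; rewrite /cut_mark /= mul0r mulr0 !mul0r.
  have zp : (0 < z)%R by rewrite lt_neqAle eq_sym zn0.
  set b := (G (s, y) + z + u + z^-1)%R.
  have zV : (0 < z^-1)%R by rewrite invr_gt0.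
  have b0 : (0 <= b)%R by rewrite !addr_ge0 // ltW.
  apply: cvg_near_cst; exists (Num.bound b) => // n /= nb.
  have bn : (b < n%:R)%R by apply: (lt_le_trans (archi_boundP b0)); rewrite ler_nat.
  have Gn : (G (s, y) <= n%:R)%R by have := G0 (s, y); rewrite /b in bn; lra.
  have zn : (z <= n%:R)%R by have := G0 (s, y); rewrite /b in bn; lra.
  have un : (u <= n%:R)%R by have := G0 (s, y); rewrite /b in bn; lra.
  have nz : (n.+1%:R^-1 < z)%R.
    rewrite -[z]invrK ltf_pV2 ?posrE //.
    by have := G0 (s, y); rewrite -natr1; rewrite /b in bn; lra.
  have Zz : z \in size_range n by rewrite inE /size_range /= in_itv /= nz.
  have rm : (s, y, z, u) \in reg n.
    rewrite inE; split; last by rewrite /level_range /= in_itv /= u0.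
    by split; [split => //; rewrite /= in_itv|exact: set_mem Zz].
  have dm : (s, y, z, u) \in DT by rewrite inE.
  by rewrite /cut_mark /thin_mark /= min_l // !indicE Zz rm dm !mulr1.
Qed.

Lemma lim_sum_ae : {ae P, forall w, lim_sum w = thin_sum w}.
Proof.
apply: filterS cut_sum_cvg => w cw; rewrite /lim_sum.
by have [_ ->] := cvg_limn_einf_sup cw.
Qed.

Lemma cut_compensator_le n w b zb : (0 < b)%R -> (0 <= zb)%R ->
  \int[l]_(z in `]0%R, +oo[) (z `^ b)%:E <= zb%:E ->
  \int[nuR n]_a ((cut_mark n (w, a)) `^ b)%:E <=
  zb%:E * \int[ts]_q (G q `^ b * cut_level n (w, q))%:E.
Proof.
move=> b0 zb0 hzb.
pose h z := ((z * \1_(size_range n) z) `^ b : R)%R.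
pose L q := thin_level (w, q).
have mL : measurable_fun [set: R * borel E] L.
  exact: (measurable_fun_pair2 w measurable_thin_level).
have mh : measurable_fun [set: R] h.
  exact: (measurableT_comp (measurable_powR b) (msize n)).
have mGb : measurable_fun [set: R * borel E] (fun q => G q `^ b)%R.
  exact: (measurableT_comp (measurable_powR b) mG).
apply: (@le_trans _ _ (\int[nuR n]_a
    (G a.1.1 `^ b * h a.1.2 * (a.2%:E <= L a.1.1)%E%:R)%:E)).
  apply: ge0_le_integral => //.
  - by move=> a _; rewrite lee_fin powR_ge0.
  - apply/measurable_EFinP; apply: (measurableT_comp (measurable_powR b)).
    by have /measurable_EFinP := mcut n w.
  - apply/measurable_EFinP; apply: measurable_funM; last exact: measurable_thinning.
    apply: measurable_funM; first exact: (measurableT_comp mGb m11).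
    exact: (measurableT_comp mh m12).
  - move=> a _; rewrite lee_fin.
    rewrite (_ : _%:R = (a.2%:E <= L a.1.1)%E%:R `^ b)%R; last first.
      by case: (_ <= _)%E; rewrite ?powR1 // powR0 // gt_eqF.
    have s0 := size_ind_ge0 n a.1.2.
    have Gs0 : (0 <= G a.1.1 * (a.1.2 * \1_(size_range n) a.1.2))%R by exact: mulr_ge0.
    rewrite /h -(powRM _ (G0 _) s0) -powRM //.
    apply: ge0_ler_powR; rewrite ?nnegrE ?cut_mark_ge0 //; [exact: ltW|exact: mulr_ge0|].
    apply: (@le_trans _ _ (Num.min (G a.1.1) n%:R *
      (a.1.2 * \1_(size_range n) a.1.2) * (a.2%:E <= L a.1.1)%E%:R)%R).
      apply: ler_piMr; last by rewrite indicE; case: (_ \in _).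
      by apply: mulr_ge0 => //; apply: mulr_ge0 => //; rewrite le_min G0 ler0n.
    by rewrite ler_wpM2r // ler_wpM2r // ge_min lexx.
apply: region_integral_le => //.
- by move=> q; exact: powR_ge0.
- by move=> z; exact: powR_ge0.
- by move=> q; exact: thin_level_ge0.
apply: le_trans hzb.
have mh' : measurable_fun [set: R] (fun z => (h z)%:E) by exact/measurable_EFinP.
rewrite (_ : \int[jump_size (mZ n) (lZ n)]_z (h z)%:E = \int[l]_(z in size_range n) (h z)%:E); last first.
  by apply: ge0_integral_mrestr => // z; rewrite lee_fin powR_ge0.
rewrite (_ : \int[l]_(z in size_range n) (h z)%:E = \int[l]_(z in size_range n) (z `^ b)%:E); last first.
  by apply: eq_integral => z Zz; rewrite /h indicE Zz mulr1.
apply: ge0_subset_integral => //.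
- by apply/measurable_EFinP; apply: measurable_funTS; exact: measurable_powR.
- by move=> z _; rewrite lee_fin powR_ge0.
Qed.

Let jump_mean_ge0 : (0 <= jump_mean)%R.
Proof.
rewrite fine_ge0 //; apply: integral_ge0 => z; rewrite /= in_itv /= andbT lee_fin.
exact: ltW.
Qed.

Let jump_moment_ge0 : (0 <= jump_moment)%R.
Proof. by rewrite fine_ge0 //; apply: integral_ge0 => z _; rewrite lee_fin powR_ge0. Qed.

Let jump_meanE : \int[l]_(z in `]0%R, +oo[) (z `^ 1)%:E <= jump_mean%:E.
Proof.
rewrite (_ : \int[l]_(z in _) _ = \int[l]_(z in `]0%R, +oo[) z%:E); last first.
  apply: eq_integral => z; rewrite inE /= in_itv /= andbT => /ltW z0.
  by rewrite powRr1.
rewrite /jump_mean fineK // ge0_fin_numE //.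
by apply: integral_ge0 => z; rewrite /= in_itv /= andbT lee_fin; exact: ltW.
Qed.

Let jump_momentE : \int[l]_(z in `]0%R, +oo[) (z `^ p)%:E <= jump_moment%:E.
Proof.
rewrite /jump_moment fineK // ge0_fin_numE //.
by apply: integral_ge0 => z _; rewrite lee_fin powR_ge0.
Qed.

Lemma compensator_tpsi_le n M th w : (0 < M)%R -> (1 <= th)%R ->
  \int[ts]_q (G q)%:E <= th%:E ->
  (tpsi p M (fine (\int[nuR n]_a (cut_mark n (w, a))%:E)))%:E <=
  (Num.max 1 jump_mean `^ p * (2 * (2 * th) `^ (p - 1)))%:E *
  \int[ts]_q (G q * tpsi p M (cut_level n (w, q)))%:E.
Proof.
move=> M0 th1 Gth.
have th0 : (0 < th)%R by lra.
have mU' : measurable_fun [set: R * borel E] (fun q => cut_level n (w, q)).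
  exact: (measurable_fun_pair2 w (measurable_cut_level n)).
set I := \int[ts]_q (G q * cut_level n (w, q))%:E.
have I0 : 0 <= I by apply: integral_ge0 => q _; rewrite lee_fin mulr_ge0 // cut_level_ge0.
have Ioo : I \is a fin_num.
  rewrite ge0_fin_numE //.
  apply: (@le_lt_trans _ _ (\int[ts]_q (n%:R%:E * (G q)%:E))).
    apply: ge0_le_integral => //.
    - by move=> q _; rewrite lee_fin mulr_ge0 // cut_level_ge0.
    - by apply/measurable_EFinP; exact: measurable_funM.
    - by apply: measurable_funeM; exact/measurable_EFinP.
    - by move=> q _; rewrite -EFinM lee_fin mulrC ler_wpM2r // cut_level_le_cst.
  rewrite ge0_integralZl_EFin //; [|by move=> q _; rewrite lee_fin|exact/measurable_EFinP].
  apply: (@le_lt_trans _ _ (n%:R%:E * th%:E)); last by rewrite -EFinM ltry.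
  by apply: lee_wpmul2l; rewrite ?lee_fin ?ler0n.
pose a := fine I.
have a0 : (0 <= a)%R by rewrite fine_ge0.
have Ia : I = a%:E by rewrite fineK.
set cz := Num.max 1%R jump_mean.
have cz1 : (1 <= cz)%R by rewrite le_max lexx.
have cz0 : (0 <= cz)%R by lra.
set X := \int[nuR n]_a (cut_mark n (w, a))%:E.
have X0 : 0 <= X by apply: integral_ge0 => b _; rewrite lee_fin cut_mark_ge0.
have Xa : X <= (cz * a)%:E.
  have := @cut_compensator_le n w 1%R jump_mean ltr01 jump_mean_ge0 jump_meanE.
  rewrite (_ : \int[nuR n]_b _ = X); last first.
    by apply: eq_integral => b _; rewrite powRr1 // cut_mark_ge0.
  rewrite (_ : \int[ts]_q _ = I); last first.
    by apply: eq_integral => q _; rewrite powRr1.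
  move=> /le_trans; apply; rewrite Ia -EFinM lee_fin ler_wpM2r //.
  by rewrite le_max lexx orbT.
have Xf : X \is a fin_num by rewrite ge0_fin_numE // (le_lt_trans Xa) // ltry.
have Xa' : (fine X <= cz * a)%R by rewrite -lee_fin fineK.
have jensen := weighted_tpow_jensen measurableT hp M0 th0 mG mU' G0
  (fun q => cut_level_ge0 n (w, q)) Gth Ia.
apply: (@le_trans _ _ ((cz `^ p * (2 * (2 * th) `^ (p - 1)))%:E *
    (2^-1 * a * tpow p M (a / (2 * th)))%:E)); last first.
  by apply: lee_wpmul2l; rewrite ?lee_fin ?mulr_ge0 ?powR_ge0.
rewrite -EFinM lee_fin.
apply: (le_trans (tpsi_mono hp M0 _ Xa')); first by rewrite fine_ge0.
apply: (le_trans (tpsi_scale hp M0 cz1 a0)); rewrite -!mulrA ler_wpM2l ?powR_ge0 //.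
rewrite /tpsi.
have a1 : (0 <= a / (2 * th))%R by rewrite divr_ge0 // mulr_ge0 // ltW.
have -> : (2 * ((2 * th) `^ (p - 1) * (2^-1 * (a * tpow p M (a / (2 * th))))))%R =
    (a * ((2 * th) `^ (p - 1) * tpow p M (a / (2 * th))))%R by field.
rewrite ler_wpM2l //.
have aE : (2 * th * (a / (2 * th)) = a)%R by field; rewrite gt_eqF.
have th2 : (1 <= 2 * th)%R by lra.
by have := tpow_scale hp M0 th2 a1; rewrite aE.
Qed.

Lemma cut_sum_moment n M th : (0 < M)%R -> (1 <= th)%R ->
  \int[ts]_q (G q)%:E <= th%:E ->
  \int[P]_w (tpsi p M (fine (cut_sum n w)))%:E <=
  (drift_cst th)%:E *
    \int[ts]_q ((G q)%:E * \int[P]_w (tpsi p M (cut_level n (w, q)))%:E) +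
  jump_cst%:E * \int[ts]_q ((G q `^ p)%:E * \int[P]_w (cut_level n (w, q))%:E).
Proof.
move=> M0 th1 Gth.
have p0 : (0 < p)%R by exact: lt_le_trans ltr01 hp.
have K0 : (0 <= burkholder_cst)%R by rewrite mulr_ge0 ?powR_ge0.
have mpsi : measurable_fun [set: Omega * (R * borel E)] (fun z => tpsi p M (cut_level n z)).
  exact: (measurableT_comp (measurable_tpsi p M) (measurable_cut_level n)).
have psi0 z : (0 <= tpsi p M (cut_level n z))%R by apply: tpsi_ge0; exact: cut_level_ge0.
have mGp : measurable_fun [set: R * borel E] (fun q => G q `^ p)%R.
  exact: (measurableT_comp (measurable_powR p) mG).
have Gp0 q : (0 <= G q `^ p)%R by exact: powR_ge0.
have [_ _ mnu _] := predictable_compensation (CP n) (mcutE n) (cutE0 n).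
apply: (le_trans (core_moment_inequality (CP n)
  (fun a b a0 ab bT => region_simple hP hT hN (mZ n) (mU n) (@Z0' n) (@U0 n) (lZ n) (lU n) a0 ab bT)
  hp M0 (measurable_cut_mark n) (cut_mark_ge0 n) (cut_mark_le n))).
rewrite -/burkholder_cst.
have mts (f : Omega * (R * borel E) -> R) (g : R * borel E -> R) :
    measurable_fun [set: Omega * (R * borel E)] f -> (forall z, 0 <= f z)%R ->
    measurable_fun [set: R * borel E] g -> (forall q, 0 <= g q)%R ->
    measurable_fun [set: Omega] (fun w => \int[ts]_q (g q * f (w, q))%:E).
  move=> mf f0 mg g0.
  apply: (@measurable_fun_fubini_tonelli_F _ _ Omega (R * borel E)%type R ts
    (fun z => (g z.2 * f z)%:E)).
    apply/measurable_EFinP; apply: measurable_funM => //.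
    exact: (measurableT_comp mg measurable_snd).
  by move=> z; rewrite lee_fin mulr_ge0.
apply: leeD.
  pose A : R := (2 * (burkholder_cst * (2 * burkholder_cst) `^ (p - 1)))%R.
  pose B : R := (Num.max 1 jump_mean `^ p * (2 * (2 * th) `^ (p - 1)))%R.
  have -> : (drift_cst th)%:E = A%:E * B%:E by rewrite -EFinM.
  rewrite -(muleA A%:E); apply: lee_wpmul2l.
    by rewrite lee_fin !mulr_ge0 ?powR_ge0.
  have B0 : (0 <= B)%R by rewrite !mulr_ge0 ?powR_ge0.
  rewrite -(time_space_exchange mG G0 mpsi psi0).
  rewrite -(ge0_integralZl_EFin P measurableT _ _ B0); last first.
  - exact: (mts _ _ mpsi psi0 mG G0).
  - by move=> w _; apply: integral_ge0 => q _; rewrite lee_fin mulr_ge0.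
  apply: ge0_le_integral => //.
  - move=> w _; rewrite lee_fin tpsi_ge0 // fine_ge0 //.
    by apply: integral_ge0 => b _; rewrite lee_fin cut_mark_ge0.
  - apply/measurable_EFinP; apply: (measurableT_comp (measurable_tpsi p M)).
    by apply: measurableT_comp => //; exact: mnu.
  - by apply: measurable_funeM; exact: (mts _ _ mpsi psi0 mG G0).
  - by move=> w _; exact: compensator_tpsi_le.
pose A : R := (2 * burkholder_cst * 2 `^ p)%R.
have -> : jump_cst%:E = A%:E * jump_moment%:E by rewrite -EFinM.
rewrite -(muleA A%:E); apply: lee_wpmul2l.
  by rewrite lee_fin !mulr_ge0 ?powR_ge0.
rewrite -(time_space_exchange mGp Gp0 (measurable_cut_level n) (cut_level_ge0 n)).
rewrite -(ge0_integralZl_EFin P measurableT _ _ jump_moment_ge0); last first.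
- exact: (mts _ _ (measurable_cut_level n) (cut_level_ge0 n) mGp Gp0).
- by move=> w _; apply: integral_ge0 => q _; rewrite lee_fin mulr_ge0 // cut_level_ge0.
have mcutp : measurable_fun [set: pT] ((fun z => (cut_mark n z `^ p)%:E) : pT -> \bar R).
  apply/measurable_EFinP; apply: (measurableT_comp (measurable_powR p)).
  exact: measurable_cut_mark.
have cutp0 (z : pT) : 0 <= (cut_mark n z `^ p)%:E by rewrite lee_fin powR_ge0.
have [_ _ mnup _] := predictable_compensation (CP n) mcutp cutp0.
apply: ge0_le_integral => //.
- by move=> w _; apply: integral_ge0 => b _; rewrite lee_fin powR_ge0.
- apply: measurable_funeM; exact: (mts _ _ (measurable_cut_level n) (cut_level_ge0 n) mGp Gp0).
- by move=> w _; exact: cut_compensator_le.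
Qed.

Lemma lim_sum_ge0 w : 0 <= lim_sum w.
Proof.
apply: (le_trans _ (limn_einf_sup (cut_sum ^~ w))); apply: limn_einf_ge.
by apply: nearW => n; apply: integral_ge0 => a _; rewrite lee_fin cut_mark_ge0.
Qed.

Lemma lim_sum_moment M th B1 B2 : (0 < M)%R -> (1 <= th)%R ->
  \int[ts]_q (G q)%:E <= th%:E ->
  (forall n, \int[ts]_q ((G q)%:E * \int[P]_w (tpsi p M (cut_level n (w, q)))%:E) <= B1%:E) ->
  (forall n, \int[ts]_q ((G q `^ p)%:E * \int[P]_w (cut_level n (w, q))%:E) <= B2%:E) ->
  \int[P]_w (tpsi p M (fine (lim_sum w)))%:E <=
  (2 `^ p * (drift_cst th * B1 + jump_cst * B2))%:E.
Proof.
move=> M0 th1 Gth hB1 hB2.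
have p0 : (0 < p)%R by exact: lt_le_trans ltr01 hp.
have K0 : (0 <= burkholder_cst)%R by rewrite mulr_ge0 ?powR_ge0.
have mfine (X : Omega -> \bar R) : measurable_fun [set: Omega] X ->
    measurable_fun [set: Omega] (fun w => (tpsi p M (fine (X w)))%:E).
  move=> mX; apply/measurable_EFinP; apply: (measurableT_comp (measurable_tpsi p M)).
  exact: measurableT_comp.
pose u n w := (tpsi p M (fine (cut_sum n w)))%:E.
have sum0 n w : 0 <= cut_sum n w by apply: integral_ge0 => a _; rewrite lee_fin cut_mark_ge0.
have u0 n w : 0 <= u n w by rewrite lee_fin tpsi_ge0 // fine_ge0.
have mu n : measurable_fun [set: Omega] (u n) by apply: mfine; exact: measurable_cut_sum.
have mlim : measurable_fun [set: Omega] (fun w => limn_einf (u ^~ w)).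
  rewrite (_ : (fun w => _) = (fun w => - limn_esup (fun n => - u n w))); last first.
    apply/funext => w; rewrite -limn_einfN; congr limn_einf; apply/funext => n.
    exact/esym/oppeK.
  apply: measurableT_comp => //; apply: measurable_fun_limn_esup => n.
  exact: measurableT_comp.
have lim0 w : 0 <= limn_einf (u ^~ w) by apply: limn_einf_ge; exact: nearW.
have fat : \int[P]_w limn_einf (u ^~ w) <=
    (drift_cst th * B1 + jump_cst * B2)%:E.
  apply: (le_trans (fatou P measurableT mu (fun n w _ => u0 n w))).
  apply: limn_einf_le => n; apply: (le_trans (cut_sum_moment n M0 th1 Gth)).
  rewrite EFinD !EFinM; apply: leeD; apply: lee_wpmul2l => //.
    by rewrite lee_fin !mulr_ge0 ?powR_ge0.
  by rewrite lee_fin !mulr_ge0 ?powR_ge0.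
apply: (@le_trans _ _ ((2 `^ p)%:E * \int[P]_w limn_einf (u ^~ w))); last first.
  by rewrite EFinM; apply: lee_wpmul2l; rewrite ?lee_fin ?powR_ge0.
rewrite -ge0_integralZl_EFin ?powR_ge0 //.
have limS0 := lim_sum_ge0.
apply: ae_ge0_le_integral => //.
- by move=> w _; rewrite lee_fin tpsi_ge0 // fine_ge0.
- by apply: mfine; exact: measurable_lim_sum.
- by move=> w _; rewrite mule_ge0 // lee_fin powR_ge0.
- exact: measurable_funeM.
apply: filterS2 cut_sum_cvg lim_sum_ae => w cw lw _; rewrite -lw in cw.
have tpsi0 : tpsi p M 0 = 0%R by rewrite /tpsi mul0r.
have [x0|x0] := leP (fine (lim_sum w)) 0%R.
  have -> : fine (lim_sum w) = 0%R by apply/eqP; rewrite eq_le x0 fine_ge0.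
  by rewrite tpsi0; rewrite mule_ge0 // lee_fin powR_ge0.
set x := fine (lim_sum w) in x0 *.
have lx : lim_sum w = x%:E.
  by move: x0; rewrite /x; case: (lim_sum w) => //= [|]; rewrite ltxx.
have -> : tpsi p M x = (2 `^ p * (2 `^ p)^-1 * tpsi p M x)%R.
  by rewrite mulfV ?mul1r // gt_eqF // powR_gt0.
rewrite -mulrA EFinM; apply: lee_wpmul2l; first by rewrite lee_fin powR_ge0.
apply: limn_einf_ge; rewrite lx in cw.
have /fine_cvgP[nf fc] := cw.
have half : (x / 2 < x)%R by lra.
have near2 := cvgr_gt _ fc _ half.
near=> n.
have hn : (x / 2 < fine (cut_sum n w))%R by near: n; exact: near2.
rewrite /u lee_fin ler_pdivrMl ?powR_gt0 //.
have f0 : (0 <= fine (cut_sum n w))%R by exact: fine_ge0.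
apply: le_trans (tpsi_scale hp M0 (ler1n _ 2) f0).
by apply: tpsi_mono => //; [exact: ltW|lra].
Unshelve. all: by end_near. Qed.

End kernel.
End thinned_sums.

(** * Moments of the Volterra field *)

Lemma discounted_integral_small {R : realType} (T : R) (k : R -> \bar R) (e : R) :
  (@lebesgue_measure R).-integrable `]0%R, T] k ->
  (forall r, (0 < r <= T)%R -> 0 <= k r) -> (0 < e)%R ->
  exists2 g : R, (0 <= g)%R &
    \int[@lebesgue_measure R]_(r in `]0%R, T]) ((expR (- (g * r)))%:E * k r) <= e%:E.
Proof.
move=> ik k0 e0.
pose f n r := (expR (- (n%:R * r)))%:E * k r.
have mD : measurable (`]0%R, T]%classic : set (measurableTypeR R)) by exact: measurable_itv.
have mk : measurable_fun (`]0%R, T]%classic : set (measurableTypeR R)) k by exact: measurable_int ik.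
have mf n : measurable_fun (`]0%R, T]%classic : set (measurableTypeR R)) (f n).
  apply: emeasurable_funM => //; apply/measurable_EFinP; apply: measurable_funTS.
  apply: (measurableT_comp (@measurable_expR R)).
  rewrite (_ : (fun r => _) = (fun r : R => - n%:R * r)%R).
    exact: mulrl_measurable.
  by apply/funext => r; rewrite mulNr.
have D0 r : (`]0%R, T]%classic r) -> 0 <= k r by rewrite /= in_itv /= => /k0.
have kfin := integrable_ae mD ik.
have [] := @dominated_convergence _ (measurableTypeR R) R lebesgue_measure _ mD f (cst 0) k mf.
- exact: measurable_cst.
- apply: filterS kfin => r kr Dr; have kf := kr Dr.
  have r0 : (0 < r)%R by move: Dr; rewrite /= in_itv /= => /andP[].
  rewrite -(mul0e (k r)); apply: cvgeZr => //.
  apply: cvg_EFin; first exact: nearW.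
  apply/cvgrPdist_lt => eps eps0; near=> n; rewrite /= sub0r normrN ger0_norm ?expR_ge0 //.
  have h1 : (1 + n%:R * r <= expR (n%:R * r))%R by exact: expR_ge1Dx.
  have hn : (eps^-1 / r < n%:R)%R by near: n; exact: nbhs_infty_gtr.
  rewrite expRN invf_plt ?posrE ?expR_gt0 //.
  by apply: lt_le_trans h1; rewrite ltr_pdivrMr // in hn; lra.
- exact: ik.
- apply: aeW => r n Dr; have kr := D0 r Dr.
  rewrite /f gee0_abs; last by rewrite mule_ge0 // lee_fin expR_ge0.
  rewrite -[X in _ <= X]mul1e; apply: lee_wpmul2r => //.
  rewrite lee_fin -expR0 ler_expR oppr_le0 mulr_ge0 //.
  by move: Dr; rewrite /= in_itv /= => /andP[/ltW].
move=> _ _; rewrite integral0 => cv.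
have /fine_cvgP[[n1 _ h1] /cvgr_lt/(_ _ e0)[n2 _ h2]] := cv.
pose n := maxn n1 n2.
exists n%:R => //; have := h2 n (leq_maxr _ _); have := h1 n (leq_maxl _ _).
by move=> /= /fineK <- ?; rewrite lee_fin; exact: ltW.
Unshelve. all: by end_near. Qed.

Section volterra_moments.
Context {R : realType} d (Omega : measurableType d) (P : probability Omega R).
Hypothesis hP : measure_is_complete P.
Variables (T : R) (E : pmetricType R).
Hypothesis hT : (0 < T)%R.
Variables (m : {finite_measure set (borel E) -> \bar R}) (l : {measure set R -> \bar R}).
Local Notation mark := (R * borel E * R * R)%type.
Local Notation leb := (@lebesgue_measure R).
Variable N : Omega -> {measure set mark -> \bar R}.
Hypothesis hN : poisson_random_measure P (marks T) (intensity m l) N.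
Variables (K : R -> E -> E -> R) (lambda0 lambda1 : R) (phi : R -> E -> R).
Variables (V : R -> E -> Omega -> \bar R) (p : R).
Hypothesis hK : admissible_kernel T m K.
Hypotheses (hlambda0 : (0 <= lambda0)%R) (hlambda1 : (0 <= lambda1)%R) (hp : (1 <= p)%R).
Hypothesis hphi : initial_field T phi.
Hypothesis hV : volterra_solution T P N K lambda0 lambda1 phi V.
Hypothesis hl1 : \int[l]_(z in `]0%R, +oo[) z%:E < +oo.
Hypothesis hlp : \int[l]_(z in `]0%R, +oo[) (z `^ p)%:E < +oo.
Hypothesis hkp : leb.-integrable `]0%R, T] (kernel_sup m K p).

Local Notation Lam := (thin_level T V lambda0 lambda1).
Local Notation cutl := (cut_level T V lambda0 lambda1).
Local Notation LS := (lim_sum T N V lambda0 lambda1).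
Local Notation ts := (time_space hT m).

Definition past_kernel (t : R) (x : E) (q : R * borel E) : R :=
  if (0 < q.1 < t)%R then K (t - q.1)%R x q.2 else 0%R.

Let hVp : predictable T P N V. Proof. by have [] := hV. Qed.
Let hV0 t x w : (0 <= t <= T)%R -> 0 <= V t x w. Proof. by have [_ h _ _ _] := hV; exact: h. Qed.
Let hK0 r x y : (0 < r <= T)%R -> (0 <= K r x y)%R. Proof. by have [h _ _] := hK; exact: h. Qed.

Lemma past_kernel_ge0 t x q : (t <= T)%R -> (0 <= past_kernel t x q)%R.
Proof.
move=> tT; rewrite /past_kernel; case: ifP => // /andP[? ?]; apply: hK0.
by apply/andP; split; lra.
Qed.

Lemma measurable_past_kernel t x : (t <= T)%R ->
  measurable_fun [set: R * borel E] (past_kernel t x).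
Proof.
move=> tT; pose D := [set q : R * borel E | (0 < q.1 < t)%R].
have mD : measurable D.
  rewrite (_ : D = `]0%R, t[%classic `*` setT); first exact: measurableX.
  by apply/seteqP; split => -[s y]; rewrite /D /= in_itv /=; [|case].
rewrite (_ : past_kernel t x = (fun q => K (t - q.1)%R x q.2) \_ D); last first.
  apply/funext => q; rewrite patchE /past_kernel.
  by congr (if _ then _ else _); apply/idP/idP; rewrite inE.
apply: (iffLR (measurable_restrictT _ mD)).
pose F := [set a : R * borel E * borel E | (0 < a.1.1 <= T)%R].
apply: (@measurable_comp _ _ _ _ _ _ F (fun a => K a.1.1 a.1.2 a.2) D
  (fun q => (t - q.1, x : borel E, q.2)%R)).
- rewrite (_ : F = `]0%R, T]%classic `*` setT `*` setT).
    by apply: measurableX => //; exact: measurableX.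
  by apply/seteqP; split => -[[s y] z]; rewrite /F /= in_itv /=; [|case; case].
- move=> _ [[s y] /= /andP[s0 st] <-]; rewrite /F /= subr_gt0 st /= lerBlDr.
  by rewrite (le_trans tT) // lerDl ltW.
- by have [_ h _] := hK.
- apply: measurable_funTS; apply: measurable_fun_pair; last exact: measurable_snd.
  by apply: measurable_fun_pair => //; apply: measurable_funB.
Qed.

Let k (r : R) : \bar R := ereal_sup (range (fun x : E => \int[m]_y (K r x y)%:E)).

Let ik : leb.-integrable `]0%R, T] k. Proof. by have [] := hK. Qed.

Let mTI : measurable (`]0%R, T]%classic : set (measurableTypeR R)).
Proof. exact: measurable_itv. Qed.

Let k0 r : (0 < r <= T)%R -> 0 <= k r.
Proof.
move=> r0; apply: le_trans (ereal_sup_ubound _); last by exists (point : E).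
by apply: integral_ge0 => y _; rewrite lee_fin hK0.
Qed.

Let kp0 r : 0 <= kernel_sup m K p r.
Proof.
apply: le_trans (ereal_sup_ubound _); last by exists (point : E).
by apply: integral_ge0 => y _; rewrite lee_fin powR_ge0.
Qed.

Let kint_fin (f : R -> \bar R) : leb.-integrable `]0%R, T] f ->
  (forall r, (0 < r <= T)%R -> 0 <= f r) ->
  exists2 I : R, (0 <= I)%R & \int[leb]_(r in `]0%R, T]) f r = I%:E.
Proof.
move=> if_ f0; have i0 : 0 <= \int[leb]_(r in `]0%R, T]) f r.
  by apply: integral_ge0 => r; rewrite /= in_itv /= => /f0.
have fn := integrable_fin_num mTI if_.
by exists (fine (\int[leb]_(r in `]0%R, T]) f r)); rewrite ?fine_ge0 ?fineK.
Qed.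

Lemma past_kernel_sup t x s : (0 < s < t)%R ->
  \int[m]_y (past_kernel t x (s, y))%:E <= k (t - s)%R.
Proof.
move=> st; rewrite /past_kernel /= st.
by apply: ereal_sup_ubound; exists x.
Qed.

Lemma past_kernel_pow_sup t x s : (0 < s < t)%R ->
  \int[m]_y (past_kernel t x (s, y) `^ p)%:E <= kernel_sup m K p (t - s)%R.
Proof.
move=> st; rewrite /past_kernel /= st.
by apply: ereal_sup_ubound; exists x.
Qed.

Lemma thin_levelE w s y : (0 < s <= T)%R ->
  Lam (w, (s, y)) = lambda0%:E + lambda1%:E * V s y w.
Proof. by move=> sT; rewrite /thin_level /field_point /= sT. Qed.

Lemma volterra_lim_sum t x : (0 <= t <= T)%R ->
  {ae P, forall w, V t x w = (phi t x)%:E + LS (past_kernel t x) w}.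
Proof.
move=> tT; have [_ _ _ _ hVeq] := hV; have [t0 tT'] := andP tT.
apply: filterS2 (hVeq t x tT) (lim_sum_ae hP hT hN hVp lambda0 lambda1 hl1
  (measurable_past_kernel x tT') (fun q => past_kernel_ge0 x q tT')) => w -> ->.
congr (_ + _); rewrite /thin_sum integral_mkcond [RHS]integral_mkcond.
apply: eq_integral => -[[[s y] z] u] _; rewrite !patchE /thin_mark /past_kernel /=.
case: ifPn => [|nb]; last first.
  case: ifPn => //; rewrite inE => -[/= sT z0 u0].
  case: ifPn => [st|_]; last by rewrite !mul0r.
  by move: nb; rewrite notin_setE; case; split.
rewrite inE => -[/= st z0 u0]; have [s0 s1] := andP st.
have sT : (0 < s <= T)%R by rewrite s0 (le_trans (ltW s1)).
by rewrite st ifT ?thin_levelE // inE.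
Qed.

Lemma thin_level_mean : exists2 C : R, (0 <= C)%R & forall q, (0 < q.1 <= T)%R ->
  \int[P]_w Lam (w, q) <= C%:E.
Proof.
have [_ _ _ sup _] := hV.
set S := ereal_sup _ in sup.
have S0 : 0 <= S.
  apply: (@le_trans _ _ (\int[P]_w V 0 (point : E) w)).
    by apply: integral_ge0 => w _; apply: hV0; rewrite lexx ltW.
  by apply: ereal_sup_ubound; exists (0%R, point : E) => //=; rewrite lexx ltW.
have SE : S = (fine S)%:E by rewrite fineK // ge0_fin_numE.
exists (lambda0 + lambda1 * fine S)%R; first by rewrite addr_ge0 // mulr_ge0 // fine_ge0.
move=> [s y] /= sT; have sT' : (0 <= s <= T)%R by case/andP: sT => /ltW -> ->.
have mfp := measurable_fun_pair1 (s, y) (measurable_field_point hP hT hN hVp).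
have fp0 w : [set: Omega] w -> 0 <= field_point T V (w, (s, y)) by move=> _; exact: field_point_ge0.
have l0 w : [set: Omega] w -> 0 <= lambda0%:E by rewrite lee_fin.
have lfp0 w : [set: Omega] w -> 0 <= lambda1%:E * field_point T V (w, (s, y)).
  by move=> _; rewrite mule_ge0 ?lee_fin ?fp0.
rewrite /thin_level (ge0_integralD P measurableT l0 (measurable_cst _) lfp0 (measurable_funeM _ mfp)).
rewrite (integral_cst P measurableT) [X in _ * X]probability_setT mule1.
rewrite (ge0_integralZl_EFin P measurableT fp0 mfp hlambda1).
rewrite EFinD EFinM -SE; apply: leeD => //; apply: lee_wpmul2l; first by rewrite lee_fin.
apply: ereal_sup_ubound; exists (s, y) => //=.
by apply: eq_integral => w _; rewrite /field_point /= sT.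
Qed.

Lemma thin_level_finite q : (0 < q.1 <= T)%R -> {ae P, forall w, Lam (w, q) < +oo}.
Proof.
case: q => s y /= sT; have sT' : (0 <= s <= T)%R by case/andP: sT => /ltW -> ->.
have [_ _ fin _ _] := hV; apply: filterS (fin s y sT') => w Vfin.
rewrite thin_levelE // -(@fineK _ (V s y w)); first by rewrite -EFinM -EFinD ltry.
by rewrite ge0_fin_numE // hV0.
Qed.

Let mLam q : measurable_fun [set: Omega] (fun w => Lam (w, q)).
Proof. exact: (measurable_fun_pair1 q (measurable_thin_level hP hT hN hVp lambda0 lambda1)). Qed.

Let Lam0 z : 0 <= Lam z. Proof. exact: thin_level_ge0. Qed.

Let mpsi M (X : Omega -> \bar R) : measurable_fun [set: Omega] X ->
  measurable_fun [set: Omega] (fun w => (tpsi p M (fine (X w)))%:E).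
Proof.
move=> mX; apply/measurable_EFinP; apply: (measurableT_comp (measurable_tpsi p M)).
exact: measurableT_comp.
Qed.

Definition truncated_moment M q : \bar R := \int[P]_w (tpsi p M (fine (Lam (w, q))))%:E.

Let mcutl n q : measurable_fun [set: Omega] (fun w => cutl n (w, q)).
Proof. exact: (measurable_fun_pair1 q (measurable_cut_level hP hT hN hVp lambda0 lambda1 n)). Qed.

Lemma cut_moment_le M n q : (0 < M)%R -> (0 < q.1 <= T)%R ->
  \int[P]_w (tpsi p M (cutl n (w, q)))%:E <= truncated_moment M q.
Proof.
move=> M0 qT; apply: ae_ge0_le_integral => //.
- by move=> w _; rewrite lee_fin tpsi_ge0 // cut_level_ge0.
- apply/measurable_EFinP; exact: (measurableT_comp (measurable_tpsi p M)).
- by move=> w _; rewrite lee_fin tpsi_ge0 // fine_ge0.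
- exact: mpsi.
apply: filterS (thin_level_finite qT) => w fin _.
rewrite lee_fin; apply: tpsi_mono => //; first exact: cut_level_ge0.
have Lf : Lam (w, q) \is a fin_num by rewrite ge0_fin_numE.
by rewrite -lee_fin (fineK Lf); exact: cut_level_le.
Qed.

Lemma truncated_moment_le M C q : (0 < M)%R -> (0 < q.1 <= T)%R ->
  \int[P]_w Lam (w, q) <= C%:E -> truncated_moment M q <= (M `^ (p - 1) * C)%:E.
Proof.
move=> M0 qT hC; apply: (@le_trans _ _ (\int[P]_w ((M `^ (p - 1))%:E * Lam (w, q)))).
  apply: ge0_le_integral => //.
  - by move=> w _; rewrite lee_fin tpsi_ge0 // fine_ge0.
  - exact: mpsi.
  - exact: measurable_funeM.
  move=> w _; apply: (@le_trans _ _ ((M `^ (p - 1))%:E * (fine (Lam (w, q)))%:E)).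
    by rewrite -EFinM lee_fin tpsi_le_lin // fine_ge0.
  apply: lee_wpmul2l; first by rewrite lee_fin powR_ge0.
  by case: (Lam (w, q)) (Lam0 (w, q)) => [r|_|] //; rewrite /= leey.
rewrite ge0_integralZl_EFin ?powR_ge0 // EFinM.
by apply: lee_wpmul2l; rewrite ?lee_fin ?powR_ge0.
Qed.

Lemma volterra_lin_moment : exists C : R,
  [/\ (0 <= C)%R, forall q, (0 < q.1 <= T)%R -> \int[P]_w Lam (w, q) <= C%:E &
    forall n q, (0 < q.1 <= T)%R -> \int[P]_w (cutl n (w, q))%:E <= C%:E].
Proof.
have [C C0 hC] := thin_level_mean; exists C; split => // n q qT.
apply: le_trans (hC q qT); apply: ge0_le_integral => //.
- by move=> w _; rewrite lee_fin cut_level_ge0.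
- exact/measurable_EFinP.
- by move=> w _; exact: cut_level_le.
Qed.

Let mtsP (G : R * borel E -> R) (f : Omega * (R * borel E) -> R) :
  measurable_fun [set: R * borel E] G ->
  measurable_fun [set: Omega * (R * borel E)] f -> (forall z, 0 <= f z)%R ->
  measurable_fun [set: R * borel E] (fun q => (G q)%:E * \int[P]_w (f (w, q))%:E).
Proof.
move=> mG mf f0; apply: emeasurable_funM; first exact/measurable_EFinP.
apply: (@measurable_fun_fubini_tonelli_G _ _ Omega (R * borel E)%type R P (fun z => (f z)%:E)).
  exact/measurable_EFinP.
by move=> z; rewrite lee_fin.
Qed.

Lemma weighted_moment_le (G : R * borel E -> R) (f : Omega * (R * borel E) -> R) (C : R)
    (b : R -> \bar R) t :
  (t <= T)%R -> measurable_fun [set: R * borel E] G -> (forall q, 0 <= G q)%R ->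
  (forall s y, ~ (0 < s < t)%R -> G (s, y) = 0%R) ->
  measurable_fun [set: Omega * (R * borel E)] f -> (forall z, 0 <= f z)%R ->
  (0 <= C)%R -> (forall q, (0 < q.1 <= T)%R -> \int[P]_w (f (w, q))%:E <= C%:E) ->
  \int[ts]_q (G q)%:E <= b t ->
  \int[ts]_q ((G q)%:E * \int[P]_w (f (w, q))%:E) <= C%:E * b t.
Proof.
move=> tT mG G0 Gout mf f0 C0 hC Gb.
apply: (@le_trans _ _ (\int[ts]_q (C%:E * (G q)%:E))); last first.
  rewrite ge0_integralZl_EFin //; [exact: lee_wpmul2l|by move=> q _; rewrite lee_fin|].
  exact/measurable_EFinP.
apply: ge0_le_integral => //.
- move=> q _; apply: mule_ge0; first by rewrite lee_fin.
  by apply: integral_ge0 => w _; rewrite lee_fin.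
- exact: mtsP.
- by apply: measurable_funeM; exact/measurable_EFinP.
move=> [s y] _; case: (boolP (0 < s < t)%R) => [st|/negP st]; last by rewrite Gout // mule0 mul0e.
rewrite muleC; apply: lee_wpmul2r; rewrite ?lee_fin //; apply: hC => /=.
by case/andP: st => -> /ltW /= /le_trans; apply.
Qed.

Let past_out t x s y : ~ (0 < s < t)%R -> past_kernel t x (s, y) = 0%R.
Proof. by move=> /negP/negbTE st; rewrite /past_kernel /= st. Qed.

Lemma moment_step : exists C0 D : R, [/\ (0 <= C0)%R, (0 <= D)%R &
  forall M B g kap t x, (0 < M)%R -> (0 <= B)%R -> (0 <= g)%R -> (0 < t <= T)%R ->
    \int[leb]_(r in `]0%R, T]) ((expR (- (g * r)))%:E * k r) <= kap%:E ->
    (forall q, (0 < q.1 <= T)%R -> truncated_moment M q <= (B * expR (g * q.1))%:E) ->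
    truncated_moment M (t, x) <= (C0 + D * (B * expR (g * t) * kap))%:E].
Proof.
have [I1 I10 I1E] := kint_fin ik k0.
have [Ip Ip0 IpE] := kint_fin hkp (fun r _ => kp0 r).
have [Cl [Cl0 _ hCl]] := volterra_lin_moment.
have [phi0 [Mphi hMphi] _] := hphi.
have K0 : (0 <= @burkholder_cst R p)%R by rewrite mulr_ge0 ?powR_ge0.
pose th := Num.max 1%R I1; have th1 : (1 <= th)%R by rewrite le_max lexx.
pose c1 := Num.max 1%R lambda1; have c11 : (1 <= c1)%R by rewrite le_max lexx.
have jm0 : (0 <= jump_moment l p)%R.
  by rewrite fine_ge0 //; apply: integral_ge0 => z _; rewrite lee_fin powR_ge0.
have jc0 : (0 <= jump_cst l p)%R by rewrite /jump_cst !mulr_ge0 ?powR_ge0.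
have dc0 : (0 <= drift_cst l p th)%R by rewrite /drift_cst !mulr_ge0 ?powR_ge0.
pose a0 := (lambda0 + lambda1 * `|Mphi|)%R.
have a00 : (0 <= a0)%R by rewrite addr_ge0 // mulr_ge0.
pose E1 := (2 `^ p * c1 `^ p * 2 `^ p)%R.
have E10 : (0 <= E1)%R by rewrite !mulr_ge0 ?powR_ge0.
exists (2 `^ p * a0 `^ p + E1 * (jump_cst l p * (Cl * Ip)))%R, (E1 * drift_cst l p th)%R.
split; [by rewrite addr_ge0 // !mulr_ge0 ?powR_ge0|by rewrite mulr_ge0|].
move=> M B g kap t x M0 B0 g0 tT hkap hA.
have [t0 tT'] := andP tT; have tT2 : (0 <= t <= T)%R by rewrite (ltW t0).
set G := past_kernel t x.
have mG : measurable_fun [set: R * borel E] G by exact: measurable_past_kernel.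
have G0 q : (0 <= G q)%R by exact: past_kernel_ge0.
have mk : measurable_fun (`]0%R, T]%classic : set R) k by exact: measurable_int ik.
have mkp : measurable_fun (`]0%R, T]%classic : set R) (kernel_sup m K p) by exact: measurable_int hkp.
have Gout s y : ~ (0 < s < t)%R -> G (s, y) = 0%R by exact: past_out.
have Gth : \int[ts]_q (G q)%:E <= th%:E.
  apply: (@le_trans _ _ I1%:E); last by rewrite lee_fin le_max lexx orbT.
  rewrite -I1E; apply: (time_space_le hT tT' (F := fun q => (G q)%:E)) => [||s y st|||s st].
  - exact/measurable_EFinP.
  - by move=> q; rewrite lee_fin.
  - by rewrite Gout.
  - exact: mk.
  - exact: k0.
  - exact: past_kernel_sup.
have hB2 n : \int[ts]_q ((G q `^ p)%:E * \int[P]_w (cutl n (w, q))%:E) <= (Cl * Ip)%:E.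
  rewrite EFinM -IpE.
  apply: (@weighted_moment_le (fun q => G q `^ p)%R (cutl n) Cl (fun=> _) t) => //.
  - exact: (measurableT_comp (measurable_powR p) mG).
  - by move=> q; exact: powR_ge0.
  - by move=> s y st; rewrite Gout // powR0 // gt_eqF // (lt_le_trans _ hp).
  - exact: (measurable_cut_level hP hT hN hVp).
  - by move=> z; exact: cut_level_ge0.
  - by move=> q; exact: hCl.
  apply: (time_space_le hT tT' (F := fun q => (G q `^ p)%:E)) => [||s y st|||s st].
  - apply/measurable_EFinP; exact: (measurableT_comp (measurable_powR p) mG).
  - by move=> q; rewrite lee_fin powR_ge0.
  - by rewrite Gout // powR0 // gt_eqF // (lt_le_trans _ hp).
  - exact: mkp.
  - by move=> r _; exact: kp0.
  - exact: past_kernel_pow_sup.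
have hB1 n : \int[ts]_q ((G q)%:E * \int[P]_w (tpsi p M (cutl n (w, q)))%:E) <=
    (B * expR (g * t) * kap)%:E.
  have mexp : measurable_fun [set: R] (fun r : R => expR (g * r))%R.
    by apply: (measurableT_comp (@measurable_expR R)); exact: mulrl_measurable.
  apply: (@le_trans _ _ (\int[ts]_q (G q * (B * expR (g * q.1)))%:E)).
    apply: ge0_le_integral => //.
    - move=> q _; apply: mule_ge0; first by rewrite lee_fin.
      by apply: integral_ge0 => w _; rewrite lee_fin tpsi_ge0 // cut_level_ge0.
    - apply: (mtsP mG (f := fun z => tpsi p M (cutl n z))).
        apply: (measurableT_comp (measurable_tpsi p M)).
        exact: (measurable_cut_level hP hT hN hVp).
      by move=> z; rewrite tpsi_ge0 // cut_level_ge0.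
    - apply/measurable_EFinP; apply: measurable_funM => //; apply: measurable_funM => //.
      exact: (measurableT_comp mexp measurable_fst).
    - move=> [s y] _; case: (boolP (0 < s < t)%R) => [st|/negP st]; last first.
        by rewrite Gout // mul0r mul0e.
      rewrite EFinM; apply: lee_wpmul2l; first by rewrite lee_fin.
      have sT : (0 < s <= T)%R by case/andP: st => -> /ltW /= /le_trans; apply.
      by apply: le_trans (cut_moment_le n M0 _) (hA (s, y) sT).
  apply: (@le_trans _ _ (\int[leb]_(r in `]0%R, T])
      ((B * expR (g * t))%:E * ((expR (- (g * r)))%:E * k r)))).
    apply: (time_space_le hT tT' (F := fun q => (G q * (B * expR (g * q.1)))%:E)).
    - apply/measurable_EFinP; apply: measurable_funM => //; apply: measurable_funM => //.
      exact: (measurableT_comp mexp measurable_fst).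
    - by move=> q; rewrite lee_fin !mulr_ge0 // expR_ge0.
    - by move=> s y st; rewrite Gout // mul0r.
    - apply: measurable_funeM; apply: emeasurable_funM => //.
      apply/measurable_EFinP; apply: measurable_funTS.
      apply: (measurableT_comp (@measurable_expR R)); apply: measurableT_comp => //.
    - by move=> r /k0 kr; rewrite !mule_ge0 // lee_fin ?mulr_ge0 // expR_ge0.
    - move=> s st; rewrite muleA -EFinM.
      have -> : (B * expR (g * t) * expR (- (g * (t - s))) = B * expR (g * s))%R.
        by rewrite -mulrA -expRD; congr (_ * expR _)%R; ring.
      under eq_integral do rewrite /= mulrC EFinM.
      rewrite ge0_integralZl_EFin //.
      + apply: lee_wpmul2l; first by rewrite lee_fin mulr_ge0 // expR_ge0.
        exact: past_kernel_sup.
      + by move=> y _; rewrite lee_fin.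
      + by apply/measurable_EFinP; exact: (measurable_fun_pair2 s mG).
      + by rewrite mulr_ge0 // expR_ge0.
  rewrite ge0_integralZl_EFin ?mulr_ge0 ?expR_ge0 //.
  - by rewrite (EFinM _ kap); apply: lee_wpmul2l; rewrite ?lee_fin ?mulr_ge0 ?expR_ge0.
  - by move=> r; rewrite /= in_itv /= => /k0 kr; rewrite mule_ge0 // lee_fin expR_ge0.
  - apply: emeasurable_funM => //.
    apply/measurable_EFinP; apply: measurable_funTS.
    apply: (measurableT_comp (@measurable_expR R)); apply: measurableT_comp => //.
have main := lim_sum_moment hP hN hVp hV0 hlambda0 hlambda1 hp hl1 hlp mG G0 M0 th1 Gth hB1 hB2.
have mLS : measurable_fun [set: Omega] (LS G).
  exact: (measurable_lim_sum hP hT hN hVp lambda0 lambda1 hl1 mG G0).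
have c0 : (0 <= (2 : R) `^ p * c1 `^ p)%R by rewrite mulr_ge0 ?powR_ge0.
apply: (@le_trans _ _ (\int[P]_w ((2 `^ p * a0 `^ p)%:E +
    (2 `^ p * c1 `^ p)%:E * (tpsi p M (fine (LS G w)))%:E))).
  apply: ae_ge0_le_integral => //.
  - by move=> w _; rewrite lee_fin tpsi_ge0 // fine_ge0.
  - exact: mpsi.
  - move=> w _; rewrite -EFinM -EFinD lee_fin.
    have LS0 : (0 <= fine (LS G w))%R by rewrite fine_ge0 //; exact: lim_sum_ge0.
    by rewrite addr_ge0 // mulr_ge0 ?powR_ge0 // tpsi_ge0.
  - apply: emeasurable_funD; first exact: measurable_cst.
    by apply: measurable_funeM; exact: mpsi.
  apply: filterS2 (volterra_lim_sum x tT2) (thin_level_finite (q := (t, x)) tT) => w Vw fin _.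
  have LS0 : 0 <= LS G w by exact: lim_sum_ge0.
  have LSf : (fine (LS G w))%:E = LS G w \/ lambda1 = 0%R.
    have [->|l10] := eqVneq lambda1 0%R; [by right|left].
    rewrite fineK // ge0_fin_numE // ltey; apply/eqP => Loo.
    have l1p : 0 < lambda1%:E by rewrite lte_fin lt_neqAle eq_sym l10.
    have e : Lam (w, (t, x)) = +oo.
      by rewrite thin_levelE // Vw Loo addey // (gt0_muley l1p) addey.
    by rewrite e in fin.
  have -> : fine (Lam (w, (t, x))) = (lambda0 + lambda1 * phi t x + lambda1 * fine (LS G w))%R.
    rewrite thin_levelE // Vw -/G; case: LSf => [|->]; last first.
      by rewrite mul0e adde0 /=; ring.
    by set r := fine (LS G w) => <- /=; ring.
  have LSr : (0 <= fine (LS G w))%R by rewrite fine_ge0.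
  have ph0 : (0 <= phi t x)%R by exact: phi0.
  have u0 : (0 <= lambda0 + lambda1 * phi t x)%R by rewrite addr_ge0 // mulr_ge0.
  rewrite -EFinM -EFinD lee_fin.
  apply: (le_trans (tpsi_add hp M0 u0 (mulr_ge0 hlambda1 LSr))).
  rewrite mulrDr lerD //.
    rewrite ler_wpM2l ?powR_ge0 //; apply: (le_trans (tpsi_le_pow hp M0 u0)).
    apply: ge0_ler_powR; rewrite ?nnegrE ?(le_trans _ hp) //.
    by rewrite lerD2l ler_wpM2l // (le_trans (hMphi t x tT2)) // ler_norm.
  rewrite -mulrA ler_wpM2l ?powR_ge0 //.
  apply: le_trans (tpsi_scale hp M0 c11 LSr).
  apply: tpsi_mono => //; first by rewrite mulr_ge0.
  by rewrite ler_wpM2r // le_max lexx orbT.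
have psi0 w : 0 <= (tpsi p M (fine (LS G w)))%:E.
  by rewrite lee_fin tpsi_ge0 // fine_ge0 //; exact: lim_sum_ge0.
rewrite ge0_integralD //; last 3 first.
- by move=> w _; rewrite lee_fin mulr_ge0 ?powR_ge0.
- by move=> w _; rewrite mule_ge0 // lee_fin.
- by apply: measurable_funeM; exact: mpsi.
rewrite (integral_cst P measurableT) [X in _ * X]probability_setT mule1.
rewrite (ge0_integralZl_EFin P measurableT (fun w _ => psi0 w) (mpsi M mLS) c0).
apply: (@le_trans _ _ ((2 `^ p * a0 `^ p)%:E + (2 `^ p * c1 `^ p)%:E *
  (2 `^ p * (drift_cst l p th * (B * expR (g * t) * kap) + jump_cst l p * (Cl * Ip)))%:E)).
  by apply: leeD => //; apply: lee_wpmul2l; rewrite ?lee_fin.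
by rewrite -EFinM -EFinD lee_fin /E1 le_eqVlt; apply/orP; left; apply/eqP; ring.
Qed.

(* Gronwall's lemma by iteration: with the weight [expR (g * t)] and g large, [moment_step]
   turns a bound [B] into [C0 + B / 2], and the crude initial bound, which depends on the
   truncation level, is forgotten in the limit. *)
Lemma volterra_moment : exists2 C : R, (0 <= C)%R &
  forall M q, (0 < M)%R -> (0 < q.1 <= T)%R -> truncated_moment M q <= C%:E.
Proof.
have [C0 [D [C00 D0 step]]] := moment_step.
have [Cl [Cl0 hCl _]] := volterra_lin_moment.
have e0 : (0 < (2 * (D + 1))^-1)%R by rewrite invr_gt0; lra.
have [g g0 hg] := discounted_integral_small ik k0 e0.
exists ((2 * C0 + 1) * expR (g * T))%R; first by rewrite mulr_ge0 ?expR_ge0 //; lra.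
move=> M q M0 qT; set B0 := (M `^ (p - 1) * Cl)%R.
have B00 : (0 <= B0)%R by rewrite mulr_ge0 ?powR_ge0.
have Bd n : (0 <= B0 / 2 ^+ n)%R by apply: divr_ge0 => //; exact: exprn_ge0.
have exp1 s : (0 < s <= T)%R -> (1 <= expR (g * s))%R.
  by move=> /andP[/ltW s0 _]; rewrite -expR0 ler_expR mulr_ge0.
have iter n : forall q', (0 < q'.1 <= T)%R ->
    truncated_moment M q' <= ((2 * C0 + B0 / 2 ^+ n) * expR (g * q'.1))%:E.
  elim: n => [|n IH] q' q'T.
    apply: (le_trans (truncated_moment_le M0 q'T (hCl _ q'T))); rewrite lee_fin -/B0.
    rewrite expr0 divr1; have := exp1 _ q'T; nra.
  case: q' q'T => t x /= tT.
  have Bn0 : (0 <= 2 * C0 + B0 / 2 ^+ n)%R by rewrite addr_ge0 // mulr_ge0.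
  apply: (le_trans (step M _ g _ t x M0 Bn0 g0 tT hg IH)); rewrite lee_fin.
  set b := (B0 / 2 ^+ n)%R in Bn0 *.
  have -> : (B0 / 2 ^+ n.+1 = b / 2)%R.
    by rewrite /b exprS; field; rewrite expf_neq0.
  have b0 : (0 <= b)%R by exact: Bd.
  have ex := exp1 t tT; set e := expR (g * t) in ex *.
  have De : (D * (2 * (D + 1))^-1 <= 2^-1)%R.
    rewrite invfM mulrCA ler_piMr // ler_pdivrMr; lra.
  have -> : (D * ((2 * C0 + b) * e * (2 * (D + 1))^-1) =
      D * (2 * (D + 1))^-1 * ((2 * C0 + b) * e))%R by ring.
  have Be0 : (0 <= (2 * C0 + b) * e)%R by rewrite mulr_ge0 //; lra.
  have h1 : (D * (2 * (D + 1))^-1 * ((2 * C0 + b) * e) <= 2^-1 * ((2 * C0 + b) * e))%R.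
    exact: ler_wpM2r.
  have h2 : (C0 <= C0 * e)%R by rewrite ler_peMr.
  apply: (le_trans (lerD h2 h1)).
  rewrite le_eqVlt; apply/orP; left; apply/eqP.
  by field.
have [n hn] : exists n, (B0 / 2 ^+ n <= 1)%R.
  exists (Num.bound B0); rewrite ler_pdivrMr ?exprn_gt0 // mul1r.
  apply: (le_trans (ltW (archi_boundP B00))).
  by rewrite -natrX ler_nat ltnW // ltn_expl.
apply: (le_trans (iter n q qT)); rewrite lee_fin.
apply: ler_pM; rewrite ?expR_ge0 // ?lerD2l //.
  by rewrite addr_ge0 // mulr_ge0.
by rewrite ler_expR ler_wpM2l //; case/andP: qT.
Qed.

End volterra_moments.

Lemma poweR_le_pow (R : realType) (X : \bar R) (q a : R) : (0 < q)%R -> (0 <= a)%R ->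
  0 <= X -> X `^ q^-1 <= a%:E -> X <= (a `^ q)%:E.
Proof.
move=> q0 a0; case: X => [r| |] //; last first.
  by rewrite poweRyr ?gt_eqF ?invr_gt0 // leye_eq.
rewrite poweR_EFin !lee_fin => r0 ra.
have -> : r = ((r `^ q^-1) `^ q)%R by rewrite -powRrM mulVf ?powRr1 // gt_eqF.
by apply: ge0_ler_powR; rewrite ?nnegrE ?powR_ge0 // ltW.
Qed.

Section volterra_increments.
Context {R : realType} d (Omega : measurableType d) (P : probability Omega R).
Hypothesis hP : measure_is_complete P.
Variables (T : R) (E : pmetricType R).
Hypothesis hT : (0 < T)%R.
Variables (m : {finite_measure set (borel E) -> \bar R}) (l : {measure set R -> \bar R}).
Local Notation mark := (R * borel E * R * R)%type.
Local Notation leb := (@lebesgue_measure R).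
Variable N : Omega -> {measure set mark -> \bar R}.
Hypothesis hN : poisson_random_measure P (marks T) (intensity m l) N.
Variables (K : R -> E -> E -> R) (lambda0 lambda1 : R) (phi : R -> E -> R).
Variables (V : R -> E -> Omega -> \bar R) (p : R).
Hypothesis hK : admissible_kernel T m K.
Hypotheses (hlambda0 : (0 <= lambda0)%R) (hlambda1 : (0 <= lambda1)%R) (hp : (1 <= p)%R).
Hypothesis hphi : initial_field T phi.
Hypothesis hV : volterra_solution T P N K lambda0 lambda1 phi V.
Hypothesis hl1 : \int[l]_(z in `]0%R, +oo[) z%:E < +oo.
Hypothesis hlp : \int[l]_(z in `]0%R, +oo[) (z `^ p)%:E < +oo.
Hypothesis hkp : leb.-integrable `]0%R, T] (kernel_sup m K p).

Local Notation Lam := (thin_level T V lambda0 lambda1).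
Local Notation cutl := (cut_level T V lambda0 lambda1).
Local Notation LS := (lim_sum T N V lambda0 lambda1).
Local Notation TS := (thin_sum T N V lambda0 lambda1).
Local Notation ts := (time_space hT m).
Local Notation PK := (past_kernel K).

Let hVp : predictable T P N V. Proof. by have [] := hV. Qed.
Let hV0 t x w : (0 <= t <= T)%R -> 0 <= V t x w. Proof. by have [_ h _ _ _] := hV; exact: h. Qed.
Let p0 : (0 < p)%R. Proof. exact: lt_le_trans ltr01 hp. Qed.

Lemma lim_sum_pow_moment (H1 Hp : R) : (0 <= H1)%R -> (0 <= Hp)%R ->
  exists2 C : R, (0 <= C)%R & forall t (G : R * borel E -> R), (t <= T)%R ->
    measurable_fun [set: R * borel E] G -> (forall q, 0 <= G q)%R ->
    (forall s y, ~ (0 < s < t)%R -> G (s, y) = 0%R) ->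
    \int[ts]_q (G q)%:E <= H1%:E -> \int[ts]_q (G q `^ p)%:E <= Hp%:E ->
    \int[P]_w (fine (LS G w) `^ p)%:E <= C%:E.
Proof.
move=> H10 Hp0.
have [Cl [Cl0 _ hCl]] := volterra_lin_moment hP hT hN hlambda0 hlambda1 hV.
have [CA CA0 hCA] := volterra_moment hP hT hN hK hlambda0 hlambda1 hp hphi hV hl1 hlp hkp.
pose th := Num.max 1%R H1; have th1 : (1 <= th)%R by rewrite le_max lexx.
have K0 : (0 <= @burkholder_cst R p)%R by rewrite mulr_ge0 ?powR_ge0.
have jm0 : (0 <= jump_moment l p)%R.
  by rewrite fine_ge0 //; apply: integral_ge0 => z _; rewrite lee_fin powR_ge0.
have jc0 : (0 <= jump_cst l p)%R by rewrite /jump_cst !mulr_ge0 ?powR_ge0.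
have dc0 : (0 <= drift_cst l p th)%R by rewrite /drift_cst !mulr_ge0 ?powR_ge0.
exists (2 `^ p * (drift_cst l p th * (CA * H1) + jump_cst l p * (Cl * Hp)))%R.
  apply: mulr_ge0; first exact: powR_ge0.
  by apply: addr_ge0; apply: mulr_ge0 => //; exact: mulr_ge0.
move=> t G tT mG G0 Gout Gth Gthp.
have Gth' : \int[ts]_q (G q)%:E <= th%:E.
  by apply: (le_trans Gth); rewrite lee_fin le_max lexx orbT.
have mGp : measurable_fun [set: R * borel E] (fun q => G q `^ p)%R.
  exact: (measurableT_comp (measurable_powR p) mG).
have mcut := measurable_cut_level hP hT hN hVp lambda0 lambda1.
have cut0 n z : (0 <= cutl n z)%R by exact: cut_level_ge0.
have hB2 n : \int[ts]_q ((G q `^ p)%:E * \int[P]_w (cutl n (w, q))%:E) <= (Cl * Hp)%:E.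
  rewrite EFinM; apply: (@weighted_moment_le _ _ _ P T E hT m (fun q => G q `^ p)%R (cutl n) Cl (fun=> Hp%:E) t) => //.
  - by move=> q; exact: powR_ge0.
  - by move=> s y st; rewrite Gout // powR0 // gt_eqF.
  - by move=> q; exact: hCl.
have LS0 w : (0 <= fine (LS G w))%R by rewrite fine_ge0 //; exact: lim_sum_ge0.
have mLS : measurable_fun [set: Omega] (fun w => fine (LS G w)).
  apply: measurableT_comp => //.
  exact: (measurable_lim_sum hP hT hN hVp lambda0 lambda1 hl1 mG G0).
pose u (n : nat) w := (tpsi p n.+1%:R (fine (LS G w)))%:E.
have M0 n : (0 < n.+1%:R :> R)%R by [].
have u0 n w : 0 <= u n w by rewrite lee_fin tpsi_ge0.
have mu n : measurable_fun [set: Omega] (u n).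
  by apply/measurable_EFinP; exact: (measurableT_comp (measurable_tpsi p _) mLS).
have lim w : limn_einf (u ^~ w) = (fine (LS G w) `^ p)%:E.
  have : u ^~ w @ \oo --> (fine (LS G w) `^ p)%:E.
    apply: cvg_near_cst; exists (Num.bound (fine (LS G w))) => // n /= bn.
    rewrite /u tpsi_eq_pow //; apply: ltW.
    by apply: (lt_le_trans (archi_boundP (LS0 w))); rewrite ler_nat ltnW.
  by move=> /cvg_limn_einf_sup [].
under eq_integral do rewrite -lim.
apply: (le_trans (fatou P measurableT mu (fun n w _ => u0 n w))).
apply: limn_einf_le => n.
apply: (lim_sum_moment hP hN hVp hV0 hlambda0 hlambda1 hp hl1 hlp mG G0 (M0 n) th1 Gth' _ hB2) => k.
rewrite EFinM; apply: (@weighted_moment_le _ _ _ P T E hT m G (fun z => tpsi p n.+1%:R (cutl k z)) CA (fun=> H1%:E) t) => //.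
- exact: (measurableT_comp (measurable_tpsi p _) (mcut k)).
- by move=> z; exact: tpsi_ge0.
- move=> q qT; apply: le_trans (hCA n.+1%:R q (M0 n) qT).
  exact: (cut_moment_le hP hT hN hlambda0 hlambda1 hp hV).
Qed.

Let mthin (G : R * borel E -> R) w : measurable_fun [set: R * borel E] G ->
  measurable_fun [set: mark] (fun a => (thin_mark T V lambda0 lambda1 G (w, a))%:E).
Proof.
move=> mG; apply/measurable_EFinP; apply: measurable_funM; last first.
  apply: (measurable_thinning (L := fun q => Lam (w, q))).
  exact: (measurable_fun_pair2 w (measurable_thin_level hP hT hN hVp lambda0 lambda1)).
apply: measurable_funM.
  apply: (measurableT_comp mG); apply: (measurableT_comp measurable_fst).
  exact: measurable_fst.
by apply: (measurableT_comp measurable_snd); exact: measurable_fst.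
Qed.

Lemma thin_sum_increment (G1 G2 G : R * borel E -> R) (c : R) w : (0 < c)%R ->
  measurable_fun [set: R * borel E] G1 -> measurable_fun [set: R * borel E] G2 ->
  measurable_fun [set: R * borel E] G ->
  (forall q, 0 <= G1 q)%R -> (forall q, 0 <= G2 q)%R -> (forall q, 0 <= G q)%R ->
  (forall q, c * G q = `|G1 q - G2 q|)%R ->
  TS G1 w < +oo -> TS G2 w < +oo ->
  (`|fine (TS G1 w) - fine (TS G2 w)| <= c * fine (TS G w))%R.
Proof.
move=> c0 m1 m2 m3 g1 g2 g3 e f1 f2.
have pos H : (forall q, 0 <= H q)%R -> forall a, live T a -> 0 <= (thin_mark T V lambda0 lambda1 H (w, a))%:E.
  by move=> H0 a [_ z0 _]; rewrite lee_fin !mulr_ge0.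
have mm H : measurable_fun [set: R * borel E] H ->
    measurable_fun (@live R T E) (fun a => (thin_mark T V lambda0 lambda1 H (w, a))%:E).
  by move=> mH; apply: measurable_funTS; exact: mthin.
have S0 H : (forall q, 0 <= H q)%R -> 0 <= TS H w.
  by move=> H0; apply: integral_ge0 => a /(pos H H0).
have mL := @measurable_live R T E.
have add (H1 H2 : R * borel E -> R) : measurable_fun [set: R * borel E] H1 -> measurable_fun [set: R * borel E] H2 ->
    (forall q, 0 <= H1 q)%R -> (forall q, 0 <= H2 q)%R ->
    TS H1 w + TS H2 w = \int[N w]_(a in @live R T E) ((thin_mark T V lambda0 lambda1 H1 (w, a))%:E
      + (thin_mark T V lambda0 lambda1 H2 (w, a))%:E).
  by move=> mH1 mH2 H10 H20; rewrite -(ge0_integralD (N w) mL (pos _ H10) (mm _ mH1) (pos _ H20) (mm _ mH2)).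
pose cG q := (c * G q)%R.
have mcG : measurable_fun [set: R * borel E] cG by exact: measurable_funM.
have cG0 q : (0 <= cG q)%R by rewrite mulr_ge0 // ltW.
have cGE : TS cG w = c%:E * TS G w.
  rewrite /thin_sum -(ge0_integralZl_EFin (N w) mL (pos _ g3) (mm _ m3) (ltW c0)).
  by apply: eq_integral => a _; rewrite -EFinM /thin_mark /cG !mulrA.
have le3 (H1 H2 H3 : R * borel E -> R) : measurable_fun [set: R * borel E] H1 ->
    measurable_fun [set: R * borel E] H2 -> measurable_fun [set: R * borel E] H3 ->
    (forall q, 0 <= H1 q)%R -> (forall q, 0 <= H2 q)%R -> (forall q, 0 <= H3 q)%R ->
    (forall q, H1 q <= H2 q + H3 q)%R -> TS H1 w <= TS H2 w + TS H3 w.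
  move=> mH1 mH2 mH3 H10 H20 H30 H123; rewrite add //.
  apply: ge0_le_integral => //.
  - exact: pos.
  - exact: mm.
  - by apply: emeasurable_funD; exact: mm.
  - move=> a [_ z0 _]; rewrite -EFinD lee_fin /thin_mark /= -mulrDl ler_wpM2r //.
    by rewrite -mulrDl ler_wpM2r.
have n1 q : (G1 q <= G2 q + cG q)%R by rewrite /cG e -lerBlDl ler_norm.
have n2 q : (G2 q <= G1 q + cG q)%R by rewrite /cG e distrC -lerBlDl ler_norm.
have n3 q : (cG q <= G1 q + G2 q)%R.
  by rewrite /cG e; apply: (le_trans (ler_normB _ _)); rewrite !ger0_norm.
have e3 := le3 _ _ _ mcG m1 m2 cG0 g1 g2 n3.
have e1 := le3 _ _ _ m1 m2 mcG g1 g2 cG0 n1.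
have e2 := le3 _ _ _ m2 m1 mcG g2 g1 cG0 n2.
have F1 : (fine (TS G1 w))%:E = TS G1 w by rewrite fineK // ge0_fin_numE // S0.
have F2 : (fine (TS G2 w))%:E = TS G2 w by rewrite fineK // ge0_fin_numE // S0.
have fin3 : TS cG w < +oo.
  by apply: (le_lt_trans e3); rewrite -F1 -F2 -EFinD ltry.
have F3 : (fine (TS cG w))%:E = TS cG w by rewrite fineK // ge0_fin_numE ?S0.
have GF : TS G w \is a fin_num.
  rewrite ge0_fin_numE ?S0 // ltey; apply/eqP => oo; move: fin3.
  by rewrite cGE oo gt0_muley ?lte_fin // ltxx.
have <- : fine (TS cG w) = (c * fine (TS G w))%R by rewrite cGE fineM.
rewrite -F1 -F2 -F3 -!EFinD !lee_fin in e1 e2.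
by rewrite ler_norml; apply/andP; split; lra.
Qed.

Variables (beta Cphi : R) (h : R -> R -> R).
Hypothesis hCphi : (0 <= Cphi)%R.
Hypothesis hh : forall q, q \in [:: 1%R; 2%R; p] ->
  (forall r, (0 <= r <= T)%R -> (0 <= h q r)%R) /\ in_Lq q `[0%R, T] (h q).
Hypothesis hphi_holder : forall x x' : E,
  ereal_sup [set `|phi t x - phi t x'|%:E | t in `[0%R, T]] <=
  (Cphi * mdist x x' `^ beta)%:E.
Hypothesis hK_holder : forall q r (x x' : E), q \in [:: 1%R; 2%R; p] ->
  (0 < r <= T)%R ->
  (\int[m]_y (`|K r x y - K r x' y| `^ q)%:E) `^ q^-1 <=
  (h q r * mdist x x' `^ beta)%:E.

Let kernel_quotient t x x' (q : R * borel E) : R :=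
  (`|PK t x q - PK t x' q| / mdist x x' `^ beta)%R.

Let mTI : measurable (`]0%R, T]%classic : set (measurableTypeR R)).
Proof. exact: measurable_itv. Qed.

Let kernel_quotient_bound q : q \in [:: 1%R; 2%R; p] -> (1 <= q)%R ->
  exists2 H : R, (0 <= H)%R & forall t (x x' : E), (t <= T)%R -> (0 < mdist x x')%R ->
    \int[ts]_a (kernel_quotient t x x' a `^ q)%:E <= H%:E.
Proof.
move=> qin q1; have q0 : (0 < q)%R by exact: lt_le_trans ltr01 q1.
have [hq0 [mhq hqoo]] := hh qin.
have mhp : measurable_fun (`[0%R, T]%classic : set (measurableTypeR R)) (fun r => (`|h q r| `^ q)%:E).
  apply/measurable_EFinP; apply: (measurableT_comp (measurable_powR q)).
  exact: measurableT_comp.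
have sub : `]0%R, T]%classic `<=` `[0%R, T]%classic.
  by move=> r; rewrite /= !in_itv /= => /andP[/ltW -> ->].
have mI : measurable (`[0%R, T]%classic : set (measurableTypeR R)) by exact: measurable_itv.
have i0 : 0 <= \int[leb]_(r in `[0%R, T]) (`|h q r| `^ q)%:E.
  by apply: integral_ge0 => r _; rewrite lee_fin powR_ge0.
exists (fine (\int[leb]_(r in `[0%R, T]) (`|h q r| `^ q)%:E)); first exact: fine_ge0.
rewrite fineK ?ge0_fin_numE // => t x x' tT d0.
have db0 : (0 < mdist x x' `^ beta)%R by exact: powR_gt0.
apply: (@le_trans _ _ (\int[leb]_(r in `]0%R, T]) (`|h q r| `^ q)%:E)); last first.
  by apply: ge0_subset_integral => // r _; rewrite lee_fin powR_ge0.
have mPK z := measurable_past_kernel hK z tT.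
have mG : measurable_fun [set: R * borel E] (kernel_quotient t x x').
  apply: measurable_funM => //; apply: measurableT_comp => //.
  exact: measurable_funB.
have mGq : measurable_fun [set: R * borel E] (fun a => kernel_quotient t x x' a `^ q)%R.
  exact: (measurableT_comp (measurable_powR q) mG).
apply: (time_space_le hT tT (F := fun a => (kernel_quotient t x x' a `^ q)%:E)) => [||s y st||r _|s st].
- exact/measurable_EFinP.
- by move=> a; rewrite lee_fin powR_ge0.
- have /negP/negbTE e := st.
  by rewrite /kernel_quotient /past_kernel /= e subrr normr0 mul0r powR0 // gt_eqF.
- exact: measurable_funS mhp.
- by rewrite lee_fin powR_ge0.
have rT : (0 < t - s <= T)%R by case/andP: st => ? ?; apply/andP; split; lra.
have hr0 : (0 <= h q (t - s))%R by apply: hq0; case/andP: rT => /ltW -> ->.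
have h1 := hK_holder x x' qin rT.
have I0 : 0 <= \int[m]_y (`|K (t - s) x y - K (t - s) x' y| `^ q)%:E.
  by apply: integral_ge0 => y _; rewrite lee_fin powR_ge0.
have h2 := poweR_le_pow q0 (mulr_ge0 hr0 (ltW db0)) I0 h1.
have mdq : measurable_fun [set: borel E] (fun y => `|PK t x (s, y) - PK t x' (s, y)| `^ q)%R.
  apply: (measurableT_comp (measurable_powR q)); apply: measurableT_comp => //.
  by apply: measurable_funB; exact: (measurable_fun_pair2 s (mPK _)).
rewrite (_ : \int[m]_y _ = ((mdist x x' `^ beta) `^ q)^-1%:E *
    \int[m]_y (`|K (t - s) x y - K (t - s) x' y| `^ q)%:E); last first.
  rewrite -ge0_integralZl_EFin ?invr_ge0 ?powR_ge0 //.
  - apply: eq_integral => y _; rewrite -EFinM /kernel_quotient /past_kernel /= st.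
    rewrite powRM ?invr_ge0 ?(ltW db0) // mulrC; congr (_ * _)%:E.
    have dq : ((mdist x x' `^ beta) `^ q != 0)%R by rewrite gt_eqF // powR_gt0.
    by apply: (mulfI dq); rewrite -powRM ?invr_ge0 ?(ltW db0) // !mulfV ?powR1 // gt_eqF.
  - have := mdq; rewrite /past_kernel /= st => mq.
    exact/measurable_EFinP.
apply: (@le_trans _ _ (((mdist x x' `^ beta) `^ q)^-1%:E *
    ((h q (t - s) * mdist x x' `^ beta) `^ q)%:E)).
  apply: lee_wpmul2l; first by rewrite lee_fin invr_ge0 powR_ge0.
  exact: h2.
rewrite -EFinM lee_fin powRM // ?(ltW db0) // ger0_norm // mulrCA mulVf ?mulr1 //.
by rewrite gt_eqF // powR_gt0.
Qed.

Lemma volterra_increment : exists2 C : R, (0 <= C)%R &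
  forall t, (0 <= t <= T)%R -> exists2 Y : E -> Omega -> R,
    (forall x, measurable_fun [set: Omega] (Y x)) /\
    (forall x, {ae P, forall w, V t x w = (Y x w)%:E}) &
    forall x x', \int[P]_w (`|Y x w - Y x' w| `^ p)%:E <=
      (C * mdist x x' `^ (beta * p))%:E.
Proof.
have q1 : (1%R : R) \in [:: 1%R; 2%R; p] by rewrite mem_head.
have qp : p \in [:: 1%R; 2%R; p] by rewrite !inE eqxx !orbT.
have [H1 H10 hH1] := kernel_quotient_bound q1 (lexx _).
have [Hp Hp0 hHp] := kernel_quotient_bound qp hp.
have [C C0 hC] := lim_sum_pow_moment H10 Hp0.
exists (2 `^ p * (Cphi `^ p + C))%R.
  by rewrite mulr_ge0 ?powR_ge0 // addr_ge0 // powR_ge0.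
move=> t tT; have [t0 tT'] := andP tT.
have mPK x := measurable_past_kernel hK x tT'.
have PK0 x q := past_kernel_ge0 hK x q tT'.
have mLSf (G : R * borel E -> R) : measurable_fun [set: R * borel E] G -> (forall q, 0 <= G q)%R ->
    measurable_fun [set: Omega] (fun w => fine (LS G w)).
  move=> mG G0; apply: measurableT_comp => //.
  exact: (measurable_lim_sum hP hT hN hVp lambda0 lambda1 hl1 mG G0).
have LS0 (G : R * borel E -> R) w : (forall q, 0 <= G q)%R -> 0 <= LS G w by move=> G0; exact: lim_sum_ge0.
have VLS x := volterra_lim_sum hP hT hN hK hV hl1 x tT.
have Vfin x : {ae P, forall w, V t x w < +oo} by have [_ _ vf _ _] := hV; exact: vf.
have LSfin x : {ae P, forall w, LS (PK t x) w < +oo}.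
  apply: filterS2 (VLS x) (Vfin x) => w -> vf; rewrite ltey; apply/eqP => oo.
  by move: vf; rewrite oo addey.
pose Y x w := (phi t x + fine (LS (PK t x) w))%R.
have mY x : measurable_fun [set: Omega] (Y x).
  by apply: measurable_funD => //; exact: mLSf.
exists Y.
  split=> // x; apply: filterS2 (VLS x) (LSfin x) => w -> fin.
  by rewrite EFinD fineK // ge0_fin_numE // LS0.
move=> x x'; have [->|xx'] := eqVneq x x'.
  under eq_integral do rewrite subrr normr0 powR0 ?gt_eqF //.
  by rewrite integral0 lee_fin mulr_ge0 ?powR_ge0 // mulr_ge0 ?powR_ge0 // addr_ge0 ?powR_ge0.
have d0 : (0 < mdist x x')%R by rewrite mdist_gt0.
set db := (mdist x x' `^ beta)%R.
have db0 : (0 < db)%R by exact: powR_gt0.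
set G := kernel_quotient t x x'.
have G0 q : (0 <= G q)%R by rewrite divr_ge0 // ltW.
have mG : measurable_fun [set: R * borel E] G.
  apply: measurable_funM => //; apply: measurableT_comp => //.
  exact: measurable_funB.
have GE q : (db * G q = `|PK t x q - PK t x' q|)%R.
  by rewrite /G /kernel_quotient mulrCA mulfV ?mulr1 // gt_eqF.
have TSE H := lim_sum_ae hP hT hN hVp lambda0 lambda1 hl1 (G := H).
have inc : {ae P, forall w, (`|Y x w - Y x' w| <= db * (Cphi + fine (LS G w)))%R}.
  have h12 : {ae P, forall w, LS (PK t x) w < +oo /\ LS (PK t x') w < +oo}.
    by apply: filterS2 (LSfin x) (LSfin x') => w.
  have h34 : {ae P, forall w, LS (PK t x) w = TS (PK t x) w /\ LS (PK t x') w = TS (PK t x') w}.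
    by apply: filterS2 (TSE _ (mPK x) (PK0 x)) (TSE _ (mPK x') (PK0 x')) => w.
  apply: filterS3 h12 h34 (TSE _ mG G0) => w [f1 f2] [e1 e2] e3.
  rewrite e1 in f1; rewrite e2 in f2.
  have := thin_sum_increment db0 (mPK x) (mPK x') mG (PK0 x) (PK0 x') G0 GE f1 f2.
  rewrite -e1 -e2 -e3 => i1.
  have i2 : (`|phi t x - phi t x'| <= Cphi * db)%R.
    rewrite -lee_fin; apply: le_trans (hphi_holder x x').
    by apply: ereal_sup_ubound; exists t.
  rewrite /Y opprD addrACA; apply: (le_trans (ler_normD _ _)).
  by rewrite mulrDr [(db * Cphi)%R]mulrC; exact: lerD.
have X0 w : (0 <= fine (LS G w))%R by rewrite fine_ge0 // LS0.
have powD a b : (0 <= a)%R -> (0 <= b)%R -> ((a + b) `^ p <= 2 `^ p * (a `^ p + b `^ p))%R.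
  move=> a0 b0; have M0 : (0 < a + b + 1)%R by lra.
  have := tpsi_add hp M0 a0 b0; rewrite !tpsi_eq_pow //; lra.
apply: (@le_trans _ _ (\int[P]_w ((db `^ p * 2 `^ p)%:E *
    ((Cphi `^ p)%:E + (fine (LS G w) `^ p)%:E)))).
  apply: ae_ge0_le_integral => //.
  - apply/measurable_EFinP; apply: (measurableT_comp (measurable_powR p)).
    by apply: measurableT_comp => //; exact: measurable_funB.
  - move=> w _; rewrite -EFinD -EFinM lee_fin.
    by rewrite !mulr_ge0 ?powR_ge0 // addr_ge0 ?powR_ge0.
  - apply: measurable_funeM; apply: emeasurable_funD => //.
    apply/measurable_EFinP; apply: (measurableT_comp (measurable_powR p)).
    exact: mLSf.
  apply: filterS inc => w hw _; rewrite -EFinD -EFinM lee_fin.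
  have s0 : (0 <= Cphi + fine (LS G w))%R by rewrite addr_ge0.
  apply: (@le_trans _ _ ((db * (Cphi + fine (LS G w))) `^ p)%R).
    apply: ge0_ler_powR; rewrite ?nnegrE //; first exact: ltW.
    by rewrite mulr_ge0 // ltW.
  rewrite powRM ?(ltW db0) // -mulrA ler_wpM2l ?powR_ge0 //; exact: powD.
have mX : measurable_fun [set: Omega] (fun w => (fine (LS G w) `^ p)%:E).
  by apply/measurable_EFinP; apply: (measurableT_comp (measurable_powR p)); exact: mLSf.
rewrite ge0_integralZl_EFin; last 4 first.
- by [].
- by move=> w _; rewrite -EFinD lee_fin addr_ge0 ?powR_ge0.
- by apply: emeasurable_funD.
- by rewrite mulr_ge0 ?powR_ge0.
have c1 w : [set: Omega] w -> 0 <= (Cphi `^ p)%:E by rewrite lee_fin powR_ge0.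
have c2 w : [set: Omega] w -> 0 <= (fine (LS G w) `^ p)%:E by rewrite lee_fin powR_ge0.
rewrite (ge0_integralD P measurableT c1 (measurable_cst _) c2 mX).
rewrite (integral_cst P measurableT) [X in _ * X + _]probability_setT mule1.
have -> : (2 `^ p * (Cphi `^ p + C) * mdist x x' `^ (beta * p) =
    db `^ p * 2 `^ p * (Cphi `^ p + C))%R by rewrite /db -powRrM; ring.
rewrite (EFinM (db `^ p * 2 `^ p)); apply: lee_wpmul2l; first by rewrite lee_fin mulr_ge0 ?powR_ge0.
rewrite (EFinD (Cphi `^ p)); apply: leeD => //.
apply: (hC t G) => //.
- move=> s y /negP/negbTE e.
  by rewrite /G /kernel_quotient /past_kernel /= e subrr normr0 mul0r.
- have := hH1 t x x' tT' d0; congr (_ <= _); apply: eq_integral => q _.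
  by rewrite powRr1.
- exact: hHp.
Qed.

End volterra_increments.

(** * Kolmogorov's criterion in spaces of finite metric dimension *)

(* Only about #|V| pairs need to be controlled to control all close pairs of V: balls around
   a chosen point cannot grow by the factor [a] at each of n.+1 steps, so for some radius the
   pairs from the centre to the larger ball are few compared with the smaller ball, which is
   then removed. Taking all close pairs instead would only give exponents below
   beta - 2 * D / p. *)
Section pair_reduction.
Local Open Scope ring_scope.
Context {R : realType} (I : finType) (dist : I -> I -> R) (c a : R).
Hypothesis dist0 : forall x, dist x x <= 0.
Hypothesis dist_sym : forall x y, dist x y = dist y x.
Hypothesis dist_triangle : forall x y z, dist x z <= dist x y + dist y z.
Hypotheses (c0 : 0 <= c) (a1 : 1 <= a).

Let ball_in (V : {set I}) (t : I) (k : nat) : {set I} :=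
  [set s in V | dist t s <= c * k%:R].

Let ball_growth (V : {set I}) (t : I) n : t \in V -> #|V|%:R <= a ^+ n.+1 ->
  exists k, (k <= n)%N /\ #|ball_in V t k.+1|%:R <= a * #|ball_in V t k|%:R.
Proof.
move=> tV Vn; apply: contrapT => no.
have grow k : (k <= n.+1)%N -> (a ^+ k <= #|ball_in V t k|%:R).
  elim: k => [_|k IH kn].
    rewrite expr0 ler1n card_gt0; apply/set0Pn; exists t.
    by rewrite finset.inE tV mulr0 dist0.
  rewrite exprS; apply: (@le_trans _ _ (a * #|ball_in V t k|%:R)).
    by rewrite ler_wpM2l ?(le_trans ler01) // IH // ltnW.
  by rewrite leNgt; apply/negP => /ltW h; apply: no; exists k.
have last : ~ (#|ball_in V t n.+1|%:R <= a * #|ball_in V t n|%:R).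
  by move=> h; apply: no; exists n.
apply: last; apply: (@le_trans _ _ #|V|%:R).
  by rewrite ler_nat subset_leq_card //; apply/fintype.subsetP => s; rewrite finset.inE => /andP[].
apply: (le_trans Vn); rewrite exprS ler_wpM2l ?(le_trans ler01) // grow //.
Qed.

Lemma pair_reduction n (V : {set I}) : #|V|%:R <= a ^+ n.+1 ->
  exists U : {set I * I}, [/\ #|U|%:R <= a * #|V|%:R,
    forall u, u \in U -> dist u.1 u.2 <= c * n.+1%:R &
    forall s t, s \in V -> t \in V -> dist s t <= c ->
      exists2 t0, (t0, s) \in U & (t0, t) \in U].
Proof.
move: {2}#|V| (leqnn #|V|) => N; elim: N V => [|N IH] V VN Vn.
  have V0 : V = finset.set0 by apply/eqP; rewrite -cards_eq0 -leqn0.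
  exists finset.set0; split.
  - by rewrite cards0 mulr_ge0 // (le_trans ler01).
  - by move=> u; rewrite finset.inE.
  - by move=> s t; rewrite V0 finset.inE.
have [->|[t0 t0V]] := set_0Vmem V.
  exists finset.set0; split.
  - by rewrite cards0 mulr_ge0 // (le_trans ler01).
  - by move=> u; rewrite finset.inE.
  - by move=> s t; rewrite finset.inE.
have [k [kn grow]] := ball_growth t0V Vn.
set B := ball_in V t0 k in grow; set B1 := ball_in V t0 k.+1 in grow.
have BV : B \subset V by apply/fintype.subsetP => s; rewrite finset.inE => /andP[].
have t0B : t0 \in B.
  by rewrite finset.inE t0V /= (le_trans (dist0 t0)) // mulr_ge0.
have cardV : (#|V| = #|B| + #|V :\: B|)%N.
  by rewrite -(cardsID B V) (finset.setIidPr BV).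
have VBN : (#|V :\: B| <= N)%N.
  have : (0 < #|B|)%N by rewrite card_gt0; apply/set0Pn; exists t0.
  by move: VN; rewrite cardV; case: #|B| => // b; rewrite addSn ltnS => h _; apply: leq_trans h; exact: leq_addl.
have VBn : #|V :\: B|%:R <= a ^+ n.+1.
  by apply: le_trans Vn; rewrite ler_nat subset_leq_card // finset.subsetDl.
have [U [cU dU close]] := IH _ VBN VBn.
exists ([set (t0, s) | s in B1] :|: U); split.
- apply: (@le_trans _ _ (#|B1|%:R + #|U|%:R)).
    rewrite -natrD ler_nat; apply: (leq_trans (leq_card_setU _ _)).
    by rewrite leq_add2r leq_imset_card.
  by rewrite cardV natrD mulrDr; exact: lerD.
- move=> u; rewrite finset.inE => /orP[/imsetP[s sB ->]|]; last exact: dU.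
  move: sB; rewrite finset.inE => /andP[_ /le_trans]; apply => /=.
  by rewrite ler_wpM2l // ler_nat.
- move=> s t sV tV st.
  have inB x y : y \in V -> x \in B -> dist x y <= c -> y \in B1.
    rewrite !finset.inE => yV /andP[xV dx] xy; rewrite yV /=.
    by apply: (le_trans (dist_triangle t0 x y)); rewrite -natr1 mulrDr mulr1 lerD.
  have BB1 x : x \in B -> x \in B1.
    rewrite !finset.inE => /andP[-> /le_trans]; apply; by rewrite ler_wpM2l // ler_nat.
  have U1 x : x \in B1 -> (t0, x) \in [set (t0, s) | s in B1] :|: U.
    by move=> xB; rewrite finset.inE; apply/orP; left; apply/imsetP; exists x.
  case: (boolP (s \in B)) => [sB|sB].
    by exists t0; apply: U1; [exact: BB1|exact: inB tV sB st].
  case: (boolP (t \in B)) => [tB|tB].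
    by exists t0; apply: U1; [apply: inB sV tB _; rewrite dist_sym|exact: BB1].
  have [t1 h1 h2] : exists2 t1, (t1, s) \in U & (t1, t) \in U.
    by apply: close => //; rewrite finset.inE ?sB ?tB.
  by exists t1; rewrite finset.inE; apply/orP; right.
Qed.

End pair_reduction.

Section telescoping.
Local Open Scope ring_scope.
Context {R : realType}.

Lemma telescoping_cvg (y : nat -> R) (M r : R) : 0 <= M -> 0 <= r -> r < 1 ->
  (forall k, `|y k.+1 - y k| <= M * r ^+ k) ->
  exists2 L : R, y @ \oo --> L & forall k, `|y k - L| <= M / (1 - r) * r ^+ k.
Proof.
move=> M0 r0 r1 hy; set b := M / (1 - r).
have r1' : 0 < 1 - r by lra.
have bE : b * (1 - r) = M by rewrite /b divfK // gt_eqF.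
have b0 : 0 <= b by rewrite divr_ge0 // ltW.
pose u k := y k - b * r ^+ k; pose v k := y k + b * r ^+ k.
have step k : - (M * r ^+ k) <= y k.+1 - y k <= M * r ^+ k by rewrite -ler_norml.
have eqb k : b * r ^+ k - b * r ^+ k.+1 = M * r ^+ k by rewrite exprS -bE; ring.
have undec : nondecreasing_seq u.
  apply/nondecreasing_seqP => k; have /andP[h _] := step k; have := eqb k.
  rewrite /u; lra.
have vninc : nonincreasing_seq v.
  apply/nonincreasing_seqP => k; have /andP[_ h] := step k; have := eqb k.
  rewrite /v; lra.
have rk0 k : 0 <= b * r ^+ k by rewrite mulr_ge0 // exprn_ge0.
have uv i k : u i <= v k.
  apply: (@le_trans _ _ (u (maxn i k))); first exact: undec (leq_maxl _ _).
  apply: (@le_trans _ _ (v (maxn i k))); last exact: vninc (leq_maxr _ _).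
  rewrite /u /v; have := rk0 (maxn i k); lra.
have uub : has_ubound (range u) by exists (v 0%N) => _ [i _ <-].
have cu := nondecreasing_cvgn undec uub.
set L := sup (range u) in cu.
have uL k : u k <= L by apply: ub_le_sup => //; exists k.
have Lv k : L <= v k by apply: ge_sup; [exists (u 0%N), 0%N|move=> _ [i _ <-]].
exists L; last first.
  by move=> k; rewrite ler_norml; have := uL k; have := Lv k; rewrite /u /v; lra.
have cr : b * r ^+ k @[k --> \oo] --> 0.
  have nr : `|r| < 1 by rewrite ger0_norm.
  exact: (cvg_geometric b nr).
have -> : y = (fun k => u k + b * r ^+ k) by apply/funext => k; rewrite /u subrK.
by rewrite -[L]addr0; exact: cvgD cu cr.
Qed.

End telescoping.

Lemma geometric_ae_bounded d (T : measurableType d) (R : realType)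
    (mu : {measure set T -> \bar R}) (Z : nat -> T -> R) (C r : R) :
  (forall k, measurable_fun [set: T] (Z k)) -> (forall k w, 0 <= Z k w)%R ->
  (0 <= C)%R -> (0 <= r < 1)%R ->
  (forall k, \int[mu]_w (Z k w)%:E <= (C * r ^+ k)%:E) ->
  {ae mu, forall w, exists2 M : R, (0 <= M)%R & forall k, (Z k w <= M)%R}.
Proof.
move=> mZ Z0 C0 /andP[r0 r1] hZ.
pose S w := \sum_(k <oo) (Z k w)%:E.
have mZE k : measurable_fun [set: T] (fun w => (Z k w)%:E) by exact/measurable_EFinP.
have Z0E k w : 0 <= (Z k w)%:E by rewrite lee_fin.
have mS : measurable_fun [set: T] S by apply: ge0_emeasurable_sum => // k w _; exact: Z0E.
have S0 w : 0 <= S w by apply: nneseries_ge0.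
have geo n : (\sum_(0 <= k < n) C * r ^+ k <= C / (1 - r))%R.
  have r1' : (0 < 1 - r)%R by lra.
  rewrite -mulr_sumr ler_wpM2l // -div1r ler_pdivlMr //.
  suff -> : ((\sum_(0 <= k < n) r ^+ k) * (1 - r) = 1 - r ^+ n)%R.
    by rewrite gerBl exprn_ge0.
  elim: n => [|n IH]; first by rewrite big_geq // mul0r expr0 subrr.
  by rewrite big_nat_recr //= mulrDl IH exprS; ring.
have intS : \int[mu]_w S w <= (C / (1 - r))%:E.
  rewrite /S integral_nneseries //.
  apply: lime_le; first by apply: is_cvg_nneseries => k _ _; exact: integral_ge0.
  apply: nearW => n; apply: le_trans (_ : (\sum_(0 <= k < n) C * r ^+ k)%:E <= _); last by rewrite lee_fin.
  by rewrite -sumEFin; apply: lee_sum => k _.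
have iS : mu.-integrable [set: T] S.
  apply/integrableP; split => //; under eq_integral do rewrite gee0_abs //.
  exact: le_lt_trans intS (ltry _).
have := integrable_ae measurableT iS; apply: filterS => w /(_ Logic.I) Sf.
exists (fine (S w)); first by rewrite fine_ge0.
move=> k; rewrite -lee_fin fineK //.
apply: (@le_trans _ _ (\sum_(0 <= i < k.+1) (Z i w)%:E)).
  by rewrite big_nat_recr //= leeDr // sume_ge0.
exact: nneseries_lim_ge.
Qed.

Section dyadic_powers.
Local Open Scope ring_scope.
Context {R : realType}.
Implicit Types (a b s : R) (k : nat).

Definition dyadic k : R := (2 ^+ k)^-1.

Lemma dyadic_gt0 k : 0 < dyadic k. Proof. by rewrite invr_gt0 exprn_gt0. Qed.

Lemma dyadicS k : dyadic k = 2 * dyadic k.+1.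
Proof. by rewrite /dyadic exprS; field; rewrite expf_neq0. Qed.

Lemma powRX a s k : 0 <= a -> (a ^+ k) `^ s = (a `^ s) ^+ k.
Proof. by move=> a0; rewrite -!powR_mulrn ?powR_ge0 // -!powRrM mulrC. Qed.

Lemma powRV a s : 0 < a -> (a^-1) `^ s = (a `^ s)^-1.
Proof.
move=> a0; have an : a `^ s != 0 by rewrite gt_eqF // powR_gt0.
by apply: (mulfI an); rewrite -powRM ?invr_ge0 ?ltW // !mulfV ?powR1 // gt_eqF.
Qed.

Lemma dyadic_powR k s : dyadic k `^ s = ((2 `^ s)^-1) ^+ k.
Proof. by rewrite /dyadic powRV ?exprn_gt0 // powRX // exprVn. Qed.

Lemma powR2_lt1 s : s < 0 -> 2 `^ s < 1 :> R.
Proof.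
move=> s0; rewrite /powR pnatr_eq0 /= -[X in _ < X]expR0 ltr_expR.
by rewrite pmulr_llt0 // ln_gt0 // ltr1n.
Qed.

Lemma powR2V s : (2 `^ s)^-1 = 2 `^ (- s) :> R.
Proof. by rewrite powRN. Qed.

Lemma pow_root_le (x M p g : R) k : 0 < p -> 0 <= x -> 0 <= M ->
  x `^ p * (2 `^ (g * p)) ^+ k <= M -> x <= M `^ p^-1 * ((2 `^ g)^-1) ^+ k.
Proof.
move=> p0 x0 M0 h.
have g0 : 0 < (2 `^ g) ^+ k :> R by rewrite exprn_gt0 // powR_gt0.
rewrite exprVn ler_pdivlMr //.
have z0 : 0 <= x * (2 `^ g) ^+ k by rewrite mulr_ge0 // ltW.
have -> : x * (2 `^ g) ^+ k = ((x * (2 `^ g) ^+ k) `^ p) `^ p^-1.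
  by rewrite -powRrM mulfV ?powRr1 // gt_eqF.
apply: ge0_ler_powR; rewrite ?nnegrE ?powR_ge0 ?invr_ge0 ?(ltW p0) //.
by rewrite powRM ?(ltW g0) // powRX ?powR_ge0 // -powRrM.
Qed.

End dyadic_powers.

Section nets.
Context {R : realType} (E : pmetricType R).

Lemma covering_nets (c D : R) : (0 < c)%R -> (0 < D)%R ->
  (forall e, (0 < e <= 1)%R -> covering_number E e <= (c * e `^ (- D))%:E) ->
  exists (n : nat -> nat) (f : forall k, 'I_(n k) -> E),
    (forall k x, exists i, (mdist (f k i) x <= dyadic k)%R) /\
    forall k, ((n k)%:R <= (c + 1) * (2 `^ D) ^+ k :> R)%R.
Proof.
move=> c0 D0 hc.
have h k : {s : {n : nat & 'I_n -> E} |
    (forall x, exists i, (mdist (projT2 s i) x <= dyadic k)%R) /\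
    ((projT1 s)%:R <= (c + 1) * (2 `^ D) ^+ k :> R)%R}.
  apply: cid; have d1 : (0 < dyadic (R := R) k <= 1)%R.
    by rewrite dyadic_gt0 invf_le1 ?exprn_gt0 // exprn_ege1 // ler1n.
  have eD : (dyadic k `^ (- D) = (2 `^ D) ^+ k :> R)%R.
    by rewrite dyadic_powR powR2V opprK.
  have q1 : (1 <= (2 `^ D) ^+ k :> R)%R.
    rewrite exprn_ege1 // -[X in (X <= _)%R](powRr0 2); apply: ler_powR; last exact: ltW.
    by rewrite ler1n.
  apply: contrapT => no.
  have : ((c * dyadic k `^ (- D) + 1)%:E <= covering_number E (dyadic k)).
    apply: le_ereal_inf_tmp => _ [n [f cov] <-]; rewrite lee_fin leNgt; apply/negP => lt.
    apply: no; exists (existT _ n f) => /=; split.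
      by move=> x; have [i _ xi] := cov x Logic.I; exists i.
    by apply: (le_trans (ltW lt)); rewrite eD mulrDl mul1r lerD2l.
  move=> /le_trans /(_ (hc _ d1)); rewrite lee_fin; lra.
exists (fun k => projT1 (sval (h k))), (fun k => projT2 (sval (h k))).
by split => [k x|k]; have [h1 h2] := svalP (h k).
Qed.

Variables (n : nat -> nat) (f : forall k, 'I_(n k) -> E).
Hypothesis cover : forall k x, exists i, (mdist (@f k i) x <= @dyadic R k)%R.

Definition net_proj k (x : E) : E := @f k (sval (cid (cover k x))).

Definition two_scale k (s : 'I_(n k) + 'I_(n k.+1)) : E :=
  match s with inl i => @f k i | inr i => @f k.+1 i end.

Lemma net_proj_dist k x : (mdist (net_proj k x) x <= dyadic k)%R.
Proof. exact: (svalP (cid (cover k x))). Qed.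

Definition close_bound (v : E -> R) (alpha M : R) : Prop :=
  forall k (s t : 'I_(n k) + 'I_(n k.+1)),
    (mdist (two_scale s) (two_scale t) <= 3 * dyadic k)%R ->
    (`|v (two_scale s) - v (two_scale t)| <= M * ((2 `^ alpha)^-1) ^+ k)%R.

Definition net_limit (v : E -> R) (x : E) : R :=
  fine (limn_esup (fun k => (v (net_proj k x))%:E)).

Lemma net_limitE (v : E -> R) x (L : R) :
  (fun k => v (net_proj k x)) @ \oo --> L -> net_limit v x = L.
Proof.
move=> cL; rewrite /net_limit.
have : (fun k => (v (net_proj k x))%:E) @ \oo --> L%:E.
  by apply: cvg_EFin => //; exact: nearW.
by move=> /cvg_limn_einf_sup[_ ->].
Qed.

Lemma net_limit_holder (v : E -> R) (alpha M : R) : (0 < alpha)%R -> (0 <= M)%R ->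
  close_bound v alpha M -> holder_continuous alpha (net_limit v).
Proof.
move=> al0 M0 close; set r : R := ((2 `^ alpha)^-1)%R.
have r0 : (0 < r)%R by rewrite invr_gt0 powR_gt0.
have r1 : (r < 1)%R by rewrite /r powR2V powR2_lt1 // oppr_lt0.
pose y k x := v (net_proj k x).
have tele x : exists2 L : R, y ^~ x @ \oo --> L &
    forall k, (`|y k x - L| <= M / (1 - r) * r ^+ k)%R.
  apply: telescoping_cvg => //; first exact: ltW.
  move=> k; have := close k (inr (sval (cid (cover k.+1 x)))) (inl (sval (cid (cover k x)))).
  apply; rewrite /= -/(net_proj k.+1 x) -/(net_proj k x).
  apply: (le_trans (metric_triangle _ x _)); rewrite [mdist x _]metric_sym.
  have := net_proj_dist k x; have := net_proj_dist k.+1 x.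
  have := dyadicS (R := R) k; have := dyadic_gt0 (R := R) k.+1; lra.
set b := (M / (1 - r))%R in tele.
have b0 : (0 <= b)%R by rewrite divr_ge0 // subr_ge0 ltW.
have dist_lim k x : (`|y k x - net_limit v x| <= b * r ^+ k)%R.
  by have [L cL hL] := tele x; rewrite (net_limitE cL).
have split k x x' : (`|net_limit v x - net_limit v x'| <= 2 * b * r ^+ k + `|y k x - y k x'|)%R.
  have h1 := dist_lim k x; have h2 := dist_lim k x'; rewrite distrC in h1.
  have -> : (net_limit v x - net_limit v x' = (net_limit v x - y k x) +
    ((y k x - y k x') + (y k x' - net_limit v x')))%R by ring.
  apply: (le_trans (ler_normD _ _)).
  have := ler_normD (y k x - y k x')%R (y k x' - net_limit v x')%R; lra.
pose B := (\sum_i `|v (@f 0%N i)|)%R.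
have yB x : (`|y 0%N x| <= B)%R.
  rewrite /B (bigD1 (sval (cid (cover 0%N x)))) //=.
  by rewrite lerDl sumr_ge0.
have B0 : (0 <= B)%R by apply: sumr_ge0.
exists ((2 * b + M) * 2 `^ alpha + 2 * b + 2 * B)%R => x x'.
have C0 : (0 <= (2 * b + M) * 2 `^ alpha)%R by rewrite mulr_ge0 ?powR_ge0 // addr_ge0 // mulr_ge0.
have [->|xx'] := eqVneq x x'.
  by rewrite subrr normr0 mulr_ge0 ?powR_ge0 // !addr_ge0 // mulr_ge0.
have d0 : (0 < mdist x x')%R by rewrite mdist_gt0.
set dd := mdist x x' in d0 *.
have [d1|d1] := leP dd 1%R; last first.
  apply: (le_trans (split 0%N x x')); rewrite expr0 mulr1.
  have h1 := yB x; have h2 := yB x'; have h3 := ler_normB (y 0%N x) (y 0%N x').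
  have da : (1 <= dd `^ alpha)%R.
    by rewrite -(powRr0 dd); apply: ler_powR; exact: ltW.
  apply: (@le_trans _ _ ((2 * b + M) * 2 `^ alpha + 2 * b + 2 * B)%R); first by lra.
  by rewrite ler_peMr // !addr_ge0 // mulr_ge0.
have exk : exists k, (dyadic k.+1 < dd)%R.
  exists (Num.bound dd^-1); rewrite /dyadic invf_plt ?posrE ?exprn_gt0 //.
  have iv : (0 <= dd^-1)%R by rewrite invr_ge0 ltW.
  apply: (lt_le_trans (archi_boundP iv)); rewrite -natrX ler_nat.
  apply: (@leq_trans (2 ^ Num.bound (dd^-1)%R)%N); first exact/ltnW/ltn_expl.
  by rewrite leq_exp2l.
have [k kd kmin] := ex_minnP exk.
have dk : (dd <= dyadic k)%R.
  case: k kd kmin => [|k] kd kmin; first by rewrite /dyadic expr0 invr1.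
  by rewrite leNgt; apply/negP => /kmin; rewrite ltnn.
apply: (le_trans (split k x x')).
have yy : (`|y k x - y k x'| <= M * r ^+ k)%R.
  have := close k (inl (sval (cid (cover k x)))) (inl (sval (cid (cover k x')))).
  apply; rewrite /= -/(net_proj k x) -/(net_proj k x').
  apply: (le_trans (metric_triangle _ x _)).
  have := metric_triangle x x' (net_proj k x'); rewrite [mdist x' (net_proj k x')]metric_sym.
  have := net_proj_dist k x; have := net_proj_dist k x'; rewrite -/dd; lra.
have rk : (r ^+ k <= 2 `^ alpha * dd `^ alpha)%R.
  rewrite -dyadic_powR -powRM ?(ltW d0) //.
  apply: ge0_ler_powR; rewrite ?nnegrE ?(ltW (dyadic_gt0 _)) ?(ltW al0) //.
    by rewrite mulr_ge0 // ltW.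
  by rewrite dyadicS; lra.
apply: (@le_trans _ _ ((2 * b + M) * r ^+ k)%R); first by rewrite [X in (_ <= X)%R]mulrDl lerD2l.
apply: (@le_trans _ _ ((2 * b + M) * (2 `^ alpha * dd `^ alpha))%R).
  by rewrite ler_wpM2l // addr_ge0 // mulr_ge0.
rewrite mulrA ler_wpM2r ?powR_ge0 // -addrA lerDl addr_ge0 // mulr_ge0 //.
Qed.

End nets.

Section kolmogorov.
Context {R : realType} (E : pmetricType R) d (Omega : measurableType d) (P : probability Omega R).
Variables (Y : E -> Omega -> R) (p beta C : R).
Hypothesis mY : forall x, measurable_fun [set: Omega] (Y x).
Hypotheses (p0 : (0 < p)%R) (beta0 : (0 < beta)%R) (C0 : (0 <= C)%R).
Hypothesis hY : forall x x', \int[P]_w (`|Y x w - Y x' w| `^ p)%:E <=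
  (C * mdist x x' `^ (beta * p))%:E.
Variables (n : nat -> nat) (f : forall k, 'I_(n k) -> E) (c D : R).
Hypotheses (c0 : (0 < c)%R) (D0 : (0 < D)%R).
Hypothesis cover : forall k x, exists i, (mdist (@f k i) x <= @dyadic R k)%R.
Hypothesis card_net : forall k, ((n k)%:R <= (c + 1) * (2 `^ D) ^+ k :> R)%R.

Let bp0 : (0 < beta * p)%R. Proof. exact: mulr_gt0. Qed.

Let mYY x x' : measurable_fun [set: Omega] (fun w => `|Y x w - Y x' w| `^ p)%R.
Proof.
apply: (measurableT_comp (measurable_powR p)); apply: measurableT_comp => //.
exact: measurable_funB.
Qed.

Let mYYE x x' : measurable_fun [set: Omega] (fun w => (`|Y x w - Y x' w| `^ p)%:E).
Proof. exact/measurable_EFinP. Qed.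

Let pos x x' w : [set: Omega] w -> 0 <= (`|Y x w - Y x' w| `^ p)%:E.
Proof. by rewrite lee_fin powR_ge0. Qed.

Let increment_le x x' e : (mdist x x' <= e)%R ->
  \int[P]_w (`|Y x w - Y x' w| `^ p)%:E <= (C * e `^ (beta * p))%:E.
Proof.
move=> de; apply: (le_trans (hY x x')); rewrite lee_fin ler_wpM2l //.
apply: ge0_ler_powR; rewrite ?nnegrE ?(ltW bp0) ?mdist_ge0 //.
by apply: le_trans de; exact: mdist_ge0.
Qed.

Let powR2X s k : ((2 `^ s) ^+ k = 2 `^ (s * k%:R) :> R)%R.
Proof. by rewrite powRrM powR_mulrn // powR_ge0. Qed.

Lemma net_limit_ae x :
  {ae P, forall w, net_limit cover (Y ^~ w) x = Y x w}.
Proof.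
pose g := (beta / 2)%R; have g0 : (0 < g)%R by rewrite divr_gt0.
pose Z k w := (`|Y (net_proj cover k x) w - Y x w| `^ p * (2 `^ (g * p)) ^+ k)%R.
have Z0 k w : (0 <= Z k w)%R by rewrite mulr_ge0 ?powR_ge0 // exprn_ge0 // powR_ge0.
have mZ k : measurable_fun [set: Omega] (Z k) by apply: measurable_funM => //; exact: mYY.
pose rho : R := (2 `^ (- (g * p)))%R.
have rho01 : (0 <= rho < 1)%R.
  by rewrite /rho powR_ge0 powR2_lt1 // oppr_lt0 mulr_gt0.
have hZ k : \int[P]_w (Z k w)%:E <= (C * rho ^+ k)%:E.
  rewrite /Z; under eq_integral do rewrite mulrC EFinM.
  rewrite (ge0_integralZl_EFin P measurableT (pos _ _) (mYYE _ _)) ?exprn_ge0 ?powR_ge0 //.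
  apply: (@le_trans _ _ (((2 `^ (g * p)) ^+ k)%:E * (C * dyadic k `^ (beta * p))%:E)).
    apply: lee_wpmul2l; first by rewrite lee_fin exprn_ge0 // powR_ge0.
    by apply: increment_le; exact: net_proj_dist.
  rewrite -EFinM lee_fin mulrCA dyadic_powR -exprMn le_eqVlt; apply/orP; left; apply/eqP.
  congr (_ * _ ^+ _)%R; rewrite powR2V -powRD; last by rewrite pnatr_eq0 implybT.
  by congr (2 `^ _)%R; rewrite /g; field.
apply: filterS (geometric_ae_bounded mZ Z0 C0 rho01 hZ) => w [M M0 hM].
apply: net_limitE; pose r : R := ((2 `^ g)^-1)%R.
have nr : (`|r| < 1)%R.
  by rewrite ger0_norm ?invr_ge0 ?powR_ge0 // /r powR2V powR2_lt1 // oppr_lt0.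
have cr : (M `^ p^-1 * r ^+ k)%R @[k --> \oo] --> (0 : R)%R by exact: (cvg_geometric _ nr).
apply/cvgrPdist_lt => e e0; have nearr := cvgr_lt _ cr _ e0.
near=> k; rewrite distrC.
have hk : (M `^ p^-1 * r ^+ k < e)%R by near: k; exact: nearr.
apply: le_lt_trans hk; apply: pow_root_le => //; exact: hM.
Unshelve. all: by end_near. Qed.

(* The growth factor is the root of order [nn.+1] of the size of the net, with [nn] so large
   that the resulting loss D / nn.+1 fits into the gap between alpha * p and beta * p - D. *)
Lemma close_bound_ae alpha : (0 < alpha)%R -> (alpha * p < beta * p - D)%R ->
  {ae P, forall w, exists2 M : R, (0 <= M)%R & close_bound f (Y ^~ w) alpha M}.
Proof.
move=> al0 alp; pose gap := (beta * p - D - alpha * p)%R.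
have gap0 : (0 < gap)%R by rewrite /gap; lra.
pose nn := Num.bound (D / gap)%R; pose n1 : R := nn.+1%:R.
have n10 : (0 < n1)%R by [].
have Dn : (D / n1 < gap)%R.
  rewrite ltr_pdivrMr // mulrC -ltr_pdivrMr //.
  have Dg0 : (0 <= D / gap)%R by rewrite divr_ge0 // ltW.
  by apply: (lt_le_trans (archi_boundP Dg0)); rewrite ler_nat.
pose q : R := (2 `^ D)%R.
have q1 : (1 <= q)%R.
  by rewrite /q -[X in (X <= _)%R](powRr0 2); apply: ler_powR; [rewrite ler1n|exact: ltW].
pose c2 := ((c + 1) * (1 + q))%R.
have c21 : (1 <= c2)%R.
  by apply: mulr_ege1; [rewrite lerDr ltW|rewrite lerDl (le_trans ler01)].
pose Nk k := (c2 * q ^+ k)%R.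
have qk1 k : (1 <= q ^+ k)%R by rewrite exprn_ege1.
have Nk1 k : (1 <= Nk k)%R by apply: mulr_ege1.
have Nk0 k : (0 <= Nk k)%R by exact: le_trans ler01 (Nk1 k).
pose a k := (Nk k `^ n1^-1)%R.
have a1 k : (1 <= a k)%R.
  by rewrite /a -[X in (X <= _)%R](powRr0 (Nk k)); apply: ler_powR => //; rewrite invr_ge0 ltW.
have an k : (a k ^+ nn.+1 = Nk k)%R.
  by rewrite -powR_mulrn ?powR_ge0 // /a -powRrM mulVf ?powRr1 // gt_eqF.
pose I k : finType := ('I_(n k) + 'I_(n k.+1))%type.
have cardI k : ((#|[set: I k]%SET|%:R : R) <= Nk k)%R.
  rewrite cardsT card_sum !card_ord natrD /Nk.
  have h1 := card_net k; have h2 := card_net k.+1; rewrite exprS in h2.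
  apply: (le_trans (lerD h1 h2)); rewrite -/q /c2 le_eqVlt; apply/orP; left; apply/eqP; ring.
pose pt k : I k -> E := @two_scale R E n f k.
have I3 k : (0 <= 3 * dyadic (R := R) k)%R by rewrite mulr_ge0 // ltW // dyadic_gt0.
have red k : exists U : {set I k * I k}, [/\ (#|U|%:R <= a k * Nk k)%R,
    forall u, u \in U -> (mdist (pt k u.1) (pt k u.2) <= 3 * dyadic k * n1)%R &
    forall s t, (mdist (pt k s) (pt k t) <= 3 * dyadic k)%R ->
      exists2 t0, (t0, s) \in U & (t0, t) \in U].
  have d0 x : (mdist (pt k x) (pt k x) <= 0)%R by rewrite mdistxx.
  have hV : (#|[set: I k]%SET|%:R <= a k ^+ nn.+1)%R by rewrite an.
  have [U [cU dU close]] := @pair_reduction R (I k) (fun s t => mdist (pt k s) (pt k t))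
    (3 * dyadic k)%R (a k) d0 (fun x y => metric_sym _ _)
    (fun x y z => metric_triangle _ _ _) (I3 k) (a1 k) nn [set: I k]%SET hV.
  exists U; split => //.
    by apply: (le_trans cU); rewrite ler_wpM2l // (le_trans ler01).
  by move=> s t st; apply: close; rewrite ?finset.inE.
pose U k := sval (cid (red k)).
have cU k : (#|U k|%:R <= a k * Nk k)%R by have [] := svalP (cid (red k)).
have dU k u : u \in U k -> (mdist (pt k u.1) (pt k u.2) <= 3 * dyadic k * n1)%R.
  by have [_ h _] := svalP (cid (red k)); exact: h.
have closeU k s t : (mdist (pt k s) (pt k t) <= 3 * dyadic k)%R ->
    exists2 t0, (t0, s) \in U k & (t0, t) \in U k.
  by have [_ _ h] := svalP (cid (red k)); exact: h.
pose Z k w := ((\sum_(u in U k) `|Y (pt k u.1) w - Y (pt k u.2) w| `^ p) * (2 `^ (alpha * p)) ^+ k)%R.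
have e0 k : (0 <= (2 `^ (alpha * p)) ^+ k :> R)%R by rewrite exprn_ge0 // powR_ge0.
have Z0 k w : (0 <= Z k w)%R by rewrite mulr_ge0 // sumr_ge0 // => u _; rewrite powR_ge0.
have mS k : measurable_fun [set: Omega] (fun w => \sum_(u in U k) `|Y (pt k u.1) w - Y (pt k u.2) w| `^ p)%R.
  under eq_fun do rewrite -big_enum /=.
  by apply: measurable_sum => u; exact: mYY.
have mZ k : measurable_fun [set: Omega] (Z k) by apply: measurable_funM.
pose s1 := (n1^-1 + 1)%R.
pose rho : R := (2 `^ (D * s1 - beta * p + alpha * p))%R.
have rho01 : (0 <= rho < 1)%R.
  rewrite /rho powR_ge0 powR2_lt1 //.
  move: Dn; rewrite /s1 /gap mulrDr mulr1; move: (D / n1)%R => z zD; lra.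
pose C1 := (c2 `^ s1 * (C * (3 * n1) `^ (beta * p)))%R.
have C10 : (0 <= C1)%R by rewrite !mulr_ge0 ?powR_ge0.
have rhoE k : (a k * Nk k * (C * (3 * dyadic k * n1) `^ (beta * p)) * (2 `^ (alpha * p)) ^+ k
    = C1 * rho ^+ k)%R.
  have -> : (a k * Nk k = c2 `^ s1 * (2 `^ (D * s1)) ^+ k)%R.
    have c20 : (0 <= c2)%R by exact: le_trans ler01 c21.
    have N00 : (Nk k != 0)%R by rewrite gt_eqF // (lt_le_trans ltr01).
    rewrite /a -[X in (_ * X)%R](powRr1 (Nk0 k)) -powRD; last by rewrite N00 implybT.
    rewrite -/s1 /Nk powRM // ?exprn_ge0 ?powR_ge0 // powRX ?powR_ge0 //.
    by rewrite /q -powRrM.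
  have -> : (3 * dyadic k * n1 = 3 * n1 * dyadic k)%R by ring.
  rewrite powRM ?mulr_ge0 ?(ltW n10) ?(ltW (dyadic_gt0 _)) // dyadic_powR powR2V.
  have two (u v : R) : (2 `^ (u + v) = 2 `^ u * 2 `^ v :> R)%R.
    by rewrite powRD // pnatr_eq0 implybT.
  rewrite /rho !two.
  by rewrite !exprMn /C1; ring.
have hZ k : \int[P]_w (Z k w)%:E <= (C1 * rho ^+ k)%:E.
  rewrite /Z; under eq_integral do rewrite mulrC EFinM.
  rewrite (ge0_integralZl_EFin P measurableT) //; last 2 first.
  - by move=> w _; rewrite lee_fin sumr_ge0 // => u _; rewrite powR_ge0.
  - exact/measurable_EFinP.
  rewrite -rhoE [X in _ <= X%:E]mulrC EFinM; apply: lee_wpmul2l; first by rewrite lee_fin.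
  under eq_integral do rewrite -sumEFin -big_enum /=.
  rewrite ge0_integral_sum // big_enum /=.
  apply: (@le_trans _ _ (\sum_(u in U k) (C * (3 * dyadic k * n1) `^ (beta * p))%:E)).
    by apply: lee_sum => u uU; apply: increment_le; exact: dU.
  rewrite sumEFin lee_fin sumr_const -[X in (X <= _)%R]mulr_natl ler_wpM2r //.
  by rewrite mulr_ge0 ?powR_ge0.
apply: filterS (geometric_ae_bounded mZ Z0 C10 rho01 hZ) => w [M M0 hM].
exists (2 * M `^ p^-1)%R; first by rewrite mulr_ge0 ?powR_ge0.
move=> k s t /closeU[t0 h1 h2].
have one u : u \in U k -> (`|Y (pt k u.1) w - Y (pt k u.2) w| <= M `^ p^-1 * ((2 `^ alpha)^-1) ^+ k)%R.
  move=> uU; apply: pow_root_le => //.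
  apply: le_trans (hM k); rewrite /Z ler_wpM2r //.
  rewrite (bigD1 u) //= lerDl; apply: sumr_ge0 => v _; exact: powR_ge0.
have /= o1 := one _ h1; have /= o2 := one _ h2; rewrite distrC in o1.
have -> : (Y (two_scale f s) w - Y (two_scale f t) w = (Y (pt k s) w - Y (pt k t0) w) +
  (Y (pt k t0) w - Y (pt k t) w))%R by rewrite /pt; ring.
apply: (le_trans (ler_normD _ _)); rewrite -mulrA mulr_natl mulr2n; exact: lerD.
Qed.

End kolmogorov.

Lemma kolmogorov_holder {R : realType} (E : pmetricType R) d (Omega : measurableType d)
    (P : probability Omega R) (Y : E -> Omega -> R) (p beta C c D : R) :
  (forall x, measurable_fun [set: Omega] (Y x)) -> (0 < p)%R -> (0 < beta)%R -> (0 <= C)%R ->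
  (forall x x', \int[P]_w (`|Y x w - Y x' w| `^ p)%:E <= (C * mdist x x' `^ (beta * p))%:E) ->
  (0 < c)%R -> (0 < D)%R ->
  (forall e, (0 < e <= 1)%R -> covering_number E e <= (c * e `^ (- D))%:E) ->
  (D < beta * p)%R ->
  exists W : E -> Omega -> R, [/\ forall x, measurable_fun [set: Omega] (W x),
    forall x, {ae P, forall w, W x w = Y x w} &
    {ae P, forall w, forall alpha, (0 < alpha < beta - D / p)%R ->
      holder_continuous alpha (fun x => W x w)}].
Proof.
move=> mY p0 beta0 C0 hY c0 D0 hcover hbp.
have [n [f [cover card_net]]] := covering_nets c0 D0 hcover.
exists (fun x w => net_limit cover (Y ^~ w) x); split.
- move=> x; apply: measurableT_comp => //; apply: measurable_fun_limn_esup => k.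
  exact/measurable_EFinP.
- by move=> x; exact: (net_limit_ae mY p0 beta0 C0 hY cover).
pose kap := (beta - D / p)%R.
have kap0 : (0 < kap)%R by rewrite subr_gt0 ltr_pdivrMr.
pose al (j : nat) := (kap * (1 - j.+2%:R^-1))%R.
have al0 j : (0 < al j)%R by rewrite mulr_gt0 // subr_gt0 invf_lt1 // ltr1n.
have alp j : (al j * p < beta * p - D)%R.
  have -> : (beta * p - D = kap * p)%R by rewrite /kap mulrBl divfK // gt_eqF.
  by rewrite ltr_pM2r // /al gtr_pMr // gerBl.
have := ae_foralln (fun j => close_bound_ae mY p0 beta0 C0 hY f c0 D0 card_net (al0 j) (alp j)).
apply: filterS => w hw alpha /andP[a0 ak].
have [j hj] : exists j, (alpha <= al j)%R.
  have g0 : (0 < kap - alpha)%R by rewrite subr_gt0.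
  have b0 : (0 <= kap / (kap - alpha))%R by rewrite divr_ge0 // ltW.
  exists (Num.bound (kap / (kap - alpha))%R); set j := Num.bound _.
  have hj : (kap / (kap - alpha) < j.+2%:R)%R.
    by apply: (lt_le_trans (archi_boundP b0)); rewrite ler_nat ltnW // ltnW.
  have : (kap / j.+2%:R <= kap - alpha)%R.
    by rewrite ler_pdivrMr // mulrC -ler_pdivrMr // ltW.
  rewrite /al mulrBr mulr1; move: (kap) (kap / _)%R => B z zB; lra.
have [M M0 close] := hw j.
have close' : close_bound f (Y ^~ w) alpha M.
  move=> k s t st; apply: (le_trans (close k s t st)); rewrite ler_wpM2l //.
  rewrite lerXn2r ?nnegrE ?invr_ge0 ?powR_ge0 // lef_pV2 ?posrE ?powR_gt0 //.
  by apply: ler_powR => //; rewrite ler1n.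
exact: (net_limit_holder cover a0 M0 close').
Qed.

Theorem theorem7p2 (R : realType) (d : measure_display)
  (Omega : measurableType d) (P : probability Omega R)
  (hP : measure_is_complete P)
  (T : R) (hT : (0 < T)%R)
  (E : pmetricType R) (hE : polish R E)
  (m : {finite_measure set (borel E) -> \bar R})
  (l : {measure set R -> \bar R})
  (hl : l `]-oo, 0%R]%classic = 0)
  (hl1 : \int[l]_(z in `]0%R, +oo[) z%:E < +oo)
  (N : Omega -> {measure set (R * borel E * R * R) -> \bar R})
  (hN : poisson_random_measure P (marks T) (intensity m l) N)
  (K : R -> E -> E -> R) (hK : admissible_kernel T m K)
  (lambda0 lambda1 : R) (hlambda0 : (0 <= lambda0)%R)
  (hlambda1 : (0 <= lambda1)%R)
  (phi : R -> E -> R) (hphi : initial_field T phi)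
  (V : R -> E -> Omega -> \bar R)
  (hV : volterra_solution T P N K lambda0 lambda1 phi V)
  (p : R) (hp : (2 <= p)%R)
  (hlp : \int[l]_(z in `]0%R, +oo[) (z `^ p)%:E < +oo)
  (hk2 : lebesgue_measure.-integrable `]0%R, T] (kernel_sup m K 2))
  (hkp : lebesgue_measure.-integrable `]0%R, T] (kernel_sup m K p))
  (beta : R) (hbeta : (0 < beta <= 1)%R)
  (Cphi : R) (hCphi : (0 <= Cphi)%R)
  (h : R -> R -> R)
  (hh : forall q, q \in [:: 1%R; 2%R; p] ->
     (forall r, (0 <= r <= T)%R -> (0 <= h q r)%R) /\ in_Lq q `[0%R, T] (h q))
  (hphi_holder : forall x x' : E,
     ereal_sup [set `|phi t x - phi t x'|%:E | t in `[0%R, T]] <=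
     (Cphi * mdist x x' `^ beta)%:E)
  (hK_holder : forall q r (x x' : E), q \in [:: 1%R; 2%R; p] ->
     (0 < r <= T)%R ->
     (\int[m]_y (`|K r x y - K r x' y| `^ q)%:E) `^ q^-1 <=
     (h q r * mdist x x' `^ beta)%:E)
  (hcompact : compact [set: E])
  (c D : R) (hc : (0 < c)%R) (hD : (0 < D)%R)
  (hcover : forall e, (0 < e <= 1)%R ->
     covering_number E e <= (c * e `^ (- D))%:E)
  (hbp : (D < beta * p)%R) :
  forall t, (0 <= t <= T)%R ->
    exists W : E -> Omega -> R,
      spatial_modification P V t W /\
      {ae P, forall w, forall alpha, (0 < alpha < beta - D / p)%R ->
        holder_continuous alpha (fun x => W x w)}.
Proof.
have p1 : (1 <= p)%R by exact: le_trans (ler1n _ 2) hp.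
have p0 : (0 < p)%R by exact: lt_le_trans ltr01 p1.
have [beta0 _] := andP hbeta.
have [C C0 hC] := volterra_increment hP hT hN hK hlambda0 hlambda1 p1 hphi hV hl1 hlp hkp
  hCphi hh hphi_holder hK_holder.
move=> t tT; have [Y [mY VY] incY] := hC t tT.
have [W [mW WY holdW]] := kolmogorov_holder mY p0 beta0 C0 incY hc hD hcover hbp.
exists W; split => //; split => // x.
have [A [mA PA sub]] : {ae P, forall w, (W x w)%:E = V t x w}.
  by apply: filterS2 (VY x) (WY x) => w -> ->.
have nA : P.-negligible (~` [set w | (W x w)%:E = V t x w]) by exists A.
have mC := hP _ nA.
have mS : measurable [set w | (W x w)%:E = V t x w].
  by rewrite -[X in measurable X]setCK; exact: measurableC.
have e := probability_setC P mC; rewrite setCK in e.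
by rewrite e (measure_negligible mC nA) sube0.
Qed.
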